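(* Let $n\ge 1$ be an integer and $T>0$ (possibly $T=\infty$). Then for all $w^0,\theta^0\in H^2\cap H^1_0(0,L)$ and $w^1,\theta^1\in L^2(0,L)$ there exists a unique couple $(w_n,\theta_n)\in X_T^2$ of the form $$w_n(x,t)=\sum_{k=1}^n w_n^k(t)e_k(x),\qquad \theta_n(x,t)=\sum_{k=1}^n\theta_n^k(t)e_k(x)$$ solving, for $r=1,\dots,n$ (and $k=1,\dots,n$ in the initial conditions), the system $$\begin{cases} M\big((w_n)_{tt},e_r\big)_2+EI\,(w_n,e_r)_{H^2}-(Mg,e_r)_2=\big(h_\alpha(w_n,\theta_n),[\mathcal{J}_\alpha^{e_r}]'\big)_2+\big(h_\beta(w_n,\theta_n),[\mathcal{J}_\beta^{e_r}]'\big)_2,\\[1mm] \dfrac{M\ell}{3}\big((\theta_n)_{tt},e_r\big)_2+\dfrac{EJ}{\ell}(\theta_n,e_r)_{H^2}+\dfrac{GK}{\ell}(\theta_n,e_r)_{H^1}=\big(h_\alpha(w_n,\theta_n),[\mathcal{G}_\alpha^{\theta_n,e_r}]_x\big)_2-\big(h_\beta(w_n,\theta_n),[\mathcal{G}_\beta^{\theta_n,e_r}]_x\big)_2,\\[1mm] w_n^k(0)=(w^0,e_k)_2,\quad \theta_n^k(0)=(\theta^0,e_k)_2,\quad \dot w_n^k(0)=(w^1,e_k)_2,\quad \dot\theta_n^k(0)=(\theta^1,e_k)_2. \end{cases}$$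
   Context: Constants: $L,\ell,M,g,E,I,J,G,K,H,A,E_c,y_0,s_0$ are positive constants ($s_0$ is the cable sag). Products such as $EI$, $EJ$, $GK$, $Mg$ are products of constants. Cable at rest: $y(x)=-\frac{4s_0}{L^2}x^2+\frac{4s_0}{L}x-y_0$ on $[0,L]$; $L_c:=\int_0^L\sqrt{1+(y')^2}\,dx$; $\overline\xi:=\frac1L\int_0^L\sqrt{1+(y')^2}\,dx$. Function spaces: $(u,v)_2=\int_0^L uv$, $(u,v)_{H^1}=\int_0^L u'v'$, $(u,v)_{H^2}=\int_0^L u''v''$ are the scalar products on $L^2(0,L)$, $H^1_0(0,L)$, $H^2\cap H^1_0(0,L)$; $H^*(0,L)$ is the dual of $H^2\cap H^1_0(0,L)$; $$X_T:=C^0([0,T];H^2\cap H^1_0(0,L))\cap C^1([0,T];L^2(0,L))\cap C^2([0,T];H^*(0,L))$$ (with $[0,\infty)$ in place of $[0,T]$ if $T=\infty$). The basis is $e_k(x)=\sqrt{2/L}\,\sin(k\pi x/L)$. Subscripts $x,t$ denote partial derivatives, dots denote $t$-derivatives, primes denote $x$-derivatives. Convexification: for $f\in C^1[0,L]$, $f^{**}$ is the convex envelope on $[0,L]$ (largest convex function $\le f$), and $K_f:=\{x\in(0,L):f(x)=f^{**}(x)\}$. For functions depending also on $t$, convexification is in $x$ at each fixed $t$. Nonlinearities: for $u\in C^1[0,L]$, $\Gamma(u):=\int_0^L\sqrt{1+\{[(u+y)^{**}]_x\}^2}\,dx-L_c$, and $$h_\alpha(Z,\Theta):=-\Big(H\overline\xi+\tfrac{AE_c}{L_c}\Gamma(Z+\ell\sin\Theta)\Big)\frac{[(Z+\ell\sin\Theta+y)^{**}]_x}{\sqrt{1+\{[(Z+\ell\sin\Theta+y)^{**}]_x\}^2}},$$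 $$h_\beta(Z,\Theta):=-\Big(H\overline\xi+\tfrac{AE_c}{L_c}\Gamma(Z-\ell\sin\Theta)\Big)\frac{[(Z-\ell\sin\Theta+y)^{**}]_x}{\sqrt{1+\{[(Z-\ell\sin\Theta+y)^{**}]_x\}^2}}.$$ Modified test functions: at each $t$ put $f_\alpha=w_n+\ell\sin\theta_n+y$, $f_\beta=w_n-\ell\sin\theta_n+y$. For $\nu\in\{\alpha,\beta\}$ let $I^i_\nu=(a^i_\nu,b^i_\nu)$ be the connected components of $(0,L)\setminus K_{f_\nu}$. For a function $q$ continuous on $[0,L]$ let $\mathcal{L}_\nu q$ be the function equal to $q(a^i_\nu)+\frac{q(b^i_\nu)-q(a^i_\nu)}{b^i_\nu-a^i_\nu}(x-a^i_\nu)$ on each $I^i_\nu$ and equal to $q$ elsewhere on $[0,L]$. Then $\mathcal{J}^{e_r}_\nu:=\mathcal{L}_\nu e_r$ and $\mathcal{G}^{\theta_n,e_r}_\nu:=\mathcal{L}_\nu(e_r\cos\theta_n)$; their $x$-derivatives exist a.e. *)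

(* Defs.v *)
From HB Require Import structures.
From mathcomp Require Import all_boot all_order all_algebra.
From mathcomp Require Import all_classical all_reals all_analysis.
Set Implicit Arguments.
Unset Strict Implicit.
Unset Printing Implicit Defensive.
Import Order.TTheory GRing.Theory Num.Theory.
Import numFieldNormedType.Exports.
Local Open Scope classical_set_scope.
Local Open Scope ring_scope.

(* The positive constants of the model; [cs0] is the cable sag. *)
Record constants (R : realType) := Constants {
  cL : R; cell : R; cM : R; cg : R; cE : R; cI : R; cJ : R; cG : R;
  cK : R; cH : R; cA : R; cEc : R; cy0 : R; cs0 : R;
  cL_gt0 : 0 < cL; cell_gt0 : 0 < cell; cM_gt0 : 0 < cM; cg_gt0 : 0 < cg;
  cE_gt0 : 0 < cE; cI_gt0 : 0 < cI; cJ_gt0 : 0 < cJ; cG_gt0 : 0 < cG;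
  cK_gt0 : 0 < cK; cH_gt0 : 0 < cH; cA_gt0 : 0 < cA; cEc_gt0 : 0 < cEc;
  cy0_gt0 : 0 < cy0; cs0_gt0 : 0 < cs0 }.

(* Functions on [0, L] are represented by functions R -> R; none of the
   notions below depends on their values outside [0, L]. *)

Definition int0L (R : realType) (L : R) (f : R -> R) : R :=
  \int[lebesgue_measure]_(x in `]0, L[) f x.

Definition ip2 (R : realType) (L : R) (u v : R -> R) : R :=
  int0L L (fun x => u x * v x).

Definition L2 (R : realType) (L : R) : set (R -> R) :=
  [set u | (u \_ `]0, L[) \in Lfun lebesgue_measure 2%:E].

Definition norm2 (R : realType) (L : R) (u : R -> R) : R :=
  Num.sqrt (ip2 L u u).

(* C^1_c(0, L), extended by zero to R *)
Definition test_function (R : realType) (L : R) (phi : R -> R) : Prop :=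
  [/\ forall x, derivable phi x 1,
      continuous (derive1 phi) &
      exists a b, [/\ 0 < a, b < L &
        forall x, phi x != 0 -> a <= x <= b]].

Definition weak_derivative (R : realType) (L : R) (u v : R -> R) : Prop :=
  forall phi, test_function L phi -> ip2 L u (derive1 phi) = - ip2 L v phi.

(* A chosen representative of the weak derivative, unique up to a null set;
   meaningful only when there is one in L^2(0, L). *)
Definition wderiv (R : realType) (L : R) (u : R -> R) : R -> R :=
  get [set v | L2 L v /\ weak_derivative L u v].

Definition H1 (R : realType) (L : R) : set (R -> R) :=
  [set u | L2 L u /\ exists v, L2 L v /\ weak_derivative L u v].

Definition H2 (R : realType) (L : R) : set (R -> R) :=
  [set u | H1 L u /\ H1 L (wderiv L u)].

(* The elements of H^1_0(0, L) are represented by their continuous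
   representative on [0, L], which vanishes at both ends. *)
Definition H10 (R : realType) (L : R) : set (R -> R) :=
  [set u | [/\ H1 L u, {within `[0, L], continuous u}, u 0 = 0 & u L = 0]].

Definition H2H10 (R : realType) (L : R) : set (R -> R) := H2 L `&` H10 L.

Definition ipH1 (R : realType) (L : R) (u v : R -> R) : R :=
  ip2 L (wderiv L u) (wderiv L v).

Definition ipH2 (R : realType) (L : R) (u v : R -> R) : R :=
  ip2 L (wderiv L (wderiv L u)) (wderiv L (wderiv L v)).

Definition normH2 (R : realType) (L : R) (u : R -> R) : R :=
  Num.sqrt (ipH2 L u u).

(* H^*(0, L): only the values of a functional on H^2 \cap H^1_0 matter. *)
Definition Hstar (R : realType) (L : R) : set ((R -> R) -> R) :=
  [set F | (forall (a : R) (u v : R -> R), H2H10 L u -> H2H10 L v ->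
              F (fun x => a * u x + v x) = a * F u + F v) /\
           exists C : R, forall v, H2H10 L v -> `|F v| <= C * normH2 L v].

Definition normHstar (R : realType) (L : R) (F : (R -> R) -> R) : R :=
  sup [set `|F v| | v in [set v | H2H10 L v /\ normH2 L v <= 1]].

(* C^k(D; V) for a time set D and a space V given as a subset of a vector
   space Y with a (semi)norm N; at an end point of D derivatives are
   one-sided. *)
Definition C0_in (R : realType) (Y : lmodType R) (V : set Y) (N : Y -> R)
    (D : set R) (u : R -> Y) : Prop :=
  forall t, D t -> V (u t) /\ N (u s - u t) @[s --> within D (nbhs t)] --> 0.

Definition deriv_in (R : realType) (Y : lmodType R) (N : Y -> R)
    (D : set R) (u u1 : R -> Y) : Prop :=
  forall t, D t ->
    N ((s - t)^-1 *: (u s - u t) - u1 t) @[s --> within D t^'] --> 0.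

Fixpoint Ck_in (R : realType) (Y : lmodType R) (k : nat) (V : set Y)
    (N : Y -> R) (D : set R) (u : R -> Y) : Prop :=
  C0_in V N D u /\
  if k is j.+1 then exists u1, deriv_in N D u u1 /\ Ck_in j V N D u1
  else True.

(* X_T, where D is [0, T] or [0, +oo[. In the last condition L^2 is embedded
   in H^* through the scalar product of L^2. *)
Definition XT (R : realType) (L : R) (D : set R) : set (R -> R -> R) :=
  [set w | [/\ Ck_in 0 (H2H10 L) (normH2 L) D w,
               Ck_in 1 (L2 L) (norm2 L) D w &
               Ck_in 2 (Hstar L) (normHstar L) D (fun t v => ip2 L (w t) v)]].

Definition time_domain (R : realType) (T : \bar R) : set R :=
  [set t | 0 <= t /\ (t%:E <= T)%E].

Definition dt (R : realType) (D : set R) (f : R -> R) (t : R) : R :=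
  lim ((s - t)^-1 * (f s - f t) @[s --> within D t^']).

Definition e_ (R : realType) (L : R) (k : nat) (x : R) : R :=
  Num.sqrt (2 / L) * sin (k%:R * pi * x / L).

Definition conv_env (R : realType) (L : R) (f : R -> R) (x : R) : R :=
  sup [set g x | g in [set g : R -> R |
    convex_function (`[0, L]%classic : set R) g /\
    forall z, z \in `[0, L] -> g z <= f z]].

Definition contact_set (R : realType) (L : R) (f : R -> R) : set R :=
  [set x | 0 < x < L /\ f x = conv_env L f x].

(* The operator L_nu attached to f = f_nu: affine interpolation of q on each
   connected component ]a, b[ of ]0, L[ \ K_f. *)
Definition affine_on_gaps (R : realType) (L : R) (f q : R -> R) (x : R) : R :=
  let gaps := `]0, L[%classic `\` contact_set L f in
  if x \in gaps then
    let a := inf (connected_component gaps x) in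
    let b := sup (connected_component gaps x) in
    q a + (q b - q a) / (b - a) * (x - a)
  else q x.

Definition yrest (R : realType) (c : constants R) (x : R) : R :=
  - (4 * cs0 c / cL c ^+ 2) * x ^+ 2 + 4 * cs0 c / cL c * x - cy0 c.

Definition cable_length (R : realType) (c : constants R) : R :=
  int0L (cL c) (fun x => Num.sqrt (1 + derive1 (yrest c) x ^+ 2)).

Definition xibar (R : realType) (c : constants R) : R :=
  (cL c)^-1 * int0L (cL c) (fun x => Num.sqrt (1 + derive1 (yrest c) x ^+ 2)).

(* [(u + y)^{**}]_x *)
Definition slope (R : realType) (c : constants R) (u : R -> R) : R -> R :=
  derive1 (conv_env (cL c) (u \+ yrest c)).

Definition Gamma (R : realType) (c : constants R) (u : R -> R) : R :=
  int0L (cL c) (fun x => Num.sqrt (1 + slope c u x ^+ 2)) - cable_length c.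

Definition hfun (R : realType) (c : constants R) (u : R -> R) (x : R) : R :=
  - (cH c * xibar c + cA c * cEc c / cable_length c * Gamma c u)
  * (slope c u x / Num.sqrt (1 + slope c u x ^+ 2)).

Definition u_alpha (R : realType) (c : constants R) (Z Th : R -> R) : R -> R :=
  fun x => Z x + cell c * sin (Th x).

Definition u_beta (R : realType) (c : constants R) (Z Th : R -> R) : R -> R :=
  fun x => Z x - cell c * sin (Th x).

Definition h_alpha (R : realType) (c : constants R) (Z Th : R -> R) : R -> R :=
  hfun c (u_alpha c Z Th).

Definition h_beta (R : realType) (c : constants R) (Z Th : R -> R) : R -> R :=
  hfun c (u_beta c Z Th).

(* Modified test functions at a fixed time, for w = w_n(t), th = theta_n(t) *)
Definition J_alpha (R : realType) (c : constants R) (w th e : R -> R) :=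
  affine_on_gaps (cL c) (u_alpha c w th \+ yrest c) e.

Definition J_beta (R : realType) (c : constants R) (w th e : R -> R) :=
  affine_on_gaps (cL c) (u_beta c w th \+ yrest c) e.

Definition G_alpha (R : realType) (c : constants R) (w th e : R -> R) :=
  affine_on_gaps (cL c) (u_alpha c w th \+ yrest c) (fun x => e x * cos (th x)).

Definition G_beta (R : realType) (c : constants R) (w th e : R -> R) :=
  affine_on_gaps (cL c) (u_beta c w th \+ yrest c) (fun x => e x * cos (th x)).

Definition expansion (R : realType) (L : R) (D : set R) (n : nat)
    (wk : nat -> R -> R) (w : R -> R -> R) : Prop :=
  forall t x, D t -> x \in `[0, L] ->
    w t x = \sum_(1 <= k < n.+1) wk k t * e_ L k x.

(* [w t x] and [th t x] stand for w_n(x,t) and theta_n(x,t). *)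
Definition galerkin_solution (R : realType) (c : constants R) (n : nat)
    (T : \bar R) (w0 th0 w1 th1 : R -> R) (w th : R -> R -> R) : Prop :=
  let L := cL c in
  let D := time_domain T in
  let tt u t := fun x => dt D (dt D (u ^~ x)) t in
  [/\ XT L D w, XT L D th &
  exists wk thk : nat -> R -> R,
  [/\ expansion L D n wk w,
      expansion L D n thk th,
      forall r t, (1 <= r <= n)%N -> D t ->
        cM c * ip2 L (tt w t) (e_ L r)
        + cE c * cI c * ipH2 L (w t) (e_ L r)
        - ip2 L (fun=> cM c * cg c) (e_ L r)
        = ip2 L (h_alpha c (w t) (th t)) (derive1 (J_alpha c (w t) (th t) (e_ L r)))
        + ip2 L (h_beta c (w t) (th t)) (derive1 (J_beta c (w t) (th t) (e_ L r))),
      forall r t, (1 <= r <= n)%N -> D t ->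
        cM c * cell c / 3 * ip2 L (tt th t) (e_ L r)
        + cE c * cJ c / cell c * ipH2 L (th t) (e_ L r)
        + cG c * cK c / cell c * ipH1 L (th t) (e_ L r)
        = ip2 L (h_alpha c (w t) (th t)) (derive1 (G_alpha c (w t) (th t) (e_ L r)))
        - ip2 L (h_beta c (w t) (th t)) (derive1 (G_beta c (w t) (th t) (e_ L r))) &
      forall k, (1 <= k <= n)%N ->
        [/\ wk k 0 = ip2 L w0 (e_ L k), thk k 0 = ip2 L th0 (e_ L k),
            dt D (wk k) 0 = ip2 L w1 (e_ L k) &
            dt D (thk k) 0 = ip2 L th1 (e_ L k)]]].

(* Main.v *)
Require Import Defs.
From HB Require Import structures.
From mathcomp Require Import all_boot all_order all_algebra.
From mathcomp Require Import all_classical all_reals all_analysis.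
From mathcomp Require Import ring lra.
Set Implicit Arguments.
Unset Strict Implicit.
Unset Printing Implicit Defensive.
Import Order.TTheory GRing.Theory Num.Theory.
Import numFieldNormedType.Exports measurable_realfun.
Local Open Scope classical_set_scope.
Local Open Scope ring_scope.

(** The slope p of the convex envelope is constant on every gap of the contact
    set, where the modified test function is affine with the same end values; so
    phi(p) integrates to the same value against (L q)' and against q', and every
    right-hand side becomes a tension times the integral of p/sqrt(1+p^2) q'.
    The slope is a 1-Lipschitz function of the cable shape in the C^1 norm, which
    makes these forces Lipschitz on bounded sets of coefficients. Moreover
    p/sqrt(1+p^2) is nondecreasing and bounded by 1, so its integral against q' is
    at most 2 sup |q| when q vanishes at both ends: the forces grow at most
    linearly, although q' = (e_r cos theta)' depends on theta_x. Hence the system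
    for the coefficients has a global solution by Picard iteration. Conversely,
    e_k acts continuously on the dual of H^2 and H^1_0, so the coefficients of any
    solution in X_T are C^2 and solve the same system, and Gronwall's inequality
    gives uniqueness. *)

(** * Integrals over (0, L) *)

Section integrals.
Context {R : realType}.
Notation mu := (@lebesgue_measure R).
Implicit Types (f g p q : R -> R) (a b c M : R).

(** The obstacle is global existence. The tension grows linearly with the coefficients and so does
    (e_r cos theta)', so a direct estimate of the torsional forces is quadratic and would leave room
    for blow-up in finite time; bounding the integral through the monotonicity of the slope leaves
    one linear factor. Passing from (L q)' to q' also removes the dependence on the gaps, which may
    change abruptly with the solution: the pairing then sees the shape only through the slope. The
    slope is studied through supporting lines. The tangent of the envelope at an interior point
    meets f at a point on each side, and these touching points yield differentiability, constancy on
    gaps and the Lipschitz bound. For uniqueness, a solution is known only on [0, L] and at times of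
    the domain, with one-sided derivatives at its end points and weak derivatives up to null sets.
    Hence the congruence lemmas, the difference quotients restricted to the time domain, and the
    pairings in place of pointwise identities. *)

Definition bdmeas a b f :=
  measurable_fun (`]a, b[%classic : set R) f /\
  exists M, forall x, a < x < b -> `|f x| <= M.

Definition intble a b f := mu.-integrable `]a, b[ (EFin \o f).

(** The interval has finite measure. Unlike integrable functions, bounded measurable ones are stable
    under products, so most integrability conditions are discharged in this class. *)
Lemma bdmeas_intble a b f : bdmeas a b f -> intble a b f.
Proof.
move=> [mf [M fM]]; apply: measurable_bounded_integrable => //=.
  by rewrite lebesgue_measure_itv/=; case: ifP => _; rewrite ?ltry// -EFinB ltry.
exists M; split; first exact: num_real.
by move=> y My x /=; rewrite in_itv/= => /fM /le_trans; apply; exact: ltW.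
Qed.

Lemma bdmeas_cst a b c : bdmeas a b (fun=> c).
Proof. by split; [exact: measurable_cst | exists `|c|]. Qed.

Lemma bdmeasD a b f g : bdmeas a b f -> bdmeas a b g -> bdmeas a b (fun x => f x + g x).
Proof.
move=> [mf [M fM]] [mg [N gN]]; split; first exact: measurable_funD.
exists (M + N) => x xab; apply: le_trans (ler_normD _ _) _.
by apply: lerD; [exact: fM | exact: gN].
Qed.

Lemma bdmeasM a b f g : bdmeas a b f -> bdmeas a b g -> bdmeas a b (fun x => f x * g x).
Proof.
move=> [mf [M fM]] [mg [N gN]]; split; first exact: measurable_funM.
exists (M * N) => x xab; rewrite normrM.
by apply: ler_pM => //; [exact: fM | exact: gN].
Qed.

Lemma bdmeasN a b f : bdmeas a b f -> bdmeas a b (fun x => - f x).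
Proof.
move=> [mf [M fM]]; split; first exact: measurable_funN.
by exists M => x /fM; rewrite normrN.
Qed.

Lemma bdmeasB a b f g : bdmeas a b f -> bdmeas a b g -> bdmeas a b (fun x => f x - g x).
Proof. by move=> bf bg; apply: bdmeasD bf (bdmeasN bg). Qed.

Lemma continuous_bounded a b f : continuous f -> exists M, forall x, a <= x <= b -> `|f x| <= M.
Proof.
move=> cf; have cwf : {within `[a, b], continuous f} by exact: continuous_subspaceT.
have /compact_bounded[M [_ Mf]] := continuous_compact cwf (@segment_compact _ a b).
exists (M + 1) => x xab; apply: (Mf (M + 1)); first by rewrite ltrDl.
by exists x => //=; rewrite in_itv.
Qed.

Lemma bdmeas_continuous a b f : continuous f -> bdmeas a b f.
Proof.
move=> cf; split.
  by apply: (measurable_funS measurableT) => //; exact: continuous_measurable_fun.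
have [M fM] := continuous_bounded a b cf.
by exists M => x /andP[/ltW ax /ltW xb]; apply: fM; rewrite ax xb.
Qed.

Lemma intble_bdmeasM a b f g : intble a b f -> bdmeas a b g -> intble a b (fun x => f x * g x).
Proof.
move=> fi [mg [M gM]].
have bg : [bounded g x | x in `]a, b[%classic].
  exists M; split; first exact: num_real.
  by move=> y My x /=; rewrite in_itv/= => /gM /le_trans; apply; exact: ltW.
by apply: (integrableMl _ fi mg bg).
Qed.

Lemma intbleD a b f g : intble a b f -> intble a b g -> intble a b (fun x => f x + g x).
Proof. by move=> fi gi; apply: (@integrableD _ _ _ mu _ _ _ _ fi gi). Qed.

Lemma intbleZ a b c f : intble a b f -> intble a b (fun x => c * f x).
Proof. by move=> fi; apply: (@integrableZl _ _ _ mu _ _ c _ fi). Qed.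

Lemma intbleB a b f g : intble a b f -> intble a b g -> intble a b (fun x => f x - g x).
Proof. by move=> fi gi; apply: (@integrableB _ _ _ mu _ _ _ _ fi gi). Qed.

Lemma eq_int0L L f g : (forall x, 0 < x < L -> f x = g x) -> int0L L f = int0L L g.
Proof.
by move=> fg; apply: eq_Rintegral => x; rewrite inE/= in_itv/=; exact: fg.
Qed.

Lemma int0LD L f g : intble 0 L f -> intble 0 L g ->
  int0L L (fun x => f x + g x) = int0L L f + int0L L g.
Proof. by move=> fi gi; apply: RintegralD. Qed.

Lemma int0LB L f g : intble 0 L f -> intble 0 L g ->
  int0L L (fun x => f x - g x) = int0L L f - int0L L g.
Proof. by move=> fi gi; apply: RintegralB. Qed.

Lemma int0LZ L c f : intble 0 L f -> int0L L (fun x => c * f x) = c * int0L L f.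
Proof. by move=> fi; apply: RintegralZl. Qed.

Lemma int0L0 L : int0L L (fun=> 0) = 0 :> R.
Proof. by rewrite /int0L Rintegral_cst// mul0r. Qed.

Lemma int0L_sum L n (f : nat -> R -> R) : (forall k, intble 0 L (f k)) ->
  int0L L (fun x => \sum_(1 <= k < n) f k x) = \sum_(1 <= k < n) int0L L (f k).
Proof.
move=> bf; suff H s : intble 0 L (fun x => \sum_(k <- s) f k x) /\
  int0L L (fun x => \sum_(k <- s) f k x) = \sum_(k <- s) int0L L (f k) by have [] := H (index_iota 1 n).
elim: s => [|k s [ih1 ih2]].
  under eq_fun do rewrite big_nil; split; first exact: bdmeas_intble (bdmeas_cst 0 L 0).
  by rewrite big_nil int0L0.
under eq_fun do rewrite big_cons; split; first exact: intbleD.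
by rewrite big_cons int0LD// ih2.
Qed.

Lemma int0L_cst L c : 0 <= L -> int0L L (fun=> c) = c * L.
Proof.
move=> L0; rewrite /int0L Rintegral_cst//= lebesgue_measure_itv/= lte_fin.
by move: L0; rewrite le_eqVlt => /orP[/eqP<-|->]; rewrite ?ltxx ?mulr0//= subr0.
Qed.

Lemma norm_int0L_le L f g : intble 0 L f -> intble 0 L g ->
  (forall x, 0 < x < L -> `|f x| <= g x) -> `|int0L L f| <= int0L L g.
Proof.
move=> fi gi fg; apply: le_trans (le_normr_Rintegral _ fi) _ => //.
apply: le_Rintegral => //; exact: integrable_norm.
Qed.

Lemma norm_int0L_bound L f c : 0 <= L -> intble 0 L f ->
  (forall x, 0 < x < L -> `|f x| <= c) -> `|int0L L f| <= c * L.
Proof.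
move=> L0 fi fc; rewrite -int0L_cst//; apply: norm_int0L_le => //.
exact: bdmeas_intble (bdmeas_cst _ _ _).
Qed.

(** The end points are null, so the fundamental theorem on the closed interval applies. *)
Lemma Rintegral_oo_FTC f (F : R -> R) a b : a <= b -> continuous f ->
  (forall x : R, is_derive x 1 F (f x)) ->
  \int[mu]_(x in `]a, b[) f x = F b - F a.
Proof.
rewrite le_eqVlt => /predU1P[<- _ _|ab cf dF].
  by rewrite set_itv_ge ?bnd_simp ?ltxx// Rintegral_set0 subrr.
have cF : continuous F.
  by move=> x; apply/differentiable_continuous/derivable1_diffP; have [] := dF x.
have iab : mu.-integrable `[a, b] (EFin \o f).
  apply: continuous_compact_integrable; first exact: segment_compact.
  exact: continuous_subspaceT.
rewrite Rintegral_itv_obnd_cbnd; last first.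
  by apply: integrableS iab => //; apply: subset_itv; rewrite bnd_simp.
rewrite Rintegral_itv_bndo_bndc; last first.
  by apply: integrableS iab => //; apply: subset_itv; rewrite bnd_simp.
rewrite /Rintegral (@continuous_FTC2 _ f F)//.
- exact: continuous_subspaceT.
- split => [x _||]; first by have [] := dF x.
  + exact/cvg_at_right_filter/cF.
  + exact/cvg_at_left_filter/cF.
- by move=> x _; rewrite derive1E; have [_ ->] := dF x.
Qed.

Lemma int0L_FTC L f (F : R -> R) : 0 <= L -> continuous f ->
  (forall x : R, is_derive x 1 F (f x)) -> int0L L f = F L - F 0.
Proof. exact: Rintegral_oo_FTC. Qed.

End integrals.

(** * Convex envelopes *)

Section derivative_epsilon.
Context {R : realType}.
Implicit Types (f g : R -> R) (x d : R).

(** Free of division and valid also at [y = x], this form suits functions defined piecewise: the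
    position of [y] can be split into cases, each with its own estimate. *)
Lemma is_deriveP f x d : is_derive x 1 f d <->
  forall e : R, 0 < e -> exists2 r : R, 0 < r &
    forall y : R, `|y - x| < r -> `|f y - f x - d * (y - x)| <= e * `|y - x|.
Proof.
split=> [[dfx <-] e e0|H].
- have /cvgrPdist_le/(_ e e0) : h^-1 *: (f (h *: 1 + x) - f x) @[h --> 0^'] --> 'D_1 f x.
    exact: dfx.
  rewrite near_withinE => -[r /= r0 rP]; exists r => // y yx.
  have [->|yxN] := eqVneq y x; first by rewrite !subrr mulr0 subr0 normr0 mulr0.
  have yx0 : y - x != 0 by rewrite subr_eq0.
  have := rP (y - x); rewrite /ball/= sub0r normrN => /(_ yx yx0).
  rewrite [(y - x) *: 1]mulr1 subrK => le_e.
  have -> : f y - f x - 'D_1 f x * (y - x) =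
      - (('D_1 f x - (y - x)^-1 *: (f y - f x)) * (y - x)).
    by rewrite mulrBl /GRing.scale/= mulrAC mulVf// mul1r opprB.
  by rewrite normrN normrM ler_wpM2r.
- have cv : h^-1 *: (f (h *: 1 + x) - f x) @[h --> 0^'] --> d.
    apply/cvgrPdist_le => e e0; have [r r0 rP] := H e e0.
    rewrite near_withinE; exists r => //= h; rewrite /ball/= sub0r normrN => hr h0.
    have := rP (h + x); rewrite addrK => /(_ hr) le_e.
    rewrite [h *: 1]mulr1 -(ler_pM2r (_ : 0 < `|h|)) ?normr_gt0// -normrM.
    rewrite mulrBl /GRing.scale/= mulrAC mulVf// mul1r distrC.
    exact: le_e.
  by split; [apply/cvg_ex; exists d | apply/cvg_lim].
Qed.

Lemma is_derive_continuous f (df : R -> R) :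
  (forall x : R, is_derive x 1 f (df x)) -> continuous f.
Proof.
by move=> dF x; apply/differentiable_continuous/derivable1_diffP; have [] := dF x.
Qed.

Lemma is_derive_derive1 f x d : is_derive x 1 f d -> derive1 f x = d.
Proof. by rewrite derive1E => -[_ ->]. Qed.

Lemma is_derive_MVT f (df : R -> R) (a b : R) :
  (forall x : R, is_derive x 1 f (df x)) -> a < b ->
  exists2 c, a < c < b & f b - f a = df c * (b - a).
Proof.
move=> dF ab; have cf := is_derive_continuous dF.
have [c cab E] := MVT ab (fun x _ => dF x) (continuous_subspaceT cf).
by exists c => //; move: cab; rewrite in_itv.
Qed.

End derivative_epsilon.

Lemma convex_functionP {R : realType} (A : set R) (h : R -> R) :
  convex_function A h <-> forall t y z, 0 <= t <= 1 -> A y -> A z ->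
    h (t * y + (1 - t) * z) <= t * h y + (1 - t) * h z.
Proof.
split=> [ch t y z /andP[t0 t1] Ay Az|ch t y z /[!inE] Ay Az].
  by have := ch (Itv01 t0 t1) y z; rewrite !inE => /(_ Ay Az).
by apply: ch => //; rewrite ge0 le1.
Qed.

(** * Supporting lines and the slope of the envelope *)

Section convex_envelope.
Context {R : realType}.
Variables (L : R) (f : R -> R).
Implicit Types (x y z a b s c : R).
Local Notation g := (conv_env L f).

Lemma conv_env_ge_affine c s x : 0 <= x <= L ->
  (forall z, 0 <= z <= L -> c + s * z <= f z) -> c + s * x <= g x.
Proof.
move=> x0L cs; apply: ub_le_sup.
  by exists (f x) => _ [h [_ hf] <-]; apply: hf; rewrite in_itv.
exists (fun z => c + s * z) => //; split => [|z].
  apply/convex_functionP => t y z _ _ _.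
  by rewrite le_eqVlt; apply/orP; left; apply/eqP; ring.
by rewrite in_itv/=; exact: cs.
Qed.

Hypothesis cf : continuous f.

(** A constant below the minimum of [f] competes. Over an empty family the supremum would be a
    default value. *)
Let family_nonempty x : [set h x | h in [set h : R -> R |
    convex_function (`[0, L]%classic : set R) h /\
    forall z, z \in `[0, L] -> h z <= f z]] !=set0.
Proof.
have [M fM] := continuous_bounded 0 L cf.
exists (- M); exists (fun=> - M) => //; split => [|z].
  apply/convex_functionP => t y z _ _ _.
  by rewrite le_eqVlt; apply/orP; left; apply/eqP; ring.
by rewrite in_itv/= => /fM; rewrite ler_norml => /andP[].
Qed.

Lemma conv_env_le x : 0 <= x <= L -> g x <= f x.
Proof.
move=> x0L; apply: ge_sup; first exact: family_nonempty.
by move=> _ [h [_ hf] <-]; apply: hf; rewrite in_itv.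
Qed.

(** Convexity passes from the competitors to their supremum. Multiplying by [b - a] covers the
    degenerate interval and leaves later uses to linear arithmetic. *)
Lemma conv_env_chord a x b : 0 <= a -> a <= x -> x <= b -> b <= L ->
  (b - a) * g x <= (b - x) * g a + (x - a) * g b.
Proof.
move=> a0 ax xb bL; have ab := le_trans ax xb.
move: ab; rewrite le_eqVlt => /predU1P[E|ab].
  by move: ax xb; rewrite -E => ax xa; rewrite (le_anti (introT andP (conj xa ax))) !subrr !mul0r addr0.
have ba0 : 0 < b - a by rewrite subr_gt0.
rewrite -ler_pdivlMl//; apply: ge_sup; first exact: family_nonempty.
move=> _ [h [ch hf] <-]; rewrite ler_pdivlMl//.
have hg y : 0 <= y <= L -> h y <= g y.
  move=> y0L; apply: ub_le_sup; last by exists h.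
  by exists (f y) => _ [k [_ kf] <-]; apply: kf; rewrite in_itv.
have t0 : 0 <= (b - x) / (b - a) by rewrite divr_ge0 ?subr_ge0// ltW.
have t1 : (b - x) / (b - a) <= 1 by rewrite ler_pdivrMr// mul1r lerD2l lerN2.
have := (convex_functionP _ _).1 ch _ a b (introT andP (conj t0 t1)).
rewrite /= !in_itv/= a0 bL (le_trans ax (le_trans xb bL)) (le_trans a0 (le_trans ax xb)).
move=> /(_ isT isT).
have -> : (b - x) / (b - a) * a + (1 - (b - x) / (b - a)) * b = x.
  by field; rewrite gt_eqF.
rewrite -(ler_pM2l ba0) => /le_trans; apply.
have -> : (b - a) * ((b - x) / (b - a) * h a + (1 - (b - x) / (b - a)) * h b) =
  (b - x) * h a + (x - a) * h b by field; rewrite gt_eqF.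
by apply: lerD; apply: ler_wpM2l; rewrite ?subr_ge0//; apply: hg; lra.
Qed.

(** The two contact points carry the information. If both equal [x], the line is tangent to [f]
    there; otherwise the envelope coincides with the line on [a, b]. *)
Definition support x s :=
  (forall z, 0 <= z <= L -> g x + s * (z - x) <= f z) /\
  exists a b, [/\ 0 <= a <= x, x <= b <= L,
     f a = g x + s * (a - x) & f b = g x + s * (b - x)].

(** The supremum of the left difference quotients is a subgradient, since convexity makes every
    right quotient one of their upper bounds. *)
Let subgradient x : 0 < x < L ->
  exists s, forall z, 0 <= z <= L -> g x + s * (z - x) <= g z.
Proof.
move=> /andP[x0 xL].
pose E := [set (g x - g z) / (x - z) | z in [set z | 0 <= z < x]].
have EU z' : x < z' -> z' <= L -> ubound E ((g z' - g x) / (z' - x)).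
  move=> xz' z'L _ [z /= /andP[z0 zx] <-].
  have := conv_env_chord z0 (ltW zx) (ltW xz') z'L.
  rewrite ler_pdivrMr ?subr_gt0// mulrAC ler_pdivlMr ?subr_gt0//; lra.
have EL z : 0 <= z < x -> (g x - g z) / (x - z) <= sup E.
  move=> zx; apply: ub_le_sup; last by exists z.
  by exists ((g L - g x) / (L - x)); exact: EU.
exists (sup E) => z /andP[z0 zL]; case: (ltgtP z x) => [zx|xz|->].
- have := EL z; rewrite z0 zx => /(_ isT); rewrite ler_pdivrMr ?subr_gt0//; lra.
- have : sup E <= (g z - g x) / (z - x).
    apply: ge_sup; last exact: EU.
    by exists ((g x - g 0) / (x - 0)); exists 0 => //=; rewrite lexx.
  rewrite ler_pdivlMr ?subr_gt0//; lra.
- by rewrite subrr mulr0 addr0.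
Qed.

(* Otherwise the line could be tilted around a point beyond [x] and would
   still lie below [f], but above the envelope at [x]. *)
Let tilt x s (sg d : R) : 0 < x < L -> `|sg| = 1 -> 0 < d ->
  (forall z, 0 <= z <= L -> g x + s * (z - x) <= f z) ->
  (forall z, 0 <= z <= L -> 0 <= sg * (z - x) -> g x + s * (z - x) + d <= f z) ->
  False.
Proof.
move=> /andP[x0 xL] sg1 d0 sup1 sup2.
have L0 := lt_trans x0 xL.
have /cvgrPdist_lt/(_ (d / 2)) : (f z - s * z) @[z --> x] --> f x - s * x.
  by apply: cvgB; [exact: cf | apply: cvgM; [exact: cvg_cst|exact: cvg_id]].
rewrite divr_gt0// => /(_ isT) [r /= r0 rP].
(* The line is tilted by [e] around the point where [sg * (z - x) = - r]; with this [e] it rises by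
   at most [d / 2] on [0, L], while at [x] it rises by [e * r > 0]. *)
pose e := d / (2 * (L + r)).
have Lr0 : 0 < 2 * (L + r) by rewrite mulr_gt0// addr_gt0.
have e0 : 0 < e by rewrite divr_gt0.
have eLr : e * (L + r) = d / 2 by rewrite /e; field; rewrite gt_eqF ?addr_gt0.
have := @conv_env_ge_affine (g x - s * x + e * (r - sg * x)) (s + e * sg) x.
rewrite (ltW x0) (ltW xL) => /(_ isT).
have sgz z : 0 <= z <= L -> sg * (z - x) <= L.
  move=> /andP[z0 zL]; apply: le_trans (ler_norm _) _.
  by rewrite normrM sg1 mul1r ler_norml; apply/andP; split; lra.
have H : forall z, 0 <= z <= L -> g x - s * x + e * (r - sg * x) + (s + e * sg) * z <= f z.
  move=> z zL; have -> : g x - s * x + e * (r - sg * x) + (s + e * sg) * z =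
     g x + s * (z - x) + e * (sg * (z - x) + r) by ring.
  have le2 : e * (sg * (z - x) + r) <= d / 2.
    by rewrite -eLr ler_pM2l// lerD2r sgz.
  (* On the far side of [x] the distance [d] absorbs the rise; within [r] of [x] continuity still
     leaves [d / 2]; farther back the tilted line is not above the original one. *)
  have [zx|zx] := leP 0 (sg * (z - x)).
    by have := sup2 z zL zx; move: d0 le2; lra.
  have [zr|zr] := ltP (- r) (sg * (z - x)).
    have := rP z; rewrite /ball/=.
    have -> : `|x - z| < r.
      by rewrite distrC -[`|_|]mul1r -sg1 -normrM ltr_norml zr (lt_trans zx r0).
    have := sup2 x; rewrite subrr !mulr0 lexx (ltW x0) (ltW xL) addr0 => /(_ isT isT) h1.
    by move=> /(_ isT); rewrite ltr_norml => /andP[h2 h3]; move: h1 h2 h3 d0 le2; lra.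
  have := sup1 z zL; have : e * (sg * (z - x) + r) <= 0.
    by rewrite pmulr_rle0//; lra.
  by lra.
move=> /(_ H).
have -> : g x - s * x + e * (r - sg * x) + (s + e * sg) * x = g x + e * r by ring.
by have := mulr_gt0 e0 r0; lra.
Qed.

(** If the line of a subgradient missed [f] on one whole side of [x], the distance would have a
    positive minimum there by compactness, and the line could be tilted. *)
Lemma conv_env_support x : 0 < x < L -> exists s, support x s.
Proof.
move=> x0L; have [s sP] := subgradient x0L; exists s.
have /andP[x0 xL] := x0L.
have sf z : 0 <= z <= L -> g x + s * (z - x) <= f z.
  by move=> zL; apply: le_trans (sP z zL) (conv_env_le zL).
split => //.
have ch : continuous (fun z => f z - (g x + s * (z - x))).
  move=> z; apply: cvgB; first exact: cf.
  apply: cvgD; first exact: cvg_cst.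
  apply: cvgM; first exact: cvg_cst.
  by apply: cvgB; [exact: cvg_id|exact: cvg_cst].
have touch (p q sg : R) : 0 <= p -> p <= q -> q <= L -> `|sg| = 1 ->
   (forall z, 0 <= z <= L -> 0 <= sg * (z - x) -> p <= z <= q) ->
   exists2 c, p <= c <= q & f c = g x + s * (c - x).
  move=> p0 pq qL sg1 pqP.
  have [|c cpq cmin] := @EVT_min _ (fun z => f z - (g x + s * (z - x))) p q pq.
    exact: continuous_subspaceT.
  move: cpq; rewrite in_itv/= => cpq; exists c => //; apply/eqP/negPn/negP => cN.
  have c0L : 0 <= c <= L by move: cpq; lra.
  apply: (@tilt x s sg (f c - (g x + s * (c - x)))) => //.
    by rewrite lt_def subr_eq0 cN subr_ge0 sf.
  move=> z z0L zx; have := cmin z; rewrite in_itv/= pqP// => /(_ isT); lra.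
have [a aP fa] : exists2 c, 0 <= c <= x & f c = g x + s * (c - x).
  apply: (touch 0 x (-1)) => //; rewrite ?ltW ?normrN1//.
  by move=> z /andP[z0 zL]; lra.
have [b bP fb] : exists2 c, x <= c <= L & f c = g x + s * (c - x).
  apply: (touch x L 1) => //; rewrite ?ltW ?normr1//.
  by move=> z /andP[z0 zL]; lra.
by exists a, b.
Qed.

Variable df : R -> R.
Hypothesis fdf : forall x : R, is_derive x 1 f (df x).

Lemma support_le_conv_env x s z : 0 < x < L -> support x s -> 0 <= z <= L ->
  g x + s * (z - x) <= g z.
Proof.
move=> x0L [sf _] zL; have := @conv_env_ge_affine (g x - s * x) s z zL.
have -> : g x - s * x + s * z = g x + s * (z - x) by ring.
apply=> y yL; have := sf y yL.
by have -> : g x - s * x + s * y = g x + s * (y - x) by ring.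
Qed.

(** The difference between [f] and the line has an interior minimum at [x]. *)
Lemma support_touch x s : 0 < x < L -> support x s -> f x = g x -> s = df x.
Proof.
move=> /andP[x0 xL] [sf _] fg.
have L0 := lt_trans x0 xL.
have dh (z : R) : is_derive z 1 (fun z => f z - (g x + s * (z - x))) (df z - s).
  have := fdf z => ?; apply: is_derive_eq; rewrite /GRing.scale/=; ring.
have : is_derive x 1 (fun z => f z - (g x + s * (z - x))) 0.
  apply: (@derive1_at_min _ _ 0 L) => [|t _||t].
  - exact: ltW.
  - by have [] := dh t.
  - by rewrite in_itv/= x0.
  - rewrite in_itv/= => /andP[t0 tL]; rewrite fg !subrr mulr0 addr0 subrr subr_ge0.
    by apply: sf; rewrite !ltW.
by move=> [_ E2]; case: (dh x) => _; rewrite E2; lra.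
Qed.

(** At a contact point the envelope is squeezed between the line and [f], which are tangent to each
    other. Elsewhere the touching points lie strictly on either side of [x], and the envelope is
    affine between them. *)
Lemma support_is_derive x s : 0 < x < L -> support x s -> is_derive x 1 g s.
Proof.
move=> x0L sp; have /andP[x0 xL] := x0L.
have sg := support_le_conv_env x0L sp.
have [fg|fg] := eqVneq (f x) (g x).
  have /is_deriveP df' := fdf x; apply/is_deriveP => e e0.
  have [r r0 rP] := df' e e0.
  exists (Num.min r (Num.min x (L - x))); first by rewrite !lt_min r0 x0 subr_gt0.
  move=> y; rewrite !lt_min => /and3P[yr yx yL].
  have y0L : 0 <= y <= L by move: yx yL; rewrite !ltr_norml; lra.
  apply: le_trans (rP y yr).
  have := support_touch x0L sp fg => <-.
  have h1 := sg y y0L; have h2 := conv_env_le y0L.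
  rewrite fg ger0_norm; last by lra.
  by rewrite ger0_norm; lra.
have [_ [a [b [/andP[a0 ax] /andP[xb bL] fa fb]]]] := sp.
have ax' : a < x.
  rewrite lt_neqAle ax andbT; apply/eqP => E; move: fa.
  by rewrite E subrr mulr0 addr0 => /eqP; rewrite (negPf fg).
have xb' : x < b.
  rewrite lt_neqAle xb andbT; apply/eqP => E; move: fb.
  by rewrite -E subrr mulr0 addr0 => /eqP; rewrite (negPf fg).
apply/is_deriveP => e e0; exists (Num.min (x - a) (b - x)).
  by rewrite lt_min !subr_gt0 ax'.
move=> y; rewrite lt_min => /andP[ya yb].
have [ay yb'] : a < y /\ y < b by move: ya yb; rewrite !ltr_norml; lra.
suff -> : g y = g x + s * (y - x).
  by rewrite [g x + _]addrC addrK subrr normr0 mulr_ge0// ltW.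
apply/eqP; rewrite eq_le sg ?andbT; last lra.
have ga : g a <= g x + s * (a - x) by rewrite -fa; apply: conv_env_le => //; lra.
have gb : g b <= g x + s * (b - x) by rewrite -fb; apply: conv_env_le => //; lra.
have ba0 : 0 < b - a by lra.
rewrite -(ler_pM2l ba0); apply: le_trans (conv_env_chord a0 (ltW ay) (ltW yb') bL) _.
have := ler_wpM2l (_ : 0 <= b - y) ga; rewrite subr_ge0 => /(_ (ltW yb')).
have := ler_wpM2l (_ : 0 <= y - a) gb; rewrite subr_ge0 => /(_ (ltW ay)).
lra.
Qed.

Lemma conv_env_derivable x : 0 < x < L -> is_derive x 1 g (derive1 g x).
Proof.
move=> x0L; have [s /(support_is_derive x0L) ds] := conv_env_support x0L.
by rewrite (is_derive_derive1 ds).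
Qed.

Lemma derive1_support x : 0 < x < L -> support x (derive1 g x).
Proof.
move=> x0L; have [s sp] := conv_env_support x0L.
by have /is_derive_derive1 -> := support_is_derive x0L sp.
Qed.

Lemma derive1_conv_env_mono x y : 0 < x < L -> 0 < y < L -> x <= y ->
  derive1 g x <= derive1 g y.
Proof.
move=> x0L y0L; rewrite le_eqVlt => /predU1P[-> //|xy].
have xL : 0 <= x <= L by lra.
have yL : 0 <= y <= L by lra.
have hx := support_le_conv_env x0L (derive1_support x0L) yL.
have hy := support_le_conv_env y0L (derive1_support y0L) xL.
by rewrite -(ler_pM2r (_ : 0 < y - x)) ?subr_gt0//; lra.
Qed.

(** The slope is the difference quotient of [f] between the two touching points, or [f'] at [x] if
    they coincide. Bounds on [f'] thus pass to the slope. *)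
Lemma derive1_conv_envE x : 0 < x < L ->
  exists2 z, 0 < z < L & derive1 g x = df z.
Proof.
move=> x0L; have sp := derive1_support x0L.
have [_ [a [b [/andP[a0 ax] /andP[xb bL] fa fb]]]] := sp.
have := le_trans ax xb; rewrite le_eqVlt => /predU1P[E|ab].
  have ax' : a = x by apply/eqP; rewrite eq_le ax E.
  exists x => //; apply: (support_touch x0L sp).
  by rewrite -ax' {1}fa ax' subrr mulr0 addr0.
have [c cab E] := is_derive_MVT fdf ab; exists c; first lra.
have ba0 : b - a != 0 by rewrite subr_eq0 gt_eqF.
apply/(mulIf ba0); rewrite -E fa fb; ring.
Qed.

(** A touching point inside (0, L) is a contact point, so the right touching point for [x] cannot
    lie in (a, b) and is beyond [y]. The envelope is affine up to that point. *)
Lemma derive1_conv_env_const a b x y : 0 <= a -> a < x -> x < y -> y < b -> b <= L ->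
  (forall z, a < z < b -> f z != g z) -> derive1 g x = derive1 g y.
Proof.
move=> a0 ax xy yb bL fg.
have x0L : 0 < x < L by lra.
have y0L : 0 < y < L by lra.
have sp := derive1_support x0L.
have [_ [p [q [/andP[p0 px] /andP[xq qL] fp fq]]]] := sp.
have touch z : z = p \/ z = q -> 0 < z < L -> f z = g z.
  move=> zpq z0L; apply/eqP; rewrite eq_le conv_env_le ?andbT//; last lra.
  have zL : 0 <= z <= L by lra.
  by case: zpq zL => ->; rewrite ?fp ?fq => zL; exact: support_le_conv_env.
have yq : y < q.
  rewrite ltNge; apply/negP => qy; have qab : a < q < b by lra.
  have q0L : 0 < q < L by lra.
  by move: (fg q qab); rewrite (touch q)// ?eqxx//; right.
have sg := support_le_conv_env x0L sp.
have gq : g q <= g x + derive1 g x * (q - x) by rewrite -fq; apply: conv_env_le => //; lra.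
have gp : g p <= g x + derive1 g x * (p - x) by rewrite -fp; apply: conv_env_le => //; lra.
have gline z : p <= z <= q -> g z = g x + derive1 g x * (z - x).
  move=> /andP[pz zq]; apply/eqP; rewrite eq_le sg ?andbT; last lra.
  have qp0 : 0 < q - p by lra.
  rewrite -(ler_pM2l qp0); apply: le_trans (conv_env_chord p0 pz zq qL) _.
  have := ler_wpM2l (_ : 0 <= q - z) gp; rewrite subr_ge0 => /(_ zq).
  have := ler_wpM2l (_ : 0 <= z - p) gq; rewrite subr_ge0 => /(_ pz).
  lra.
apply: esym; apply: is_derive_derive1; apply/is_deriveP => e e0.
exists (Num.min (y - x) (q - y)); first by rewrite lt_min !subr_gt0 xy.
move=> z; rewrite lt_min => /andP[zx zq].
have zpq : p <= z <= q by move: zx zq; rewrite !ltr_norml; lra.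
rewrite (gline z)// (gline y); last lra.
rewrite (_ : _ - _ - _ = 0) ?normr0 ?mulr_ge0//; first exact: ltW.
ring.
Qed.

End convex_envelope.

Section envelope_comparison.
Context {R : realType}.
Implicit Types (f df : R -> R).

(* The supporting lines at [x] touch [f1] at some [a1 <= x] and [f2] at some
   [b2 >= x], so the difference of their slopes is at most a difference quotient
   of [f1 - f2] over [a1, b2]. *)
Let derive1_conv_env_ler L f1 f2 df1 df2 (d : R) x :
  (forall x : R, is_derive x 1 f1 (df1 x)) -> (forall x : R, is_derive x 1 f2 (df2 x)) ->
  (forall z, 0 < z < L -> df1 z - df2 z <= d) -> 0 < x < L ->
  derive1 (conv_env L f1) x - derive1 (conv_env L f2) x <= d.
Proof.
move=> D1 D2 dfd x0L.
have cf1 := is_derive_continuous D1; have cf2 := is_derive_continuous D2.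
have sp1 := derive1_support cf1 D1 x0L; have sp2 := derive1_support cf2 D2 x0L.
have [m1 [a1 [_ [/andP[a0 ax] _ fa _]]]] := sp1.
have [m2 [_ [b2 [_ /andP[xb bL] _ fb]]]] := sp2.
set s1 := derive1 _ x in sp1 m1 fa *; set s2 := derive1 _ x in sp2 m2 fb *.
have := le_trans ax xb; rewrite le_eqVlt => /predU1P[E|ab].
  have ax' : a1 = x by apply/eqP; rewrite eq_le ax E.
  rewrite (support_touch D1 x0L sp1) ?(support_touch D2 x0L sp2) ?dfd//.
    by rewrite -{1}ax' E fb -E ax' subrr mulr0 addr0.
  by rewrite -{1}ax' fa ax' subrr mulr0 addr0.
have D12 (z : R) : is_derive z 1 (fun z => f1 z - f2 z) (df1 z - df2 z).
  by have := D1 z; have := D2 z => ? ?; exact: is_deriveB.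
have [c cab E] := is_derive_MVT D12 ab.
have /m1 h1 : 0 <= b2 <= L by lra.
have /m2 h2 : 0 <= a1 <= L by lra.
have dc : df1 c - df2 c <= d by apply: dfd; lra.
have ba0 : 0 < b2 - a1 by lra.
rewrite -(ler_pM2r ba0); apply: le_trans (_ : (df1 c - df2 c) * (b2 - a1) <= _); last by rewrite ler_pM2r.
rewrite -E; lra.
Qed.

Lemma derive1_conv_env_dist L f1 f2 df1 df2 (d : R) x :
  (forall x : R, is_derive x 1 f1 (df1 x)) -> (forall x : R, is_derive x 1 f2 (df2 x)) ->
  (forall z, 0 < z < L -> `|df1 z - df2 z| <= d) -> 0 < x < L ->
  `|derive1 (conv_env L f1) x - derive1 (conv_env L f2) x| <= d.
Proof.
move=> D1 D2 dfd x0L; rewrite ler_norml lerNl opprB.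
apply/andP; split; apply: derive1_conv_env_ler => // z /dfd; rewrite ler_norml; lra.
Qed.

Lemma eq_conv_env L f1 f2 : (forall x, 0 <= x <= L -> f1 x = f2 x) ->
  conv_env L f1 = conv_env L f2.
Proof.
move=> E; apply/funext => x; rewrite /conv_env; congr sup; congr image.
apply/seteqP; split => h [ch hf]; split=> // z zL; have := hf z zL.
  by rewrite E// -in_itv.
by rewrite E// -in_itv.
Qed.

End envelope_comparison.

(** * Gaps of the contact set *)

Section gaps.
Context {R : realType}.
Variables (L : R) (G : set R).
Hypothesis oG : open G.
Hypothesis GL : forall x, G x -> 0 < x < L.
Notation mu := (@lebesgue_measure R).
Implicit Types (x y z a b : R).

Definition gapl x := inf (connected_component G x).
Definition gapr x := sup (connected_component G x).

Let C := connected_component G.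

Let C_interval x : is_interval (C x).
Proof. by apply/connected_intervalP; exact: component_connected. Qed.

Let C_lb x : lbound (C x) 0.
Proof. by move=> z /connected_component_sub /GL /andP[/ltW]. Qed.

Let C_ub x : ubound (C x) L.
Proof. by move=> z /connected_component_sub /GL /andP[_ /ltW]. Qed.

Let C_has_inf x : G x -> has_inf (C x).
Proof. by move=> Gx; split; [exists x; exact: connected_component_refl | exists 0; exact: C_lb]. Qed.

Let C_has_sup x : G x -> has_sup (C x).
Proof. by move=> Gx; split; [exists x; exact: connected_component_refl | exists L; exact: C_ub]. Qed.

Let C_oo x z : G x -> gapl x < z < gapr x -> C x z.
Proof.
move=> Gx /andP[az zb].
have [c Cc cz] := inf_lt (C_has_inf Gx).1 az.
have [d Cd zd] := sup_gt (C_has_sup Gx).1 zb.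
by apply: (C_interval Cc Cd); rewrite (ltW cz) (ltW zd).
Qed.

Lemma gap_sub x z : G x -> gapl x < z < gapr x -> G z.
Proof. by move=> Gx /(C_oo Gx) /connected_component_sub. Qed.

Lemma gap_bounds x : G x -> [/\ 0 <= gapl x, gapl x <= x, x <= gapr x & gapr x <= L].
Proof.
move=> Gx; have Cx : C x x by exact: connected_component_refl.
split.
- by apply: lb_le_inf; [exists x | exact: C_lb].
- by apply: ge_inf => //; exists 0; exact: C_lb.
- by apply: ub_le_sup => //; exists L; exact: C_ub.
- by apply: ge_sup; [exists x | exact: C_ub].
Qed.

(** Used to push a component past its infimum or supremum if that point belonged to the open set. *)
Let C_max x a b : a < b -> C x a \/ C x b -> (forall z, a <= z <= b -> G z) ->
  C x a /\ C x b.
Proof.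
move=> ab Cab Gab; have iab : is_interval (`[a, b]%classic : set R).
  move=> u v /=; rewrite !in_itv/= => /andP[au ub] /andP[av vb] w /andP[uw wv].
  by rewrite in_itv/=; apply/andP; split; lra.
have step (u : R) : a <= u <= b -> C x u -> C x a /\ C x b.
  move=> uab Cu; rewrite /C (same_connected_component Cu).
  have sub : `[a, b]%classic `<=` connected_component G u.
    apply: connected_component_max; first by rewrite /= in_itv.
      by move=> z /=; rewrite in_itv; exact: Gab.
    exact/connected_intervalP.
  by split; apply: sub; rewrite /= in_itv/= lexx ltW.
by case: Cab; apply: step; rewrite lexx ltW.
Qed.

Let G_ball x : G x -> exists2 e : R, 0 < e & forall y, `|y - x| < e -> G y.
Proof.
move=> Gx; have /nbhs_ballP[e /= e0 eG] := open_nbhs_nbhs (conj oG Gx).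
by exists e => // y yx; apply: eG; rewrite /ball/= distrC.
Qed.

Lemma gapl_out x : G x -> ~ G (gapl x).
Proof.
move=> Gx Ga; have [e e0 eG] := G_ball Ga.
have [c Cc] := inf_adherent e0 (C_has_inf Gx).
rewrite -/(gapl x) => ce; have ac : gapl x <= c by apply: ge_inf Cc; exists 0; exact: C_lb.
have [] := @C_max x (gapl x - e / 2) c _ (or_intror Cc).
- lra.
- by move=> z zc; apply: eG; rewrite ltr_norml; lra.
- by move=> Ca _; have := @ge_inf _ (C x) _ _ Ca; rewrite -/(gapl x) => /(_ (ex_intro _ 0 (@C_lb x))); lra.
Qed.

Lemma gapr_out x : G x -> ~ G (gapr x).
Proof.
move=> Gx Ga; have [e e0 eG] := G_ball Ga.
have [c Cc] := sup_adherent e0 (C_has_sup Gx).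
rewrite -/(gapr x) => ce; have ac : c <= gapr x by apply: ub_le_sup Cc; exists L; exact: C_ub.
have [] := @C_max x c (gapr x + e / 2) _ (or_introl Cc).
- lra.
- by move=> z zc; apply: eG; rewrite ltr_norml; lra.
- by move=> _ Ca; have := @ub_le_sup _ (C x) _ _ Ca; rewrite -/(gapr x) => /(_ (ex_intro _ L (@C_ub x))); lra.
Qed.

Lemma gap_lt x : G x -> gapl x < x < gapr x.
Proof.
move=> Gx; have [_ ax xb _] := gap_bounds Gx; rewrite !lt_neqAle ax xb !andbT.
apply/andP; split; apply/eqP => E; first by apply: (gapl_out Gx); rewrite E.
by apply: (gapr_out Gx); rewrite -E.
Qed.

Lemma gap_eq x y : G x -> gapl x < y < gapr x -> gapl y = gapl x /\ gapr y = gapr x.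
Proof.
move=> Gx /(C_oo Gx) Cy.
by rewrite /gapl /gapr (same_connected_component Cy).
Qed.

Lemma gap_outside x z : G x -> ~ G z -> z <= gapl x \/ gapr x <= z.
Proof.
move=> Gx nGz; have [|za] := leP z (gapl x); first by left.
by right; rewrite leNgt; apply/negP => zb; apply/nGz/(gap_sub Gx); rewrite za.
Qed.

Lemma gap_ends x a b : G x -> a < x < b -> ~ G a -> ~ G b ->
  [/\ a <= gapl x, gapl x < gapr x & gapr x <= b].
Proof.
move=> Gx axb nGa nGb; have lt := gap_lt Gx.
by case: (gap_outside Gx nGa) (gap_outside Gx nGb) => [|] ? [|] ?; split; lra.
Qed.

Definition gap_endpoints : set R :=
  [set z | exists2 x, G x & z = gapl x \/ z = gapr x].

Lemma gap_rational x : G x -> exists r : rat, G (ratr r) /\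
  gapl (ratr r) = gapl x /\ gapr (ratr r) = gapr x.
Proof.
move=> Gx; have /andP[ax xb] := gap_lt Gx.
have [r] := rat_in_itvoo (lt_trans ax xb).
rewrite in_itv/= => rx; exists r; split; first exact: gap_sub Gx rx.
exact: gap_eq Gx rx.
Qed.

(** Each gap contains a rational number, which determines both of its ends. *)
Lemma countable_gap_endpoints : countable gap_endpoints.
Proof.
have := @bigcup_countable rat R setT (fun r => [set gapl (ratr r); gapr (ratr r)]).
move=> /(_ (countableP _)) H; apply: (sub_countable _ (H _)).
- apply: subset_card_le => z [x Gx zx].
  have [r [Gr [rl rr]]] := gap_rational Gx.
  by exists r => //=; rewrite rl rr.
- by move=> r _; exact: finite_set_countable.
Qed.

(** This is [affine_on_gaps] with an arbitrary open set [G] as union of the gaps, so that nothing in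
    this part refers to an envelope. *)
Definition affine_ext (q : R -> R) x : R :=
  if x \in G then
    q (gapl x) + (q (gapr x) - q (gapl x)) / (gapr x - gapl x) * (x - gapl x)
  else q x.

(** An everywhere defined substitute for the derivative of [affine_ext q], which may fail to exist
    at the ends of the gaps. *)
Definition chord_slope (q dq : R -> R) x : R :=
  if x \in G then (q (gapr x) - q (gapl x)) / (gapr x - gapl x) else dq x.

Variables (q dq : R -> R).
Hypothesis q_dq : forall x : R, is_derive x 1 q (dq x).
Hypothesis cdq : continuous dq.

Lemma affine_ext_derive_gap x : G x -> is_derive x 1 (affine_ext q) (chord_slope q dq x).
Proof.
move=> Gx; have /andP[ax xb] := gap_lt Gx; apply/is_deriveP => e e0.
exists (Num.min (x - gapl x) (gapr x - x)); first by rewrite lt_min !subr_gt0 ax.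
move=> y; rewrite lt_min => yx.
have yab : gapl x < y < gapr x by move: yx; rewrite !ltr_norml; lra.
have [El Er] := gap_eq Gx yab.
have Gy : G y by exact: gap_sub yab.
rewrite /affine_ext /chord_slope !mem_set// El Er.
rewrite (_ : _ - _ - _ = 0) ?normr0 ?mulr_ge0//; first exact: ltW.
ring.
Qed.

(** Such an [x] is a limit of points outside [G] from both sides. A gap that comes close to [x] is
    therefore caught between [x] and one of these points, and is short. *)
Lemma near_gap x (r : R) : 0 < x < L -> ~ G x -> ~ gap_endpoints x -> 0 < r ->
  exists2 d : R, 0 < d & d <= r /\ forall y, G y -> `|y - x| < d ->
    [/\ `|gapl y - x| < r, `|gapr y - x| < r & x <= gapl y \/ gapr y <= x].
Proof.
move=> x0L nGx nEx r0.
(* Otherwise (x, x + r) would lie in a single gap, with left end [x]. *)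
have [k1 [xk1 k1r nGk1]] : exists k, [/\ x < k, k < x + r & ~ G k].
  apply: contrapT => H; apply: nEx.
  have rG z : x < z < x + r -> G z.
    by move=> /andP[xz zr]; apply: contrapT => nGz; apply: H; exists z.
  have Gm : G (x + r / 2) by apply: rG; lra.
  exists (x + r / 2) => //; left; have [lm|lm] := gap_outside Gm nGx; last by have := gap_lt Gm; lra.
  apply/eqP; rewrite eq_le lm leNgt; apply/negP => xl.
  by apply: (gapl_out Gm); apply: rG; have := gap_lt Gm; lra.
have [k2 [xk2 k2r nGk2]] : exists k, [/\ x - r < k, k < x & ~ G k].
  apply: contrapT => H; apply: nEx.
  have rG z : x - r < z < x -> G z.
    by move=> /andP[xz zr]; apply: contrapT => nGz; apply: H; exists z.
  have Gm : G (x - r / 2) by apply: rG; lra.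
  exists (x - r / 2) => //; right; have [lm|lm] := gap_outside Gm nGx; first by have := gap_lt Gm; lra.
  apply/eqP; rewrite eq_le lm andbT leNgt; apply/negP => xl.
  by apply: (gapr_out Gm); apply: rG; have := gap_lt Gm; lra.
exists (Num.min (k1 - x) (x - k2)); first by rewrite lt_min !subr_gt0 xk1.
split; first by rewrite ge_min; apply/orP; left; lra.
move=> y Gy; rewrite lt_min !ltr_norml => /andP[yk1 yk2].
have [xy|yx|E] := ltgtP x y; last by move: Gy; rewrite -E.
- have yk : x < y < k1 by lra.
  by have [] := gap_ends Gy yk nGx nGk1 => *; split; [| |left]; rewrite ?ltr_norml; lra.
- have yk : k2 < y < x by lra.
  by have [] := gap_ends Gy yk nGk2 nGx => *; split; [| |right]; rewrite ?ltr_norml; lra.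
Qed.

(** At [y] in a nearby gap, the remainder of [affine_ext q] is the convex combination of the
    remainders of [q] at the two ends. Both ends lie on the same side of [x], so their distances to
    [x] combine to exactly the distance from [y] to [x], and the error stays relative to it. *)
Lemma affine_ext_derive_contact x : 0 < x < L -> ~ G x -> ~ gap_endpoints x ->
  is_derive x 1 (affine_ext q) (dq x).
Proof.
move=> x0L nGx nEx; apply/is_deriveP => e e0.
have /is_deriveP/(_ e e0) [r r0 rP] := q_dq x.
have [d d0 [dr dP]] := near_gap x0L nGx nEx r0.
exists d => // y yx; rewrite /affine_ext [x \in G]memNset//.
case: ifPn => [/set_mem Gy|_]; last by apply: rP; exact: lt_le_trans dr.
have [/rP lP /rP uP side] := dP y Gy yx.
have /andP[ly yu] := gap_lt Gy.
move: lP uP side ly yu; set a := gapl y; set b := gapr y => lP uP side ay yb.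
have ba0 : b - a != 0 by rewrite subr_eq0 gt_eqF// (lt_trans ay yb).
pose t := (y - a) / (b - a).
have t0 : 0 <= t by rewrite divr_ge0// subr_ge0 ltW// (lt_trans ay).
have t1 : 0 <= 1 - t.
  by rewrite subr_ge0 ler_pdivrMr ?mul1r ?lerD2r 1?ltW// subr_gt0 (lt_trans ay).
have yE : y - x = (1 - t) * (a - x) + t * (b - x) by rewrite /t; field.
have -> : q a + (q b - q a) / (b - a) * (y - a) - q x - dq x * (y - x) =
   (1 - t) * (q a - q x - dq x * (a - x)) + t * (q b - q x - dq x * (b - x)).
  by rewrite yE /t; field.
apply: le_trans (ler_normD _ _) _; rewrite (normrM (1 - t)) (normrM t) (ger0_norm t0) (ger0_norm t1).
have -> : `|y - x| = (1 - t) * `|a - x| + t * `|b - x|.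
  case: side => sd.
    by rewrite !ger0_norm//; lra.
  by rewrite !ler0_norm//; lra.
have := ler_wpM2l t1 lP; have := ler_wpM2l t0 uP; lra.
Qed.

Lemma gap_chord_bound : exists M, forall x, 0 < x < L -> `|chord_slope q dq x| <= M.
Proof.
have [M HM] := continuous_bounded 0 L cdq; exists M => x x0L.
rewrite /chord_slope; case: ifPn => [/set_mem Gx|_]; last by apply: HM; lra.
have [l0 _ _ rL] := gap_bounds Gx; have lt := gap_lt Gx.
have ba : gapl x < gapr x by lra.
have [c cab ->] := is_derive_MVT q_dq ba.
by rewrite mulfK ?subr_eq0 ?gt_eqF//; apply: HM; lra.
Qed.

(** The gaps enumerated by the rationals they contain, hence with repetitions; making the sequence
    disjoint then prepares countable additivity. *)
Let T_ (n : nat) : set R :=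
  if unpickle n is Some r then
    if ratr (r : rat) \in G then `]gapl (ratr r), gapr (ratr r)[%classic else set0
  else set0.

Let T_P n : T_ n = set0 \/ exists2 x, G x & T_ n = `]gapl x, gapr x[%classic.
Proof.
rewrite /T_; case: unpickle => [r|]; last by left.
by case: ifPn => [/set_mem Gr|_]; [right; exists (ratr r) | left].
Qed.

Let T_gap n x : T_ n x -> G x /\ T_ n = `]gapl x, gapr x[%classic.
Proof.
have [->//|[y Gy ->]] := T_P n.
rewrite /= in_itv/= => xy; split; first exact: gap_sub xy.
by have [-> ->] := gap_eq Gy xy.
Qed.

Let T_bigcup : \bigcup_n T_ n = G.
Proof.
apply/seteqP; split => [x [n _ /T_gap[]//]|x Gx].
have [r [Gr [rl rr]]] := gap_rational Gx.
exists (pickle r); first exact: Logic.I.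
rewrite /T_ pickleK (mem_set Gr) rl rr /= in_itv/=.
exact: gap_lt.
Qed.

Let F := seqDU T_.

(** Gaps that meet coincide, so removing the earlier members leaves a gap whole at its first
    occurrence and empties it afterwards. *)
Let F_P n : F n = set0 \/ exists2 x, G x & F n = `]gapl x, gapr x[%classic.
Proof.
have [[x [Tx nTx]]|nF] := pselect (F n !=set0); last first.
  by left; apply: contrapT => /eqP/set0P.
rewrite -bigcup_mkord in nTx.
have [Gx Tn] := T_gap Tx; right; exists x => //.
rewrite -Tn; apply/seteqP; split => [z []//|z Tz]; split=> //.
rewrite -bigcup_mkord => -[k kn Tk]; apply: nTx; exists k => //.
have [Gz Tk'] := T_gap Tk.
have [_ Tn'] := T_gap Tz.
by rewrite Tk' -Tn'.
Qed.

Let F_bigcup : \bigcup_n F n = G.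
Proof. by rewrite -seqDU_bigcup_eq T_bigcup. Qed.

Let mF n : measurable (F n).
Proof. by have [->|[x _ ->]] := F_P n. Qed.

Let mG : measurable G.
Proof. exact: open_measurable. Qed.

Let E := gap_endpoints.

Let mE (A : set R) : A `<=` E -> measurable A.
Proof.
move=> AE; apply: countable_measurable => //.
by apply: sub_countable countable_gap_endpoints; exact: subset_card_le.
Qed.

Let split0L : `]0, L[%classic = G `|` (`]0, L[%classic `\` G).
Proof. by rewrite setDUK// => x /GL; rewrite /= in_itv. Qed.

Lemma bdmeas_chord_slope : bdmeas 0 L (chord_slope q dq).
Proof.
split; last exact: gap_chord_bound.
rewrite split0L; apply/measurable_funU => //; first exact: measurableD.
split.
- rewrite -F_bigcup; apply/measurable_fun_bigcup => // n.
  have [->|[x Gx ->]] := F_P n; first exact: measurable_fun_set0.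
  apply: (eq_measurable_fun (cst ((q (gapr x) - q (gapl x)) / (gapr x - gapl x)))) => //.
  move=> y /set_mem /=; rewrite in_itv/= => yx; rewrite /chord_slope mem_set; last exact: gap_sub yx.
  by have [-> ->] := gap_eq Gx yx.
- apply: (eq_measurable_fun dq).
    by move=> y /set_mem [_ nGy]; rewrite /chord_slope memNset.
  by apply: (measurable_funS measurableT) => //; exact: continuous_measurable_fun.
Qed.

Let derive_affine_ext x : 0 < x < L -> ~ E x -> derive1 (affine_ext q) x = chord_slope q dq x.
Proof.
move=> x0L nEx; apply: is_derive_derive1.
have [Gx|nGx] := pselect (G x); first exact: affine_ext_derive_gap.
by rewrite /chord_slope memNset//; exact: affine_ext_derive_contact.
Qed.

Let measurable_derive_affine_ext : measurable_fun (`]0, L[%classic : set R) (derive1 (affine_ext q)).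
Proof.
have mIE : measurable (`]0, L[%classic `&` E) by apply: mE; exact: subIsetr.
rewrite -(setDUK (_ : `]0, L[%classic `&` E `<=` `]0, L[%classic)); last exact: subIsetl.
apply/measurable_funU => //; first exact: measurableD.
split.
  by move=> _ Y _; apply: mE => x [[_ Ex] _].
apply: (eq_measurable_fun (chord_slope q dq)).
  by move=> x /set_mem [/= x0L nEx]; rewrite derive_affine_ext// => Ex; apply: nEx.
by apply: measurable_funS bdmeas_chord_slope.1 => //; exact: subDsetl.
Qed.

Variable p : R -> R.
Hypothesis bp : bdmeas 0 L p.
Hypothesis pG : forall x y z, G x -> gapl x < y < gapr x -> gapl x < z < gapr x -> p y = p z.

Lemma int0L_derive_affine_ext :
  int0L L (fun x => p x * derive1 (affine_ext q) x) = int0L L (fun x => p x * dq x).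
Proof.
have bdq : bdmeas 0 L dq by exact: bdmeas_continuous.
have bc := bdmeas_chord_slope.
have -> : int0L L (fun x => p x * derive1 (affine_ext q) x) =
    int0L L (fun x => p x * chord_slope q dq x).
  congr fine; apply: ae_eq_integral => //.
  - by apply/measurable_EFinP; apply: measurable_funM => //; case: bp.
  - by apply/measurable_EFinP; apply: measurable_funM; [case: bp | case: bc].
  - exists E; split; first exact: mE.
      exact/countable_lebesgue_measure0/countable_gap_endpoints.
    move=> x /=; apply: contra_notP => nEx x0L.
    by rewrite derive_affine_ext//; move: x0L; rewrite in_itv.
apply/eqP; rewrite -subr_eq0 -int0LB; try exact: bdmeas_intble (bdmeasM bp _).
(* This vanishes outside [G]. On a gap [p] is a constant factor, and the remaining integral is 0
   because the chord and [q] agree at both ends. *)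
pose phi x := p x * (chord_slope q dq x - dq x).
have bphi : bdmeas 0 L phi by apply: bdmeasM bp _; exact: bdmeasB.
rewrite (_ : (fun x => _) = phi); last by apply/funext => x; rewrite /phi mulrBr.
have iphi := bdmeas_intble bphi.
rewrite /int0L /Rintegral split0L integral_setU_EFin//; first last.
- by apply/disj_setPS => x [Gx []].
- by rewrite -split0L; case: bphi.
- exact: measurableD.
rewrite [X in (_ + X)%E]integral0_eq ?adde0; last first.
  by move=> x [_ nGx]; rewrite /phi /chord_slope memNset// subrr mulr0.
rewrite -F_bigcup integral_bigcup//; first last.
- by apply: integrableS iphi => //; rewrite F_bigcup// => x /GL; rewrite /= in_itv.
- exact: trivIset_seqDU.
rewrite eseries0// => n _ _.
have [->|[x Gx Fn]] := F_P n; first by rewrite integral_set0.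
rewrite Fn; have ax := gap_lt Gx; set a := gapl x in ax *; set b := gapr x in ax *.
have sub : `]a, b[%classic `<=` `]0, L[%classic.
  by rewrite -Fn => z Fz; have /GL : G z by [rewrite -F_bigcup; exists n]; rewrite /= in_itv.
have ifin : (\int[mu]_(x in `]a, b[) (phi x)%:E)%E \is a fin_num.
  by apply: integrable_fin_num => //; apply: integrableS iphi.
rewrite -(fineK ifin).
have cz : continuous (fun z => (q b - q a) / (b - a) - dq z).
  by move=> w; apply: cvgB; [exact: cvg_cst|exact: cdq].
suff -> : fine (\int[mu]_(x in `]a, b[) (phi x)%:E)%E = 0 by [].
transitivity (\int[mu]_(z in `]a, b[) (p x * ((q b - q a) / (b - a) - dq z))).
  apply: eq_Rintegral => z /set_mem; rewrite /= in_itv/= => zx.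
  rewrite /phi (pG Gx zx ax) /chord_slope mem_set; last exact: gap_sub Gx zx.
  by have [-> ->] := gap_eq Gx zx.
transitivity (p x * \int[mu]_(z in `]a, b[) ((q b - q a) / (b - a) - dq z)).
  apply: RintegralZl => //.
  exact: bdmeas_intble (bdmeas_continuous _ _ cz).
have dch (w : R) : is_derive w 1 (fun z => (q b - q a) / (b - a) * z - q z) ((q b - q a) / (b - a) - dq w).
  by have := q_dq w => ?; apply: is_derive_eq; rewrite /GRing.scale/=; ring.
rewrite (Rintegral_oo_FTC (ltW (lt_trans (andP ax).1 (andP ax).2)) cz dch).
have ba0 : b - a != 0 by rewrite subr_eq0 gt_eqF// (lt_trans (andP ax).1 (andP ax).2).
by rewrite (_ : _ - _ - _ = 0) ?mulr0//; field.
Qed.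

End gaps.

(** * Monotone integrands *)

Section monotone_integrals.
Context {R : realType}.
Notation mu := (@lebesgue_measure R).
Implicit Types (p q dq H : R -> R) (L M S : R).

(* The slope of an envelope on [0, L] is only meaningful, and monotone, inside (0, L). *)
Definition clamp_ends L M p : R -> R :=
  fun x => if x <= 0 then - M else if L <= x then M else p x.

Section clamp.
Variables (L M : R) (p : R -> R).
Hypothesis L0 : 0 < L.
Hypothesis M0 : 0 <= M.
Hypothesis pmono : forall x y, 0 < x -> x <= y -> y < L -> p x <= p y.
Hypothesis pM : forall x, 0 < x < L -> `|p x| <= M.

Lemma clamp_ends_in x : 0 < x < L -> clamp_ends L M p x = p x.
Proof. by move=> /andP[x0 xL]; rewrite /clamp_ends leNgt x0/= leNgt xL. Qed.

Lemma clamp_ends_bound x : `|clamp_ends L M p x| <= M.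
Proof.
rewrite /clamp_ends; case: (leP x 0) => x0; first by rewrite normrN ger0_norm.
by case: (leP L x) => xL; [rewrite ger0_norm | apply: pM; rewrite x0].
Qed.

Lemma clamp_ends_mono : {homo clamp_ends L M p : x y / x <= y}.
Proof.
move=> x y xy; have bx := clamp_ends_bound x; have by_ := clamp_ends_bound y.
move: bx by_; rewrite !ler_norml => /andP[_ bx] /andP[by_ _].
case: (leP x 0) => x0; first by rewrite {1}/clamp_ends x0.
have y0 := lt_le_trans x0 xy.
case: (leP L y) => yL; first by have -> : clamp_ends L M p y = M by rewrite /clamp_ends (leNgt y) y0 yL.
by rewrite !clamp_ends_in ?x0 ?yL ?(lt_le_trans x0 xy) ?(le_lt_trans xy)//; exact: pmono.
Qed.

Lemma bdmeas_nondecreasing : bdmeas 0 L p.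
Proof.
split; last by exists M.
apply: (eq_measurable_fun (clamp_ends L M p)).
  by move=> x /set_mem/=; rewrite in_itv/= => xL; rewrite clamp_ends_in.
by apply: nondecreasing_measurable => //; exact: clamp_ends_mono.
Qed.

End clamp.

(* Bisecting [x, y] halves the second-order term while the first-order terms add up. *)
Lemma bisection_bound p H S M x y :
  0 <= S -> 0 <= M -> x <= y ->
  (forall a b, x <= a -> a <= b -> b <= y -> p a <= p b) ->
  (forall a b, x <= a -> a <= b -> b <= y ->
     `|H b - H a| <= (p b - p a) * (S + M * (b - a))) ->
  `|H y - H x| <= (p y - p x) * S.
Proof.
move=> S0 M0 xy pm Hb.
have halve n a b : x <= a -> a <= b -> b <= y ->
    `|H b - H a| <= (p b - p a) * (S + M * (b - a) / 2 ^+ n).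
  elim: n a b => [|n ih] a b xa ab by_; first by rewrite expr0 divr1; exact: Hb.
  pose m := (a + b) / 2.
  have am : a <= m by rewrite /m; lra.
  have mb : m <= b by rewrite /m; lra.
  have h1 := ih a m xa am (le_trans mb by_).
  have h2 := ih m b (le_trans xa am) mb by_.
  have := ler_normD (H b - H m) (H m - H a); rewrite addrA subrK => /le_trans; apply.
  apply: le_trans (lerD h2 h1) _.
  have e1 : M * (b - m) / 2 ^+ n = M * (b - a) / 2 ^+ n.+1.
    by rewrite /m exprS; field; rewrite expf_neq0.
  have e2 : M * (m - a) / 2 ^+ n = M * (b - a) / 2 ^+ n.+1.
    by rewrite /m exprS; field; rewrite expf_neq0.
  by rewrite e1 e2 -mulrDl [p b - _ + _]addrA subrK.
have cv : (p y - p x) * (S + M * (y - x) / 2 ^+ n) @[n --> \oo] --> (p y - p x) * S.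
  have -> : (p y - p x) * S = (p y - p x) * (S + M * (y - x) * 0) by ring.
  apply: cvgM; first exact: cvg_cst.
  apply: cvgD; first exact: cvg_cst.
  apply: cvgM; first exact: cvg_cst.
  under eq_fun do rewrite -exprVn.
  by apply: cvg_expr; rewrite ger0_norm ?invr_ge0// invf_lt1// ltr1n.
rewrite -(cvg_lim (@Rhausdorff R) cv); apply: limr_ge; first exact: cvgP cv.
by apply: nearW => n; exact: halve.
Qed.

(* The bound does not involve [dq]: over [a, b] the function [int_0^x p q' - p q]
   varies by at most [(p b - p a) (S + M (b - a))], and bisection removes [M]. *)
Lemma monotone_integral_bound L p q dq S : 0 < L ->
  (forall x y, 0 < x -> x <= y -> y < L -> p x <= p y) ->
  (forall x, 0 < x < L -> `|p x| <= 1) ->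
  (forall x : R, is_derive x 1 q (dq x)) -> continuous dq ->
  q 0 = 0 -> q L = 0 -> (forall x, 0 <= x <= L -> `|q x| <= S) ->
  `|int0L L (fun x => p x * dq x)| <= 2 * S.
Proof.
move=> L0 pm p1 dQ cdq q0 qL qS.
pose P := clamp_ends L 1 p.
have Pm : {homo P : x y / x <= y} by exact: clamp_ends_mono.
have P1 x : `|P x| <= 1 by exact: clamp_ends_bound.
have S0 : 0 <= S by apply: le_trans (normr_ge0 _) (qS 0 _); rewrite lexx ltW.
have [M qM] := continuous_bounded 0 L cdq.
have M0 : 0 <= M by apply: le_trans (normr_ge0 _) (qM 0 _); rewrite lexx ltW.
have bP : bdmeas 0 L P.
  split; last by exists 1 => x _; exact: P1.
  by apply: nondecreasing_measurable.
have bPdq := bdmeasM bP (bdmeas_continuous 0 L cdq).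
have -> : int0L L (fun x => p x * dq x) = int0L L (fun x => P x * dq x).
  by apply: eq_int0L => x x0L; rewrite /P clamp_ends_in.
have iPdq : mu.-integrable `]0, L] (EFin \o (fun x => P x * dq x)).
  apply: measurable_bounded_integrable => //=.
  - by rewrite lebesgue_measure_itv/=; case: ifP => _; rewrite ?ltry// -EFinB ltry.
  - apply: measurable_funM; first exact: nondecreasing_measurable.
    by apply: (measurable_funS measurableT) => //; exact: continuous_measurable_fun.
  - exists M; split; first exact: num_real.
    move=> y My x /=; rewrite in_itv/= => /andP[x0 xL].
    apply: le_trans (ltW My); rewrite normrM -[M]mul1r ler_pM//; apply: qM.
    by rewrite ltW.
pose J x := \int[mu]_(t in `]0, x]) (P t * dq t).
have JL : int0L L (fun x => P x * dq x) = J L.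
  by rewrite /int0L Rintegral_itv_bndo_bndc//; exact: bdmeas_intble.
(* On [a, b] the monotone [P] differs from [P a] by at most [P b - P a]. *)
have JB a b : 0 <= a -> a <= b -> b <= L ->
    `|(J b - J a) - P a * (q b - q a)| <= (P b - P a) * (M * (b - a)).
  move=> a0 ab bL.
  have sub : `]a, b[%classic `<=` `]0, L]%classic.
    by move=> x /=; rewrite !in_itv/= => /andP[ax xb]; apply/andP; split; lra.
  have iab : intble a b (fun x => P x * dq x) by exact: integrableS iPdq.
  rewrite /J Rintegral_itvB//; first last.
    by apply: integrableS iPdq => // x /=; rewrite !in_itv/= => /andP[x0 xb]; rewrite x0 (le_trans xb bL).
  rewrite -Rintegral_itv_bndo_bndc//.
  rewrite -(Rintegral_oo_FTC ab cdq dQ).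
  have idq : intble a b dq by exact/bdmeas_intble/bdmeas_continuous.
  rewrite -(RintegralZl _ _ idq)//.
  rewrite -RintegralB//; last exact: intbleZ.
  have ii : intble a b (fun x => P x * dq x - P a * dq x) by apply: intbleB => //; exact: intbleZ.
  apply: le_trans (le_normr_Rintegral _ ii) _; first by [].
  have -> : (P b - P a) * (M * (b - a)) = \int[mu]_(t in `]a, b[) ((P b - P a) * M).
    rewrite Rintegral_cst//= lebesgue_measure_itv/= lte_fin.
    move: ab; rewrite le_eqVlt => /orP[/eqP->|->]/=; last by rewrite mulrA.
    by rewrite ltxx !subrr !mul0r.
  apply: le_Rintegral => //; first exact: integrable_norm.
    exact: bdmeas_intble (bdmeas_cst _ _ _).
  move=> x /=; rewrite in_itv/= => /andP[ax xb].
  rewrite -mulrBl normrM ger0_norm; last by rewrite subr_ge0 Pm// ltW.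
  apply: ler_pM => //; first by rewrite subr_ge0 Pm// ltW.
    by rewrite lerD2r Pm// ltW.
  by apply: qM; apply/andP; split; lra.
have := @bisection_bound P (fun x => J x - P x * q x) S M 0 L S0 M0 (ltW L0).
move=> /(_ (fun a b _ ab _ => Pm a b ab)); rewrite q0 qL !mulr0 !subr0.
have J0 : J 0 = 0 by rewrite /J set_itv_ge ?bnd_simp ?ltxx// Rintegral_set0.
rewrite JL J0 subr0 => H; apply: le_trans (H _) _.
  move=> a b a0 ab bL.
  have -> : J b - P b * q b - (J a - P a * q a) =
     ((J b - J a) - P a * (q b - q a)) - (P b - P a) * q b by ring.
  apply: le_trans (ler_normB _ _) _; rewrite [leRHS]mulrDr addrC.
  apply: lerD; last exact: JB.
  rewrite normrM ger0_norm ?subr_ge0 ?Pm//; apply: ler_wpM2l; first by rewrite subr_ge0 Pm.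
  by apply: qS; apply/andP; split; lra.
(* The factor 2 bounds the total increment of [P], whose values lie in [-1, 1]. *)
apply: ler_wpM2r => //.
have := P1 0; have := P1 L; rewrite !ler_norml; lra.
Qed.

End monotone_integrals.

(** * Global solutions of differential systems *)

Section primitive.
Context {R : realType}.
Notation mu := (@lebesgue_measure R).
Implicit Types (g : R -> R).

(** Integrating from a base point to the left of both [x] and 0 treats all signs of [x] alike. After
    normalisation at 0 the result does not depend on the base point, which can thus be frozen near
    [x]. *)
Lemma continuous_primitive g : continuous g ->
  exists P : R -> R, P 0 = 0 /\ forall x : R, is_derive x 1 P (g x).
Proof.
move=> cg.
have ig a b : mu.-integrable `]a, b] (EFin \o g).
  apply: (@integrableS _ _ _ mu `[a, b]) => //.
    by apply: subset_itv; rewrite bnd_simp.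
  apply: continuous_compact_integrable; first exact: segment_compact.
  exact: continuous_subspaceT.
pose I A x := \int[mu]_(t in `]A, x]) g t - \int[mu]_(t in `]A, 0]) g t.
have IAB A B x : A <= B -> B <= x -> B <= 0 -> I A x = I B x.
  move=> AB Bx B0; rewrite /I.
  by rewrite -[in RHS](@Rintegral_itvB _ g (BRight A) (BRight x) B)//
    -[in RHS](@Rintegral_itvB _ g (BRight A) (BRight 0) B)// opprB addrA subrK.
exists (fun x => I (- `|x| - 1) x); split; first by rewrite /I subrr.
(* A base point to the left of the moving base points of all [y] at distance less than 1 from
   [x]. *)
move=> x; pose A := - `|x| - 2.
have Ax : A < x by rewrite /A; have := ler_norm (- x); rewrite normrN; lra.
have dI : is_derive x 1 (I A) (g x).
  have x1 : x < x + 1 by rewrite ltrDl.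
  have Ax' : (BRight A < BRight x)%O by rewrite bnd_simp.
  have [dF gx] := continuous_FTC1 x1 (ig A (x + 1)) Ax' (@cg x).
  rewrite -[g x]subr0 -gx derive1E; apply: is_deriveB; exact/derivableP.
apply: near_eq_is_derive dI.
apply/nbhs_ballP; exists 1 => //= y; rewrite /ball/= => xy.
have yx : `|y| <= `|x| + 1.
  by have := ler_normD x (y - x); rewrite subrKC distrC; lra.
apply: IAB; rewrite /A; first lra.
  by have := ler_norm (- y); rewrite normrN; lra.
by have := normr_ge0 y; lra.
Qed.

Lemma is_derive_bigsum (I : Type) (s : seq I) (P : pred I) (f : I -> R -> R) (df : I -> R) (x : R) :
  (forall i, is_derive x 1 (f i) (df i)) ->
  is_derive x 1 (fun y => \sum_(i <- s | P i) f i y) (\sum_(i <- s | P i) df i).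
Proof.
move=> fdf; elim: s => [|i s ih].
  by rewrite big_nil; under eq_fun do rewrite big_nil; exact: is_derive_cst.
rewrite big_cons; under eq_fun do rewrite big_cons.
by case: (P i) => //; exact: is_deriveD.
Qed.

Lemma cvg_bigsum (I : Type) (s : seq I) (P : pred I) (T : Type) (D : set_system T) {FD : Filter D}
    (f : I -> T -> R) (l : I -> R) :
  (forall i, f i t @[t --> D] --> l i) ->
  \sum_(i <- s | P i) f i t @[t --> D] --> \sum_(i <- s | P i) l i.
Proof.
move=> fl; elim: s => [|i s ih].
  by rewrite big_nil; under eq_fun do rewrite big_nil; exact: cvg_cst.
rewrite big_cons; under eq_fun do rewrite big_cons.
by case: (P i) => //; exact: cvgD.
Qed.

(** The intervals of radius [2 * A / 2 ^+ m] around [u m] are nested. The supremum of their left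
    ends lies in all of them, which gives the limit together with its rate. *)
Lemma geometric_cvg (u : nat -> R) A :
  (forall m, `|u m.+1 - u m| <= A / 2 ^+ m) ->
  exists l : R, forall m, `|u m - l| <= 2 * A / 2 ^+ m.
Proof.
move=> uA; have A0 : 0 <= A by have := uA 0%N; rewrite expr0 divr1; apply: le_trans.
pose v m := u m - 2 * A / 2 ^+ m; pose w m := u m + 2 * A / 2 ^+ m.
have half m : A / 2 ^+ m = 2 * A / 2 ^+ m.+1 by rewrite exprS; field; rewrite expf_neq0.
have dbl m : 2 * A / 2 ^+ m = 2 * (A / 2 ^+ m) by rewrite mulrA.
have vS m : v m <= v m.+1.
  by have := uA m; rewrite ler_norml /v -half dbl; lra.
have wS m : w m.+1 <= w m.
  by have := uA m; rewrite ler_norml /w -half dbl; lra.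
have vm : {homo v : n m / (n <= m)%N >-> n <= m} by apply: homo_leq => //; exact: le_trans.
have wm n m : (n <= m)%N -> w m <= w n.
  elim: m => [|m ih]; first by rewrite leqn0 => /eqP->.
  by rewrite leq_eqVlt => /predU1P[-> //|/ih]; exact: le_trans.
have vw m : v m <= w m.
  by have : 0 <= 2 * A / 2 ^+ m by [rewrite divr_ge0 ?exprn_ge0 ?mulr_ge0]; rewrite /v /w; lra.
have vwn n m : v n <= w m.
  by apply: le_trans (vm _ _ (leq_maxl n m)) (le_trans (vw _) (wm _ _ (leq_maxr n m))).
exists (sup (range v)) => m; rewrite ler_norml.
have h1 : v m <= sup (range v).
  by apply: ub_le_sup; [exists (w 0%N) => _ [n _ <-] | exists m].
have h2 : sup (range v) <= w m.
  by apply: ge_sup; [exists (v 0%N); exists 0%N | move=> _ [n _ <-]].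
by move: h1 h2; rewrite /v /w; lra.
Qed.

Lemma geometric_small (a A : R) : (forall m, `|a| <= A / 2 ^+ m) -> a = 0.
Proof.
move=> aA; apply/normr0_eq0/eqP; rewrite eq_le normr_ge0 andbT.
apply: (@cvgr_to_ge _ \oo _ _ (fun m => A / 2 ^+ m)); last exact: nearW.
rewrite -[X in _ --> X](mulr0 A); apply: cvgM; first exact: cvg_cst.
under eq_fun do rewrite -exprVn.
by apply: cvg_expr; rewrite ger0_norm ?invr_ge0// invf_lt1// ltr1n.
Qed.

End primitive.

Section ode.
Context {R : realType} {I : finType}.
Implicit Types (X Y : I -> R) (t s : R) (i : I).

Definition norm1 X : R := \sum_i `|X i|.

Lemma norm1_ge0 X : 0 <= norm1 X.
Proof. by apply: sumr_ge0. Qed.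

Lemma le_norm1 X i : `|X i| <= norm1 X.
Proof. by rewrite /norm1 (bigD1 i)//= lerDl sumr_ge0. Qed.

Lemma norm1D X Y : norm1 (fun i => X i + Y i) <= norm1 X + norm1 Y.
Proof. by rewrite -big_split/=; apply: ler_sum => i _; exact: ler_normD. Qed.

Lemma norm1_subl X Y : norm1 X <= norm1 (fun i => X i - Y i) + norm1 Y.
Proof.
rewrite -big_split/=; apply: ler_sum => i _; rewrite -[X in `|X|](subrK (Y i)).
exact: ler_normD.
Qed.

Lemma norm1_cvg (x : R -> I -> R) (l : I -> R) (D : set_system R) {FD : Filter D} :
  (forall i, x t i @[t --> D] --> l i) -> norm1 (fun i => x t i - l i) @[t --> D] --> 0.
Proof.
move=> xl; rewrite [X in _ --> X](_ : 0 = \sum_(i : I) 0); last by rewrite big1.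
apply: cvg_bigsum => i; rewrite -[X in _ --> X](normr0 R); apply: cvg_norm.
by rewrite -(subrr (l i)); apply: cvgB => //; exact: cvg_cst.
Qed.

(** * Uniqueness by Gronwall's inequality *)

Section gronwall.
Variables (x y : R -> I -> R) (dx dy : R -> I -> R) (T K : R).
Hypothesis T0 : 0 <= T.
Hypothesis K0 : 0 <= K.
Hypothesis cx : forall i, {within `[0, T], continuous (x ^~ i)}.
Hypothesis cy : forall i, {within `[0, T], continuous (y ^~ i)}.
Hypothesis dxP : forall t i, 0 < t < T -> is_derive t 1 (x ^~ i) (dx t i).
Hypothesis dyP : forall t i, 0 < t < T -> is_derive t 1 (y ^~ i) (dy t i).
Hypothesis lip : forall t, 0 < t < T ->
  norm1 (fun i => dx t i - dy t i) <= K * norm1 (fun i => x t i - y t i).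

(** The sum of squares [h] is differentiable where [norm1] is not, and the square of [norm1] is at
    most [#|I|] times it, so [h' <= c * h] and [h] times [expR (- c * t)] is nonincreasing.
    Derivatives are assumed in the open interval only, in accordance with the one-sided derivatives
    at the ends of the time domain. *)
Lemma gronwall_unique : (forall i, x 0 i = y 0 i) -> forall i, x T i = y T i.
Proof.
move=> xy0.
pose h t := \sum_i (x t i - y t i) ^+ 2.
pose dh t := \sum_i (2 * (x t i - y t i) * (dx t i - dy t i)).
pose c := 2 * K * #|I|%:R.
have dhP t : 0 < t < T -> is_derive t 1 h (dh t).
  move=> tT; apply: is_derive_bigsum => i.
  have := dxP i tT; have := dyP i tT => ? ?.
  by apply: is_derive_eq; rewrite /GRing.scale/=; ring.
have dh_le t : 0 < t < T -> dh t <= c * h t.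
  move=> tT; pose N := norm1 (fun i => x t i - y t i).
  have N0 : 0 <= N by exact: norm1_ge0.
  have h1 : dh t <= 2 * N * (K * N).
    apply: (@le_trans _ _ (\sum_i 2 * N * `|dx t i - dy t i|)).
      apply: ler_sum => i _; apply: le_trans (ler_norm _) _; rewrite !normrM.
      rewrite ger0_norm// ler_wpM2r// ler_wpM2l//.
      exact: (le_norm1 (fun i => x t i - y t i)).
    by rewrite -mulr_sumr; apply: ler_wpM2l; [rewrite mulr_ge0|exact: lip].
  apply: le_trans h1 _.
  have N2 : N ^+ 2 <= #|I|%:R * h t.
    have sq (a b : R) : `|a| * `|b| <= 2^-1 * (a ^+ 2 + b ^+ 2).
      have := sqr_ge0 (`|a| - `|b|); rewrite sqrrB !real_normK ?num_real//; lra.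
    rewrite expr2 /N /norm1 mulr_suml.
    apply: (@le_trans _ _ (\sum_i \sum_j 2^-1 * ((x t i - y t i) ^+ 2 + (x t j - y t j) ^+ 2))).
      by apply: ler_sum => i _; rewrite mulr_sumr; apply: ler_sum => j _; exact: sq.
    rewrite le_eqVlt; apply/orP; left; apply/eqP.
    under eq_bigr do rewrite -mulr_sumr big_split/= sumr_const.
    rewrite -mulr_sumr big_split/= sumrMnl sumr_const -/(h t).
    by rewrite -[h t *+ _]mulr_natl; field.
  by have := ler_wpM2l (mulr_ge0 (ler0n _ 2) K0) N2; rewrite /c expr2; lra.
pose k t := h t * expR (- c * t).
have dk t : 0 < t < T -> is_derive t 1 k ((dh t - c * h t) * expR (- c * t)).
  move=> tT; have := dhP t tT => ?.
  by apply: is_derive_eq; rewrite /GRing.scale/=; ring.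
have ck : {within `[0, T], continuous k}.
  move=> t; apply: cvgM.
    apply: cvg_bigsum => i; rewrite -![_ ^+ 2]/(_ * _).
    have := @cx i t; have := @cy i t => h1 h2.
    by apply: cvgM; apply: cvgB.
  apply: continuous_subspaceT => {}t.
  apply: continuous_comp; last exact: continuous_expR.
  by apply: cvgM; [exact: cvg_cst|exact: cvg_id].
have k0 : k 0 = 0.
  by rewrite /k /h big1 ?mul0r// => i _; rewrite xy0 subrr expr0n.
have kT : k T <= 0.
  rewrite -k0; apply: (ler0_derive1_le_cc _ _ ck) => //.
  - by move=> t; rewrite in_itv/= => /dk[].
  - move=> t; rewrite in_itv/= => tT; have [_] := dk t tT; rewrite derive1E => ->.
    by rewrite mulr_le0_ge0 ?expR_ge0// subr_le0 dh_le.
  - by rewrite in_itv/= lexx T0.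
  - by rewrite in_itv/= lexx T0.
have hT : h T = 0.
  apply/eqP; rewrite eq_le sumr_ge0 ?andbT; last by move=> i _; exact: sqr_ge0.
  by move: kT; rewrite /k pmulr_lle0// expR_gt0.
move=> i; move/eqP: hT; rewrite /h psumr_eq0 => [/allP/(_ i)|j _]; last exact: sqr_ge0.
by rewrite mem_index_enum => /(_ isT); rewrite sqrf_eq0 subr_eq0 => /eqP.
Qed.

End gronwall.

Section comparison.
Variables (P g : R -> I -> R) (b db : R -> R).
Hypothesis Pg : forall t i, is_derive t 1 (P ^~ i) (g t i).
Hypothesis bdb : forall t, is_derive t 1 b (db t).

(** The mean value theorem is applied to one scalar function: the components are summed with the
    signs of their final increments, frozen in time, so that at [T] the sum is the norm. *)
Lemma norm1_derive_le T : 0 <= T ->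
  (forall s, 0 <= s <= T -> norm1 (g s) <= db s) ->
  norm1 (fun i => P T i - P 0 i) <= b T - b 0.
Proof.
rewrite le_eqVlt => /predU1P[<- _|T0 gdb].
  by rewrite subrr /norm1 big1// => i _; rewrite subrr normr0.
pose e i := Num.sg (P T i - P 0 i).
pose h t := \sum_i e i * P t i - b t.
have dh t : is_derive t 1 h (\sum_i e i * g t i - db t).
  by apply: is_deriveB; apply: is_derive_bigsum.
have [s sT E] := is_derive_MVT dh T0.
have dhs : \sum_i e i * g s i - db s <= 0.
  rewrite subr_le0; apply: le_trans (gdb s _); last by case/andP: sT => /ltW -> /ltW.
  apply: ler_sum => i _; apply: le_trans (ler_norm _) _; rewrite normrM normr_sg.
  by case: (_ != 0); rewrite ?mul1r// mul0r.
have : h T - h 0 <= 0 by rewrite E pmulr_lle0// subr_gt0.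
rewrite /h /norm1 (_ : \sum_i `|P T i - P 0 i| = \sum_i e i * P T i - \sum_i e i * P 0 i); first lra.
by rewrite -sumrB; apply: eq_bigr => i _; rewrite -mulrBr normrEsg.
Qed.

End comparison.

(** * Picard iteration for a vector field of linear growth *)

Section picard.
Variables (F : (I -> R) -> I -> R) (C : R).
Hypothesis C0 : 0 < C.
Hypothesis growth : forall X, norm1 (F X) <= C * (1 + norm1 X).
Hypothesis lip : forall B, exists2 K : R, 0 < K & forall X Y, norm1 X <= B -> norm1 Y <= B ->
  norm1 (fun i => F X i - F Y i) <= K * norm1 (fun i => X i - Y i).

Lemma lipschitz_continuous_comp (x : R -> I -> R) : (forall i, continuous (x ^~ i)) ->
  forall i, continuous (fun t => F (x t) i).
Proof.
move=> cx i t; have [K K0 KP] := lip (norm1 (x t) + 1).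
have cv : norm1 (fun i => x s i - x t i) @[s --> t] --> 0.
  by apply: norm1_cvg => j; exact: cx.
apply/cvgrPdist_le => e e0.
near=> s.
have xs : norm1 (fun i => x s i - x t i) <= Num.min 1 (e / K).
  near: s; have /cvgrPdist_le/(_ (Num.min 1 (e / K))) := cv.
  rewrite lt_min ltr01 divr_gt0// => /(_ isT).
  by apply: filterS => s; rewrite sub0r normrN ger0_norm// norm1_ge0.
move: xs; rewrite le_min => /andP[xs1 xsK].
have xsB : norm1 (x s) <= norm1 (x t) + 1.
  by have := norm1_subl (x s) (x t); lra.
have := KP (x s) (x t) xsB; rewrite lerDl => /(_ ler01) le1.
rewrite distrC; apply: le_trans (le_norm1 (fun i => F (x s) i - F (x t) i) i) _.
by apply: le_trans le1 _; rewrite -ler_pdivlMl// mulrC.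
Unshelve. all: by end_near. Qed.

Definition primitive (g : R -> R) : R -> R :=
  xget (fun=> 0) [set P : R -> R | P 0 = 0 /\ forall x : R, is_derive x 1 P (g x)].

Lemma primitiveP g : continuous g ->
  primitive g 0 = 0 /\ forall x : R, is_derive x 1 (primitive g) (g x).
Proof. by move=> cg; apply: xgetPex (continuous_primitive cg). Qed.

Variable x0 : I -> R.

(* Freezing the vector field at negative times makes all derivatives two-sided,
   also at time 0. *)
Fixpoint picard (m : nat) (t : R) (i : I) : R :=
  if m is m'.+1 then x0 i + primitive (fun s => F (picard m' (Num.max s 0)) i) t
  else x0 i.

Let vel m t := F (picard m (Num.max t 0)).

Let max_continuous : continuous (fun t : R => Num.max t 0).
Proof. by move=> t; apply: continuous_max; [exact: cvg_id|exact: cvg_cst]. Qed.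

Let picard_continuous m i : continuous (picard m ^~ i).
Proof.
elim: m i => [|m ih] i t; first exact: cvg_cst.
have cv : continuous (fun s => vel m s i).
  apply: (lipschitz_continuous_comp (x := fun s => picard m (Num.max s 0))) => j s.
  by apply: (@continuous_comp _ _ _ (fun t => Num.max t 0) (picard m ^~ j)); [exact: max_continuous|exact: ih].
have [_ dP] := primitiveP cv.
by apply: cvgD; [exact: cvg_cst|exact: (is_derive_continuous dP)].
Qed.

Let vel_continuous m i : continuous (fun t => vel m t i).
Proof.
apply: (lipschitz_continuous_comp (x := fun s => picard m (Num.max s 0))) => j s.
by apply: (@continuous_comp _ _ _ (fun t => Num.max t 0) (picard m ^~ j)); [exact: max_continuous|exact: picard_continuous].
Qed.

Let picard_derive m t i : is_derive t 1 (picard m.+1 ^~ i) (vel m t i).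
Proof.
have [_ dP] := primitiveP (@vel_continuous m i).
by rewrite -[vel m t i]add0r; apply: is_deriveD; exact: is_derive_cst.
Qed.

Let picard0 m i : picard m 0 i = x0 i.
Proof.
case: m => [//|m] /=; have [-> _] := primitiveP (@vel_continuous m i).
by rewrite addr0.
Qed.

Let N0 := 1 + norm1 x0.

Let bound T := N0 * expR (C * T).

Let bound_derive t : is_derive t 1 bound (C * bound t).
Proof. by rewrite /bound; apply: is_derive_eq; rewrite /GRing.scale/=; ring. Qed.

(** [bound] solves [b' = C * b] with [b 0 = 1 + norm1 x0], so the growth hypothesis carries this
    bound from one iterate to the next, on the whole half-line. *)
Let picard_bound m t : 0 <= t -> norm1 (picard m t) <= bound t - 1.
Proof.
have N01 : 0 <= norm1 x0 by exact: norm1_ge0.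
elim: m t => [|m ih] t t0.
  have : 1 <= expR (C * t) by rewrite -expR0 ler_expR mulr_ge0// ltW.
  by rewrite /bound /N0 => h; have := ler_wpM2l (addr_ge0 ler01 N01) h; lra.
have H : norm1 (fun i => picard m.+1 t i - picard m.+1 0 i) <= bound t - bound 0.
  apply: (norm1_derive_le (picard_derive m) bound_derive t0) => s /andP[s0 _].
  rewrite /vel max_l//; apply: le_trans (growth _) _; rewrite ler_pM2l//.
  by have := ih s s0; lra.
have H2 := norm1_subl (picard m.+1 t) (picard m.+1 0).
have E : picard m.+1 0 = x0 by apply/funext => i; exact: picard0.
have b0 : bound 0 = 1 + norm1 x0 by rewrite /bound mulr0 expR0 mulr1.
by rewrite E in H H2; move: H H2; rewrite b0; lra.
Qed.

Let bound_mono s t : s <= t -> bound s <= bound t.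
Proof.
move=> st; have N01 : 0 <= norm1 x0 by exact: norm1_ge0.
by apply: ler_wpM2l; [rewrite addr_ge0|rewrite ler_expR ler_wpM2l// ltW].
Qed.

Let picard_bound_on T m t : 0 <= t <= T -> norm1 (picard m t) <= bound T.
Proof. by move=> /andP[t0 tT]; have := picard_bound m t0; have := bound_mono tT; lra. Qed.

(** With the weight [expR (2 * K * t)] one step of the iteration halves the distance, because
    integrating [K] times the weight gives at most half of it. Convergence is thus geometric on
    intervals of any length; [M] bounds the first difference. *)
Let picard_diff T : 0 <= T -> exists A, forall m t, 0 <= t <= T ->
  norm1 (fun i => picard m.+1 t i - picard m t i) <= A / 2 ^+ m.
Proof.
move=> T0; have [K K0 KP] := lip (bound T).
have B0 : 0 <= bound T.
  by rewrite mulr_ge0 ?expR_ge0// addr_ge0// norm1_ge0.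
pose M := 2 * bound T.
have M0 : 0 <= M by rewrite mulr_ge0.
have K2 : 0 <= 2 * K by rewrite mulr_ge0// ltW.
exists (M * expR (2 * K * T)) => m t tT.
apply: (@le_trans _ _ (M * expR (2 * K * t) / 2 ^+ m)); last first.
  apply: ler_wpM2r; first by rewrite invr_ge0 exprn_ge0.
  apply: ler_wpM2l => //; rewrite ler_expR; apply: ler_wpM2l => //.
  by case/andP: tT.
elim: m t tT => [|m ih] t tT.
  rewrite expr0 divr1; apply: (@le_trans _ _ M).
    apply: le_trans (norm1D _ _) _; rewrite /M.
    rewrite (_ : norm1 (fun i => - picard 0 t i) = norm1 (picard 0 t)); last first.
      by apply: eq_bigr => i _; rewrite normrN.
    by have := picard_bound_on 1 tT; have := picard_bound_on 0 tT; lra.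
  have [t0 _] := andP tT.
  rewrite ler_peMr// -[X in X <= _]expR0 ler_expR; exact: mulr_ge0.
pose b t := M * expR (2 * K * t) / 2 ^+ m.+1.
have bd s : is_derive s 1 b (K * (M * expR (2 * K * s) / 2 ^+ m)).
  rewrite /b; apply: is_derive_eq; rewrite /GRing.scale/= !mulr0 add0r mulr1.
  by rewrite [2 ^+ m.+1]exprS; field; rewrite expf_neq0.
have dd s i : is_derive s 1 (fun s => picard m.+2 s i - picard m.+1 s i) (vel m.+1 s i - vel m s i).
  by have := picard_derive m.+1 s i; have := picard_derive m s i => ? ?; exact: is_deriveB.
have [t0 _] := andP tT.
have b0 : 0 <= b 0 by rewrite /b divr_ge0 ?exprn_ge0// mulr_ge0 ?expR_ge0.
apply: (@le_trans _ _ (b t - b 0)); last by rewrite gerBl.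
rewrite (_ : (fun i => _) = fun i => (picard m.+2 t i - picard m.+1 t i) -
    (picard m.+2 0 i - picard m.+1 0 i)); last first.
  by apply/funext => i; rewrite !picard0 subrr subr0.
apply: (norm1_derive_le dd bd t0) => s /andP[s0 st]; rewrite /vel max_l//.
have sT : 0 <= s <= T by rewrite s0 (le_trans st)//; case/andP: tT.
apply: le_trans (KP _ _ (picard_bound_on _ sT) (picard_bound_on _ sT)) _.
by rewrite ler_pM2l//; exact: ih.
Qed.

Lemma picard_lindelof_global : exists (x : R -> I -> R) (dx : R -> I -> R),
  [/\ x 0 = x0, forall t i, is_derive t 1 (x ^~ i) (dx t i),
      forall i, continuous (dx ^~ i) & forall t, 0 <= t -> dx t = F (x t)].
Proof.
(* The limit is required to serve all [T] and [A] at once, so that a single choice is valid on every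
   bounded interval; two candidates agree by [geometric_small]. *)
have lim_ex t i : exists l, 0 <= t -> forall T, t <= T -> forall A,
    (forall m s, 0 <= s <= T -> norm1 (fun i => picard m.+1 s i - picard m s i) <= A / 2 ^+ m) ->
    forall m, `|picard m t i - l| <= 2 * A / 2 ^+ m.
  have [t0|t0] := leP 0 t; last by exists 0.
  have lim_A A : (forall m, `|picard m.+1 t i - picard m t i| <= A / 2 ^+ m) ->
      exists l : R, forall m, `|picard m t i - l| <= 2 * A / 2 ^+ m by exact: geometric_cvg.
  have step T A : t <= T ->
      (forall m s, 0 <= s <= T -> norm1 (fun i => picard m.+1 s i - picard m s i) <= A / 2 ^+ m) ->
      forall m, `|picard m.+1 t i - picard m t i| <= A / 2 ^+ m.
    move=> tT HA m; apply: le_trans (HA m t _); last by rewrite t0.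
    exact: (le_norm1 (fun i => picard m.+1 t i - picard m t i)).
  have [A HA] := picard_diff t0.
  have [l lP] := lim_A A (step t A (lexx _) HA).
  exists l => _ T tT A' HA' m.
  have [l' l'P] := lim_A A' (step T A' tT HA').
  suff -> : l = l' by [].
  apply/eqP; rewrite -subr_eq0; apply/eqP.
  apply: (@geometric_small _ _ (2 * A + 2 * A')) => k.
  have := ler_distD (picard k t i) l l'; move/le_trans; apply.
  by rewrite distrC mulrDl lerD.
have /choice[z0 z0P] : forall ti : R * I, exists l, 0 <= ti.1 -> forall T, ti.1 <= T -> forall A,
    (forall m s, 0 <= s <= T -> norm1 (fun i => picard m.+1 s i - picard m s i) <= A / 2 ^+ m) ->
    forall m, `|picard m ti.1 ti.2 - l| <= 2 * A / 2 ^+ m by move=> [t i]; exact: lim_ex.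
pose z t i := z0 (Num.max t 0, i).
have max0 t : 0 <= Num.max t 0 by rewrite le_max lexx orbT.
have zP T t i A : Num.max t 0 <= T ->
    (forall m s, 0 <= s <= T -> norm1 (fun i => picard m.+1 s i - picard m s i) <= A / 2 ^+ m) ->
    forall m, `|picard m (Num.max t 0) i - z t i| <= 2 * A / 2 ^+ m.
  by move=> tT HA m; exact: (z0P (Num.max t 0, i) (max0 t) T tT A HA m).
(* The iterates share a Lipschitz constant in time, which the limit inherits. This makes [F (z s)]
   continuous, so that it has a primitive. *)
have z_dist T : 0 <= T -> forall s t i, 0 <= s -> s <= t -> t <= T ->
    `|z t i - z s i| <= C * (1 + bound T) * (t - s).
  move=> T0 s t i s0 st tT; have [A HA] := picard_diff T0.
  have pd m : `|picard m t i - picard m s i| <= C * (1 + bound T) * (t - s).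
    have B0 : 0 <= bound T by rewrite mulr_ge0 ?expR_ge0// addr_ge0// norm1_ge0.
    have k0 : 0 <= C * (1 + bound T) by apply: mulr_ge0; [exact: ltW | exact: addr_ge0].
    case: m => [|m]; first by rewrite subrr normr0 mulr_ge0// subr_ge0.
    move: st; rewrite le_eqVlt => /predU1P[->|st]; first by rewrite !subrr normr0 mulr0.
    have [c /andP[sc ct] ->] := is_derive_MVT (fun t => picard_derive m t i) st.
    rewrite normrM [`|t - s|]ger0_norm ?subr_ge0 ?(ltW st)//.
    apply: ler_wpM2r; first by rewrite subr_ge0 ltW.
    apply: le_trans (le_norm1 _ _) _; apply: le_trans (growth _) _.
    rewrite ler_pM2l// lerD2l; apply: picard_bound_on; rewrite max0/= ge_max.
    by rewrite (le_trans s0)//; lra.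
  rewrite -subr_ge0; apply: (@cvgr_to_ge _ \oo _ _ (fun m => C * (1 + bound T) * (t - s) + 4 * A / 2 ^+ m
     - `|z t i - z s i|)).
    apply: cvgB; last exact: cvg_cst.
    rewrite -[X in _ --> X]addr0; apply: cvgD; first exact: cvg_cst.
    rewrite -[X in _ --> X](mulr0 (4 * A)); apply: cvgM; first exact: cvg_cst.
    under eq_fun do rewrite -exprVn.
    by apply: cvg_expr; rewrite ger0_norm ?invr_ge0// invf_lt1// ltr1n.
  apply: nearW => m; rewrite subr_ge0.
  have t0 := le_trans s0 st.
  have h1 := @zP T t i A _ HA m; rewrite max_l// in h1.
  have h2 := @zP T s i A _ HA m; rewrite max_l// in h2.
  have := h1 tT; have := h2 (le_trans st tT); have := pd m.
  move: (picard m t i) (picard m s i) => a b h3 h4 h5.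
  have -> : z t i - z s i = (a - b) + (b - z s i) - (a - z t i) by ring.
  apply: le_trans (ler_normB _ _) _; apply: le_trans (lerD (ler_normD _ _) (lexx _)) _.
  by move: h3 h4 h5; rewrite -!mulrA; lra.
have z_cont i : continuous (z ^~ i).
  move=> t; apply/cvgrPdist_le => e e0.
  pose T := Num.max t 0 + 1.
  have T0 : 0 <= T by rewrite addr_ge0.
  pose k := C * (1 + bound T).
  have k0 : 0 < k.
    by rewrite mulr_gt0// ltr_pwDl// mulr_ge0 ?expR_ge0// addr_ge0// norm1_ge0.
  apply/nbhs_ballP; exists (Num.min 1 (e / k)); first by rewrite /= lt_min ltr01 divr_gt0.
  move=> s; rewrite /ball/= lt_min => /andP[st1 stk].
  have zz t' : z t' i = z (Num.max t' 0) i by rewrite /z [Num.max (Num.max t' 0) 0]max_l.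
  have dmax : `|Num.max t 0 - Num.max s 0| <= `|t - s|.
    rewrite ler_norml; have := ler_norm (t - s); have := ler_norm (s - t).
    by rewrite (distrC s t); case: (leP t 0) => ?; case: (leP s 0) => ?; lra.
  have sT : Num.max s 0 <= T.
    by move: dmax; rewrite ler_norml /T; lra.
  have tT : Num.max t 0 <= T by rewrite /T lerDl.
  rewrite (zz t) (zz s); apply: (@le_trans _ _ (k * `|Num.max t 0 - Num.max s 0|)).
    have [st|/ltW st] := leP (Num.max s 0) (Num.max t 0).
      by rewrite [in leRHS]ger0_norm ?subr_ge0//; apply: z_dist.
    by rewrite distrC [in leRHS]distrC [in leRHS]ger0_norm ?subr_ge0//; apply: z_dist.
  rewrite -ler_pdivlMl// mulrC; apply: le_trans dmax _; exact: ltW.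
have Fz_cont := lipschitz_continuous_comp z_cont.
(* [Y] is differentiable on the whole line by construction; it remains to identify it with [z] at
   nonnegative times, both being limits of the iterates. *)
pose Y t i := x0 i + primitive (fun s => F (z s) i) t.
have dY t i : is_derive t 1 (Y ^~ i) (F (z t) i).
  have [_ dP] := primitiveP (Fz_cont i); have := dP t => ?.
  by rewrite -[F (z t) i]add0r; apply: is_deriveD; exact: is_derive_cst.
have Y0 i : Y 0 i = x0 i.
  by rewrite /Y; have [-> _] := primitiveP (Fz_cont i); rewrite addr0.
exists Y, (fun t => F (z t)); split => //; first by apply/funext.
move=> t t0; congr F; apply/funext => i; apply/eqP; rewrite -subr_eq0; apply/eqP.
have [A HA] := picard_diff t0.
have zA s m j : 0 <= s <= t -> `|picard m s j - z s j| <= 2 * A / 2 ^+ m.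
  by move=> /andP[s0 st]; have := @zP t s j A _ HA m; rewrite max_l//; apply.
have zB s m : 0 <= s <= t -> norm1 (fun j => picard m s j - z s j) <= #|I|%:R * (2 * A / 2 ^+ m).
  move=> st; apply: (@le_trans _ _ (\sum_(j : I) 2 * A / 2 ^+ m)).
    by apply: ler_sum => j _; exact: zA.
  by rewrite sumr_const -[leLHS]mulr_natl.
(* A radius that contains the iterates and, by the rate at [m = 0], also the limit. *)
have [K K0 KP] := lip (bound t + #|I|%:R * (2 * A)).
have A0 : 0 <= #|I|%:R * (2 * A).
  have := zB 0 0%N; rewrite lexx t0 expr0 divr1 => /(_ isT).
  by apply: le_trans; exact: norm1_ge0.
have zbound s : 0 <= s <= t -> norm1 (z s) <= bound t + #|I|%:R * (2 * A).
  move=> st; have := norm1_subl (z s) (picard 0 s).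
  have := zB s 0%N st; have := picard_bound_on 0 st.
  rewrite (_ : norm1 (fun j => picard 0 s j - z s j) = norm1 (fun j => z s j - picard 0 s j)).
    by rewrite expr0 divr1; lra.
  by apply: eq_bigr => j _; rewrite distrC.
apply: (@geometric_small _ _ (K * (#|I|%:R * (2 * A)) * t + A)) => m.
pose b s := K * (#|I|%:R * (2 * A / 2 ^+ m)) * s.
have bd s : is_derive s 1 b (K * (#|I|%:R * (2 * A / 2 ^+ m))).
  by rewrite /b; apply: is_derive_eq; rewrite /GRing.scale/= mulr1.
have dd s j : is_derive s 1 (fun s => picard m.+1 s j - Y s j) (vel m s j - F (z s) j).
  by have := picard_derive m s j; have := dY s j => ? ?; exact: is_deriveB.
have := norm1_derive_le dd bd t0.
have -> : b t - b 0 = K * (#|I|%:R * (2 * A)) * t / 2 ^+ m.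
  by rewrite /b mulr0 subr0; ring.
have step : norm1 (fun j => picard m.+1 t j - Y t j - (picard m.+1 0 j - Y 0 j)) =
    norm1 (fun j => picard m.+1 t j - Y t j).
  by apply: eq_bigr => j _; rewrite picard0 Y0 subrr subr0.
rewrite step => /(_ _)/(le_trans (le_norm1 (fun j => picard m.+1 t j - Y t j) i)) H.
have hY : `|picard m.+1 t i - Y t i| <= K * (#|I|%:R * (2 * A)) * t / 2 ^+ m.
  apply: H => s st; have [s0 _] := andP st; rewrite /vel max_l//.
  apply: le_trans (KP _ _ _ (zbound s st)) _.
    by apply: le_trans (picard_bound_on m st) _; rewrite lerDl.
  by rewrite ler_pM2l//; exact: zB.
have hz : `|picard m.+1 t i - z t i| <= A / 2 ^+ m.
  apply: le_trans (zA t m.+1 i _) _; first by rewrite t0 lexx.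
  by rewrite exprS le_eqVlt; apply/orP; left; apply/eqP; field; rewrite expf_neq0.
rewrite distrC; have := ler_distD (picard m.+1 t i) (Y t i) (z t i); move/le_trans; apply.
by rewrite distrC mulrDl lerD.
Qed.

End picard.
End ode.

(** * Cable forces *)

Section tension_direction.
Context {R : realType}.
Implicit Types s : R.

Definition arclen s : R := Num.sqrt (1 + s ^+ 2).

Lemma arclen_gt0 s : 0 < arclen s.
Proof. by rewrite sqrtr_gt0 ltr_pwDl// sqr_ge0. Qed.

Lemma sqr_arclen s : arclen s ^+ 2 = 1 + s ^+ 2.
Proof. by rewrite sqr_sqrtr// addr_ge0// sqr_ge0. Qed.

Lemma norm_le_arclen s : `|s| <= arclen s.
Proof. by rewrite -sqrtr_sqr ler_wsqrtr// lerDr. Qed.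

Lemma arclen_ge1 s : 1 <= arclen s.
Proof. by rewrite -[X in X <= _]sqrtr1 ler_wsqrtr// lerDl sqr_ge0. Qed.

Lemma arclen_le s : arclen s <= 1 + `|s|.
Proof.
rewrite -(@ler_pXn2r _ 2)// ?nnegrE ?addr_ge0// ?(ltW (arclen_gt0 s))//.
rewrite sqr_arclen sqrrD expr1n real_normK ?num_real// mul1r.
by rewrite lerD2r lerDl mulrn_wge0.
Qed.

Lemma is_derive_arclen s : is_derive s 1 arclen (s / arclen s).
Proof.
have p : 0 < 1 + s ^+ 2 by rewrite ltr_pwDl// sqr_ge0.
have d1 := is_derive1_sqrt p.
have d2 : is_derive s 1 (fun s : R => 1 + s ^+ 2) (2 * s).
  by apply: is_derive_eq; rewrite /GRing.scale/=; ring.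
have := @is_derive1_comp _ Num.sqrt (fun s : R => 1 + s ^+ 2) s _ _ d1 d2.
have a0 := arclen_gt0 s; rewrite (_ : _ * (2 * s) = s / arclen s)//.
by rewrite -/(arclen s); field; rewrite gt_eqF.
Qed.

(** The sine of the inclination angle of a cable of slope [s]. *)
Definition tdir s : R := s / arclen s.

Lemma is_derive_tdir s : is_derive s 1 tdir ((arclen s) ^- 3).
Proof.
have a0 : arclen s != 0 by rewrite gt_eqF// arclen_gt0.
have := is_derive_arclen s => ?.
have dV := @is_deriveV R arclen s 1 (s / arclen s) a0.
have : is_derive s 1 (fun s => s * (arclen s)^-1) (s * (- arclen s ^- 2 * (s / arclen s)) + (arclen s)^-1 * 1).
  by have := dV _ => ?; exact: is_deriveM.
rewrite (_ : _ + _ = arclen s ^- 3)//.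
rewrite mulr1 (_ : s * (- arclen s ^- 2 * (s / arclen s)) = - (s ^+ 2) * arclen s ^- 3).
  have -> : s ^+ 2 = arclen s ^+ 2 - 1 by rewrite sqr_arclen; ring.
  by field.
by field.
Qed.

Lemma arclen_lip s s' : `|arclen s - arclen s'| <= `|s - s'|.
Proof.
wlog : s s' / s' <= s.
  move=> H; have [/ltW|] := ltP s s'; last exact: H.
  by rewrite distrC (distrC s); exact: H.
rewrite le_eqVlt => /predU1P[->|ss']; first by rewrite !subrr.
have [c _ ->] := is_derive_MVT is_derive_arclen ss'.
rewrite normrM ler_piMl// normrM normfV [`|arclen c|]gtr0_norm ?arclen_gt0//.
by rewrite ler_pdivrMr ?arclen_gt0// mul1r norm_le_arclen.
Qed.

(** This is the derivative of [tdir]: positivity gives monotonicity, the upper bound gives the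
    Lipschitz constant 1. *)
Let arclenX3 s : 0 < arclen s ^- 3 <= 1.
Proof.
rewrite invr_gt0 exprn_gt0 ?arclen_gt0//= invf_le1 ?exprn_gt0 ?arclen_gt0//.
by rewrite exprn_ege1// arclen_ge1.
Qed.

Lemma tdir_lip s s' : `|tdir s - tdir s'| <= `|s - s'|.
Proof.
wlog : s s' / s' <= s.
  move=> H; have [/ltW|] := ltP s s'; last exact: H.
  by rewrite distrC (distrC s); exact: H.
rewrite le_eqVlt => /predU1P[->|ss']; first by rewrite !subrr.
have [c _ ->] := is_derive_MVT is_derive_tdir ss'.
have /andP[h1 h2] := arclenX3 c.
by rewrite normrM ler_piMl// gtr0_norm.
Qed.

Lemma tdir_mono s s' : s <= s' -> tdir s <= tdir s'.
Proof.
rewrite le_eqVlt => /predU1P[->//|ss'].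
have [c _ E] := is_derive_MVT is_derive_tdir ss'.
have /andP[h1 h2] := arclenX3 c.
by rewrite -subr_ge0 E mulr_ge0 ?subr_ge0 ?ltW.
Qed.

Lemma tdir_le1 s : `|tdir s| <= 1.
Proof.
rewrite normrM normfV [`|arclen s|]gtr0_norm ?arclen_gt0//.
by rewrite ler_pdivrMr ?arclen_gt0// mul1r norm_le_arclen.
Qed.

End tension_direction.

Section force.
Context {R : realType}.
Variable c : constants R.
Implicit Types (u du q dq v : R -> R).
Let L := cL c.
Let L0 : 0 < L := cL_gt0 c.

Definition dyrest (x : R) : R := - (8 * cs0 c / cL c ^+ 2) * x + 4 * cs0 c / cL c.

Lemma is_derive_yrest (x : R) : is_derive x 1 (yrest c) (dyrest x).
Proof.
apply: is_derive_eq; rewrite /dyrest /GRing.scale/= ; ring.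
Qed.

Section one.
Variables (u du : R -> R).
Hypothesis udu : forall x : R, is_derive x 1 u (du x).
Variable B : R.
Hypothesis uB : forall x, 0 < x < L -> `|du x| <= B.

Let f := u \+ yrest c.
Let df x := du x + dyrest x.

Let fdf (x : R) : is_derive x 1 f (df x).
Proof. have := udu x; have := is_derive_yrest x => ? ?; exact: is_deriveD. Qed.

Let cf : continuous f := is_derive_continuous fdf.

Definition dymax : R := `|8 * cs0 c / cL c| + `|4 * cs0 c / cL c|.

Lemma dyrest_bound x : 0 < x < L -> `|dyrest x| <= dymax.
Proof.
move=> /andP[x0 xL]; apply: le_trans (ler_normD _ _) _; rewrite lerD2r.
rewrite normrM normrN.
have -> : 8 * cs0 c / cL c = 8 * cs0 c / cL c ^+ 2 * cL c.
  by field; rewrite gt_eqF// cL_gt0.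
rewrite [leRHS]normrM ler_wpM2l//.
by rewrite !gtr0_norm// ?cL_gt0//; exact: ltW.
Qed.

Lemma slope_bound x : 0 < x < L -> `|slope c u x| <= B + dymax.
Proof.
move=> x0L; have [z zL E] := derive1_conv_envE cf fdf x0L.
rewrite (_ : slope c u x = df z)//.
by apply: le_trans (ler_normD _ _) (lerD (uB zL) (dyrest_bound zL)).
Qed.

Lemma slope_mono x y : 0 < x -> x <= y -> y < L -> slope c u x <= slope c u y.
Proof.
move=> x0 xy yL; apply: (derive1_conv_env_mono cf fdf) => //.
  by rewrite x0 (le_lt_trans xy).
by rewrite (lt_le_trans x0 xy).
Qed.

Lemma bdmeas_slope : bdmeas 0 L (slope c u).
Proof.
have x0L : 0 < L / 2 < L by rewrite divr_gt0//= ltr_pdivrMr// ltr_pMr// ltr1n.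
have M0 : 0 <= B + dymax by exact: le_trans (normr_ge0 _) (slope_bound x0L).
exact: (bdmeas_nondecreasing M0 slope_mono slope_bound).
Qed.

Lemma bdmeas_tdir_slope : bdmeas 0 L (fun x => tdir (slope c u x)).
Proof.
apply: (bdmeas_nondecreasing ler01) => [x y x0 xy yL|x _]; last exact: tdir_le1.
by apply: tdir_mono; exact: slope_mono.
Qed.

Lemma bdmeas_arclen_slope : bdmeas 0 L (fun x => arclen (slope c u x)).
Proof.
have [ms [M sM]] := bdmeas_slope; split.
  apply: (measurableT_comp (f := arclen)) => //.
  by apply: continuous_measurable_fun; exact: is_derive_continuous is_derive_arclen.
exists (1 + M) => x xL; rewrite gtr0_norm ?arclen_gt0//.
by apply: le_trans (arclen_le _) _; rewrite lerD2l sM.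
Qed.

Definition tension (u : R -> R) :=
  cH c * xibar c + cA c * cEc c / cable_length c * Gamma c u.

(** Here [v] stands for the derivative of the unmodified test function. The minus sign of [hfun] is
    left out and reappears in [force_identity]. *)
Definition force u v := tension u * int0L L (fun x => tdir (slope c u x) * v x).

Lemma hfunE u0 x : hfun c u0 x = - tension u0 * tdir (slope c u0 x).
Proof. by []. Qed.

(** The gaps form an open set because the envelope is differentiable, hence continuous, inside (0,
    L). Since [hfun] depends on the point only through the slope, it is constant on each gap. *)
Lemma force_identity q dq : (forall x : R, is_derive x 1 q (dq x)) -> continuous dq ->
  ip2 L (hfun c u) (derive1 (affine_on_gaps L (u \+ yrest c) q)) = - force u dq.
Proof.
move=> qdq cdq.
pose G : set R := `]0, L[%classic `\` contact_set L f.
have GP x : G x <-> 0 < x < L /\ f x != conv_env L f x.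
  rewrite /G /= in_itv/=; split => [[xL nK]|[xL fx]]; split => //.
    by apply/eqP => fx; apply: nK.
  by move=> [_ /eqP]; rewrite (negPf fx).
have GL x : G x -> 0 < x < L by case/GP.
have oG : open G.
  rewrite openE => x /GP[xL fx].
  have cg : {for x, continuous (conv_env L f)}.
    by apply/differentiable_continuous/derivable1_diffP; have [] := conv_env_derivable cf fdf xL.
  have cfg : {for x, continuous (fun x => f x - conv_env L f x)}.
    by apply: cvgB => //; exact: cf.
  have : \forall y \near x, f y - conv_env L f y != 0.
    by apply: (cvgr_neq0 _ cfg); rewrite subr_eq0.
  have : \forall y \near x, y \in `]0, L[ by apply: near_in_itvoo; rewrite in_itv.
  rewrite /interior; apply: filterS2 => y; rewrite in_itv/= subr_eq0 => yL fy.
  exact/GP.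
transitivity (int0L L (fun x => hfun c u x * dq x)).
  apply: (int0L_derive_affine_ext oG GL qdq cdq).
    apply: bdmeasM (bdmeas_cst _ _ _) _; exact: bdmeas_tdir_slope.
  move=> x y z Gx yG zG; rewrite !hfunE; congr (_ * tdir _).
  have [l0 _ _ rL] := gap_bounds GL Gx.
  have fgap w : gapl G x < w < gapr G x -> f w != conv_env L f w.
    by move=> /(gap_sub GL Gx) /GP[].
  have [yz|zy|-> //] := ltgtP y z.
    by apply: (derive1_conv_env_const cf fdf l0 _ yz _ rL fgap); lra.
  by apply/esym/(derive1_conv_env_const cf fdf l0 _ zy _ rL fgap); lra.
rewrite /force -mulNr -int0LZ; last first.
  by apply/bdmeas_intble/bdmeasM; [exact: bdmeas_tdir_slope|exact: bdmeas_continuous].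
by apply: eq_int0L => x _; rewrite hfunE mulrA.
Qed.

(** The part of the tension bound that does not depend on the slope, obtained from
    [arclen s <= 1 + |s|]. Absolute values make it independent of the signs of [xibar] and
    [cable_length]. *)
Definition tension_const : R := `|cH c * xibar c| + `|cA c * cEc c / cable_length c| * (L + `|cable_length c|).
Definition stiffness : R := `|cA c * cEc c / cable_length c|.

Lemma tension_bound : `|tension u| <= tension_const + stiffness * (L * (B + dymax)).
Proof.
apply: le_trans (ler_normD _ _) _; rewrite /tension_const -addrA lerD2l normrM -/stiffness.
rewrite -mulrDr; apply: ler_wpM2l; first exact: normr_ge0.
rewrite /Gamma; apply: le_trans (ler_normB _ _) _.
have -> : L + `|cable_length c| + L * (B + dymax) =
  (1 + (B + dymax)) * L + `|cable_length c| by ring.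
rewrite lerD2r -/L.
apply: norm_int0L_bound; first exact: ltW.
  exact: bdmeas_intble bdmeas_arclen_slope.
move=> x xL; rewrite -/(arclen _) gtr0_norm ?arclen_gt0//; apply: le_trans (arclen_le _) _.
by rewrite lerD2l slope_bound.
Qed.

Lemma force_growth q dq S : (forall x : R, is_derive x 1 q (dq x)) -> continuous dq ->
  q 0 = 0 -> q L = 0 -> (forall x, 0 <= x <= L -> `|q x| <= S) ->
  `|force u dq| <= (tension_const + stiffness * (L * (B + dymax))) * (2 * S).
Proof.
move=> qdq cdq q0 qL qS; rewrite normrM; apply: ler_pM => //; first exact: tension_bound.
apply: (monotone_integral_bound L0 _ _ qdq cdq q0 qL qS).
  by move=> x y x0 xy yL; apply: tdir_mono; exact: slope_mono.
by move=> x _; exact: tdir_le1.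
Qed.

End one.

Section two.
Variables (u1 du1 u2 du2 v1 v2 : R -> R).
Hypothesis D1 : forall x : R, is_derive x 1 u1 (du1 x).
Hypothesis D2 : forall x : R, is_derive x 1 u2 (du2 x).
Hypothesis cv1 : continuous v1.
Hypothesis cv2 : continuous v2.
Variables (B d V e : R).
Hypothesis B1 : forall x, 0 < x < L -> `|du1 x| <= B.
Hypothesis B2 : forall x, 0 < x < L -> `|du2 x| <= B.
Hypothesis dd : forall x, 0 < x < L -> `|du1 x - du2 x| <= d.
Hypothesis V1 : forall x, 0 < x < L -> `|v1 x| <= V.
Hypothesis ve : forall x, 0 < x < L -> `|v1 x - v2 x| <= e.

Lemma slope_dist x : 0 < x < L -> `|slope c u1 x - slope c u2 x| <= d.
Proof.
move=> xL.
have E1 (z : R) : is_derive z 1 (u1 \+ yrest c) (du1 z + dyrest z).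
  by have := D1 z; have := is_derive_yrest z => ? ?; exact: is_deriveD.
have E2 (z : R) : is_derive z 1 (u2 \+ yrest c) (du2 z + dyrest z).
  by have := D2 z; have := is_derive_yrest z => ? ?; exact: is_deriveD.
apply: (derive1_conv_env_dist E1 E2 _ xL) => z zL.
by rewrite opprD addrACA subrr addr0; exact: dd.
Qed.

Lemma tension_dist : `|tension u1 - tension u2| <= stiffness * (d * L).
Proof.
have -> : tension u1 - tension u2 = cA c * cEc c / cable_length c * (Gamma c u1 - Gamma c u2).
  by rewrite /tension opprD addrACA subrr add0r -mulrBr.
rewrite normrM -/stiffness; apply: ler_wpM2l; first exact: normr_ge0.
have i1 := bdmeas_intble (bdmeas_arclen_slope D1 B1).
have i2 := bdmeas_intble (bdmeas_arclen_slope D2 B2).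
have -> : Gamma c u1 - Gamma c u2 = int0L L (fun x => arclen (slope c u1 x) - arclen (slope c u2 x)).
  by rewrite int0LB// /Gamma -/L opprB addrA subrK.
apply: norm_int0L_bound; [exact: ltW|exact: intbleB|] => x xL.
by apply: le_trans (arclen_lip _ _) (slope_dist xL).
Qed.

(** The tension and the integrand are products, each split by adding and subtracting a mixed term.
    The slopes, hence [arclen] and [tdir] of them, differ by at most [d]. *)
Lemma force_dist : `|force u1 v1 - force u2 v2| <=
  stiffness * (d * L) * (V * L) + (tension_const + stiffness * (L * (B + dymax))) * ((d * V + e) * L).
Proof.
have b1 := bdmeas_tdir_slope D1; have b2 := bdmeas_tdir_slope D2.
have i1 := bdmeas_intble (bdmeasM b1 (bdmeas_continuous 0 L cv1)).
have i2 := bdmeas_intble (bdmeasM b2 (bdmeas_continuous 0 L cv2)).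
rewrite /force; set I1 := int0L _ _; set I2 := int0L _ _.
have split2 (p1 p2 q1 q2 : R) : p1 * q1 - p2 * q2 = (p1 - p2) * q1 + p2 * (q1 - q2) by ring.
rewrite (split2 (tension u1)).
apply: le_trans (ler_normD _ _) _; rewrite !normrM; apply: lerD.
  apply: ler_pM => //; first exact: tension_dist.
  apply: norm_int0L_bound => //; first exact: ltW.
  move=> x xL; rewrite normrM -[V]mul1r; apply: ler_pM => //; [exact: tdir_le1|exact: V1].
apply: ler_pM => //; first exact: (tension_bound D2 B2).
rewrite /I1 /I2 -int0LB//; apply: norm_int0L_bound; [exact: ltW|exact: intbleB|].
move=> x xL.
rewrite (split2 (tdir (slope c u1 x))).
apply: le_trans (ler_normD _ _) _; rewrite [X in X + _]normrM [X in _ + X]normrM; apply: lerD.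
  apply: ler_pM => //; last exact: V1.
  exact: le_trans (tdir_lip _ _) (slope_dist xL).
by rewrite -[e]mul1r; apply: ler_pM => //; [exact: tdir_le1|exact: ve].
Qed.

End two.
End force.

(** * Weak derivatives *)

Section cutoffs.
Context {R : realType}.
Implicit Types (s x a b : R).

Definition pospart s : R := Num.max s 0.

Lemma pospart_continuous : continuous pospart.
Proof. by move=> t; apply: continuous_max; [exact: cvg_id|exact: cvg_cst]. Qed.

Lemma is_derive_sqr_pospart s : is_derive s 1 (fun s => pospart s ^+ 2) (2 * pospart s).
Proof.
apply/is_deriveP => e e0; exists e => // y ys.
have h : `|pospart y ^+ 2 - pospart s ^+ 2 - 2 * pospart s * (y - s)| <= `|y - s| ^+ 2.
  rewrite real_normK ?num_real// ler_norml /pospart.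
  have hy := sqr_ge0 y; have hs := sqr_ge0 s; have hys := sqr_ge0 (y - s).
  case: (leP y 0) => y0; case: (leP s 0) => s0.
  - by apply/andP; split; lra.
  - by have := mulr_le0_ge0 y0 (ltW s0); move=> ?; apply/andP; split; lra.
  - by have := mulr_ge0_le0 (ltW y0) s0; move=> ?; apply/andP; split; lra.
  - by apply/andP; split; lra.
by apply: le_trans h _; rewrite expr2 ler_wpM2r// ltW.
Qed.

(** The piecewise quadratic step of class C^1: [2 * s ^+ 2] up to 1/2, then [1 - 2 * (1 - s) ^+ 2]
    up to 1. Positive parts put it and its derivative into single formulas. *)
Definition smoothstep s : R :=
  2 * pospart s ^+ 2 - 4 * pospart (s - 2^-1) ^+ 2 + 2 * pospart (s - 1) ^+ 2.

Definition dsmoothstep s : R :=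
  4 * pospart s - 8 * pospart (s - 2^-1) + 4 * pospart (s - 1).

Lemma is_derive_smoothstep s : is_derive s 1 smoothstep (dsmoothstep s).
Proof.
have sh (r : R) : is_derive s 1 (fun s => pospart (s - r) ^+ 2) (2 * pospart (s - r)).
  have := is_derive_sqr_pospart (s - r) => h1.
  have h2 : is_derive s 1 (fun s => s - r) 1 by apply: is_derive_eq; rewrite subr0.
  have := @is_derive1_comp _ (fun s => pospart s ^+ 2) (fun s : R => s - r) s _ _ h1 h2.
  by rewrite mulr1.
have := is_derive_sqr_pospart s; have := sh 2^-1; have := sh 1 => ? ? ?.
by apply: is_derive_eq; rewrite /dsmoothstep /GRing.scale/=; ring.
Qed.

Lemma dsmoothstep_continuous : continuous dsmoothstep.
Proof.
have sh (r k : R) : continuous (fun s => k * pospart (s - r)).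
  move=> s; apply: cvgM; first exact: cvg_cst.
  apply: (@continuous_comp _ _ _ (fun s => s - r) pospart); last exact: pospart_continuous.
  by apply: cvgB; [exact: cvg_id|exact: cvg_cst].
move=> s; apply: cvgD; last exact: sh.
apply: cvgB; last exact: sh.
by have := sh 0 4 s; under eq_fun do rewrite subr0; apply.
Qed.

Lemma smoothstep_le0 s : s <= 0 -> smoothstep s = 0.
Proof. by move=> s0; rewrite /smoothstep /pospart !max_r ?expr0n/= ?mulr0 ?subr0 ?addr0//; lra. Qed.

Lemma smoothstep_ge1 s : 1 <= s -> smoothstep s = 1.
Proof. by move=> s1; rewrite /smoothstep /pospart !max_l; [field|lra..]. Qed.

Lemma dsmoothstep_ge1 s : 1 <= s -> dsmoothstep s = 0.
Proof. by move=> s1; rewrite /dsmoothstep /pospart !max_l; [field|lra..]. Qed.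

Lemma dsmoothstep_bound s : 0 <= dsmoothstep s <= 2.
Proof.
rewrite /dsmoothstep /pospart.
by case: (leP s 0) => ?; case: (leP (s - 2^-1) 0) => ?; case: (leP (s - 1) 0) => ?; lra.
Qed.

Lemma smoothstep_mono s s' : s <= s' -> smoothstep s <= smoothstep s'.
Proof.
rewrite le_eqVlt => /predU1P[->//|ss'].
have [c _ E] := is_derive_MVT is_derive_smoothstep ss'.
have /andP[h1 h2] := dsmoothstep_bound c.
by rewrite -subr_ge0 E mulr_ge0// subr_ge0 ltW.
Qed.

Lemma smoothstep_bound s : 0 <= smoothstep s <= 1.
Proof.
apply/andP; split.
  have [s0|s0] := leP 0 s; last by rewrite smoothstep_le0// ltW.
  by rewrite -(smoothstep_le0 (lexx 0)) smoothstep_mono.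
have [s0|s0] := leP s 1; last by rewrite smoothstep_ge1// ltW.
by rewrite -(smoothstep_ge1 (lexx 1)) smoothstep_mono.
Qed.

(** For [k > 0] it vanishes outside [a, b] and equals 1 at distance at least [1 / k] inside from
    both ends. *)
Definition cutoff (k a b x : R) : R := smoothstep (k * (x - a)) * smoothstep (k * (b - x)).

Definition dcutoff (k a b x : R) : R :=
  k * dsmoothstep (k * (x - a)) * smoothstep (k * (b - x))
  - k * dsmoothstep (k * (b - x)) * smoothstep (k * (x - a)).

Lemma is_derive_left (k a x : R) :
  is_derive x 1 (fun x => smoothstep (k * (x - a))) (k * dsmoothstep (k * (x - a))).
Proof.
have h1 := is_derive_smoothstep (k * (x - a)).
have h2 : is_derive x 1 (fun x => k * (x - a)) k.
  by apply: is_derive_eq; rewrite /GRing.scale/= subr0 mulr1.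
have := @is_derive1_comp _ smoothstep (fun x : R => k * (x - a)) x _ _ h1 h2.
by rewrite mulrC.
Qed.

Lemma is_derive_right (k b x : R) :
  is_derive x 1 (fun x => smoothstep (k * (b - x))) (- (k * dsmoothstep (k * (b - x)))).
Proof.
have h1 := is_derive_smoothstep (k * (b - x)).
have h2 : is_derive x 1 (fun x => k * (b - x)) (- k).
  by apply: is_derive_eq; rewrite /GRing.scale/=; ring.
have := @is_derive1_comp _ smoothstep (fun x : R => k * (b - x)) x _ _ h1 h2.
by rewrite mulrN mulrC.
Qed.

Lemma is_derive_cutoff k a b x : is_derive x 1 (cutoff k a b) (dcutoff k a b x).
Proof.
have := is_derive_left k a x; have := is_derive_right k b x => ? ?.
by apply: is_derive_eq; rewrite /dcutoff /GRing.scale/=; ring.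
Qed.

Lemma cutoff_bound k a b x : 0 <= cutoff k a b x <= 1.
Proof.
have /andP[h1 h2] := smoothstep_bound (k * (x - a)).
have /andP[h3 h4] := smoothstep_bound (k * (b - x)).
by rewrite mulr_ge0//= mulr_ile1.
Qed.

Lemma continuous_left k a : continuous (fun x => k * dsmoothstep (k * (x - a))).
Proof.
move=> x; apply: cvgM; first exact: cvg_cst.
apply: (@continuous_comp _ _ _ (fun x => k * (x - a)) dsmoothstep); last exact: dsmoothstep_continuous.
by apply: cvgM; [exact: cvg_cst|apply: cvgB; [exact: cvg_id|exact: cvg_cst]].
Qed.

Lemma continuous_right k b : continuous (fun x => k * dsmoothstep (k * (b - x))).
Proof.
move=> x; apply: cvgM; first exact: cvg_cst.
apply: (@continuous_comp _ _ _ (fun x => k * (b - x)) dsmoothstep); last exact: dsmoothstep_continuous.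
by apply: cvgM; [exact: cvg_cst|apply: cvgB; [exact: cvg_cst|exact: cvg_id]].
Qed.

Lemma dcutoff_continuous k a b : continuous (dcutoff k a b).
Proof.
have h1 := is_derive_continuous (is_derive_left k a).
have h2 := is_derive_continuous (is_derive_right k b).
move=> x; apply: cvgB.
- by apply: cvgM; [exact: (@continuous_left k a x)|exact: (h2 x)].
- by apply: cvgM; [exact: (@continuous_right k b x)|exact: (h1 x)].
Qed.

Lemma dcutoff_le k a b x : 0 <= k ->
  `|dcutoff k a b x| <= k * dsmoothstep (k * (x - a)) + k * dsmoothstep (k * (b - x)).
Proof.
move=> k0; apply: le_trans (ler_normB _ _) _.
have /andP[h1 h2] := smoothstep_bound (k * (x - a)).
have /andP[h3 h4] := smoothstep_bound (k * (b - x)).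
have /andP[h5 h6] := dsmoothstep_bound (k * (x - a)).
have /andP[h7 h8] := dsmoothstep_bound (k * (b - x)).
by rewrite !ger0_norm ?mulr_ge0//; apply: lerD; rewrite ler_piMr// mulr_ge0.
Qed.

Lemma cutoff_support (k a b x : R) : 0 < k -> cutoff k a b x != 0 -> a <= x <= b.
Proof.
move=> k0; rewrite mulf_eq0 negb_or => /andP[h1 h2].
apply/andP; split; rewrite leNgt; apply/negP => h.
  by move: h1; rewrite smoothstep_le0 ?eqxx// pmulr_rle0//; lra.
by move: h2; rewrite smoothstep_le0 ?eqxx// pmulr_rle0//; lra.
Qed.

Lemma cutoff_eq0 (k a b x : R) : 0 < k -> x <= a \/ b <= x -> cutoff k a b x = 0.
Proof.
move=> k0 [h|h]; rewrite /cutoff; [rewrite smoothstep_le0 ?mul0r//|rewrite [X in _ * X]smoothstep_le0 ?mulr0//];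
  by rewrite pmulr_rle0//; lra.
Qed.

Lemma cutoff_eq1 (k a b x : R) : 1 <= k * (x - a) -> 1 <= k * (b - x) -> cutoff k a b x = 1.
Proof. by move=> h1 h2; rewrite /cutoff !smoothstep_ge1// mulr1. Qed.

Lemma dcutoff_eq0 (k a b x : R) : 1 <= k * (x - a) -> 1 <= k * (b - x) -> dcutoff k a b x = 0.
Proof. by move=> h1 h2; rewrite /dcutoff !dsmoothstep_ge1// mulr0 !mul0r subr0. Qed.

Lemma test_cutoff (L k a b : R) (psi dpsi : R -> R) : 0 < k -> 0 < a -> b < L ->
  (forall x : R, is_derive x 1 psi (dpsi x)) -> continuous dpsi ->
  test_function L (fun x => psi x * cutoff k a b x) /\
  derive1 (fun x => psi x * cutoff k a b x) = fun x => dpsi x * cutoff k a b x + psi x * dcutoff k a b x.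
Proof.
move=> k0 a0 bL dP cdP.
have D (x : R) : is_derive x 1 (fun x => psi x * cutoff k a b x) (dpsi x * cutoff k a b x + psi x * dcutoff k a b x).
  have := dP x; have := is_derive_cutoff k a b x => ? ?.
  by apply: is_derive_eq; rewrite /GRing.scale/=; ring.
have E : derive1 (fun x => psi x * cutoff k a b x) = fun x => dpsi x * cutoff k a b x + psi x * dcutoff k a b x.
  by apply/funext => x; exact: is_derive_derive1.
split => //; split; first by move=> x; have [] := D x.
  rewrite E => x; apply: cvgD; apply: cvgM.
  - exact: cdP.
  - exact: (is_derive_continuous (is_derive_cutoff k a b)).
  - exact: (is_derive_continuous dP).
  - exact: dcutoff_continuous.
exists a, b; split => // x; rewrite mulf_eq0 negb_or => /andP[_]; exact: cutoff_support.
Qed.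

End cutoffs.

(** * Uniqueness of weak derivatives and agreement with classical ones *)

Section weak_derivatives.
Context {R : realType}.
Variable L : R.
Hypothesis L0 : 0 < L.
Notation mu := (@lebesgue_measure R).
Implicit Types (u v z f phi : R -> R).

Lemma L2_mul u v : L2 L u -> L2 L v -> intble 0 L (fun x => u x * v x).
Proof.
move=> Lu Lv; have /Lfun1_integrable := Lfun2_mul_Lfun1 Lu Lv.
move=> /(@integrableS _ _ _ mu setT `]0, L[ _ measurableT (measurable_itv _) (@subsetT _ _)).
apply: eq_integrable => // x xL /=; by rewrite !patchE xL.
Qed.

Lemma L2_measurable u : L2 L u -> measurable_fun (`]0, L[%classic : set R) u.
Proof. by rewrite /L2 /= inE => /andP[/[!inE]/= mu_ _]; apply/(measurable_restrictT _ _).2. Qed.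

Lemma bdmeas_L2 u : bdmeas 0 L u -> L2 L u.
Proof.
move=> bu; have [mu_ [M uM]] := bu.
rewrite /L2 /= inE; apply/andP; split; rewrite inE/=.
  exact/(measurable_restrictT _ _).1.
rewrite /finite_norm unlock; apply: poweR_lty.
have /integrableP[_] := bdmeas_intble (bdmeasM bu bu).
rewrite [X in (X < _)%E -> _]integral_mkcond; apply: le_lt_trans.
rewrite le_eqVlt; apply/orP; left; apply/eqP; apply: eq_integral => x _.
rewrite /= !patchE; case: ifPn => _ /=.
  by rewrite powR_mulrn// normrM expr2.
by rewrite normr0 powR0// pnatr_eq0.
Qed.

Lemma L2_intble u : L2 L u -> intble 0 L u.
Proof.
move=> Lu; have := L2_mul Lu (bdmeas_L2 (bdmeas_cst 0 L 1)).
by under eq_fun do rewrite mulr1.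
Qed.

Lemma int0L_dct (f_ : nat -> R -> R) f g :
  (forall m, measurable_fun (`]0, L[%classic : set R) (f_ m)) ->
  measurable_fun (`]0, L[%classic : set R) f -> intble 0 L g ->
  (forall x, 0 < x < L -> f_ m x @[m --> \oo] --> f x) ->
  (forall m x, 0 < x < L -> `|f_ m x| <= g x) ->
  int0L L (f_ m) @[m --> \oo] --> int0L L f.
Proof.
move=> mf_ mf ig cv dom.
have [|||||i1 _ cvI] := @dominated_convergence _ _ R mu `]0, L[%classic (measurable_itv _)
  (fun m => EFin \o f_ m) (EFin \o f) (EFin \o g).
- by move=> m; apply/measurable_EFinP; exact: mf_.
- exact/measurable_EFinP.
- by apply: aeW => x /=; rewrite in_itv/= => xL; apply: cvg_EFin; [exact: nearW|exact: cv].
- exact: ig.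
- by apply: aeW => x m /=; rewrite in_itv/= => xL; rewrite lee_fin; exact: dom.
- by apply: fine_cvg; rewrite fineK//; exact: integrable_fin_num.
Qed.

Definition ae0L (P : R -> Prop) := {ae mu, forall x, 0 < x < L -> P x}.

Lemma cvg_eventually (f_ : nat -> R) (l : R) (N : R) :
  (forall m, N <= m%:R -> f_ m = l) -> f_ m @[m --> \oo] --> l.
Proof.
move=> H; apply: cvg_near_cst; near=> m; apply: H; apply: ltW; near: m.
exact: nbhs_infty_gtr.
Unshelve. all: by end_near. Qed.

Lemma measurable_cutoff (k a b : R) (A : set R) : measurable_fun A (cutoff k a b).
Proof.
apply: (measurable_funS measurableT) => //.
by apply: continuous_measurable_fun; exact: (is_derive_continuous (is_derive_cutoff k a b)).
Qed.

Lemma intble_measurable f : intble 0 L f -> measurable_fun (`]0, L[%classic : set R) f.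
Proof. by move=> /measurable_int/measurable_EFinP. Qed.

Lemma int_cutoff_cvg f a b : intble 0 L f -> 0 <= a -> b <= L ->
  int0L L (fun x => f x * cutoff m.+1%:R a b x) @[m --> \oo] --> int0L L (fun x => f x * \1_(`]a, b[%classic) x).
Proof.
move=> fi a0 bL; apply: (@int0L_dct _ _ (fun x => `|f x|)).
- by move=> m; apply: measurable_funM; [exact: intble_measurable|exact: measurable_cutoff].
- by apply: measurable_funM; [exact: intble_measurable|exact: measurable_indic].
- exact: integrable_norm.
- move=> x _; apply: cvgM; first exact: cvg_cst.
  have [xab|nxab] := boolP (x \in (`]a, b[%classic : set R)).
    rewrite indicE xab /=; move: xab; rewrite inE/= in_itv/= => /andP[ax xb].
    apply: (@cvg_eventually _ _ (Num.max (x - a)^-1 (b - x)^-1)) => m.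
    rewrite ge_max => /andP[h1 h2]; apply: cutoff_eq1.
      rewrite -ler_pdivrMr ?subr_gt0// div1r; apply: le_trans h1 _.
      by rewrite ler_nat.
    rewrite -ler_pdivrMr ?subr_gt0// div1r; apply: le_trans h2 _.
    by rewrite ler_nat.
  rewrite indicE (negbTE nxab) /=; apply: (@cvg_eventually _ _ 0) => m _.
  apply: cutoff_eq0; first by rewrite ltr0n.
  move: nxab; rewrite notin_setE/= in_itv/= => /negP; rewrite negb_and -!leNgt.
  by case/orP; [left|right].
- move=> m x _; rewrite normrM ler_piMr//.
  by have /andP[h1 h2] := @cutoff_bound R m.+1%:R a b x; rewrite ger0_norm.
Qed.

(** Cutoffs converge to the indicators of intervals compactly contained in (0, L), so [f] integrates
    to 0 over each of them. Its primitive is then constant on (0, L), and by Lebesgue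
    differentiation [f] is almost everywhere the derivative of that primitive. *)
Lemma fundamental_lemma f : intble 0 L f ->
  (forall phi, test_function L phi -> int0L L (fun x => f x * phi x) = 0) ->
  ae0L (fun x => f x = 0).
Proof.
move=> fi fphi.
have int0 a b : 0 < a -> b < L -> int0L L (fun x => f x * \1_(`]a, b[%classic) x) = 0.
  move=> a0 bL; apply: (@cvg_unique _ (@Rhausdorff R)  _ _ _ _ (int_cutoff_cvg fi (ltW a0) (ltW bL))).
  rewrite (_ : (fun m => _) = fun=> 0); first exact: cvg_cst.
  apply/funext => m.
  have k0 : (0 : R) < m.+1%:R by rewrite ltr0n.
  have [tb _] := test_cutoff k0 a0 bL (fun x : R => is_derive_cst (1 : R) x 1) (fun x => @cvg_cst _ _ _ _ _).
  by rewrite -(fphi _ tb); apply: eq_int0L => x _; rewrite mul1r.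
pose D : set R := `]0, L[%classic.
pose g := f \_ D.
have mg : mu.-integrable setT (EFin \o g).
  by rewrite /g -restrict_EFin; apply/(integrable_mkcond _ _).1; [exact: measurable_itv | exact: fi].
have igS (A : set R) : measurable A -> mu.-integrable A (EFin \o g).
  by move=> mA; apply: integrableS mg.
pose F x := \int[mu]_(t in `]-oo, x]) g t.
have FE a b : 0 < a -> a < b -> b < L -> F a = F b.
  move=> a0 ab bL; apply/esym/eqP; rewrite -subr_eq0; apply/eqP.
  rewrite /F Rintegral_itvB; [|exact: igS|by []|by rewrite bnd_simp ltW].
  rewrite -Rintegral_itv_bndo_bndc; last exact: igS.
  rewrite -(int0 a b a0 bL) /int0L Rintegral_mkcond [RHS]Rintegral_mkcond.
  apply: eq_Rintegral => x _; rewrite !patchE /g patchE indicE.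
  case: ifPn => [xab|nxab]; last by case: ifPn => //; rewrite mulr0.
  have xD : x \in D.
    by apply/mem_set; move: xab; rewrite inE /D/= !in_itv/=; lra.
  by rewrite xD mulr1.
have lg : locally_integrable setT g by apply: integrable_locally_restrict; [exact: measurable_itv|exact: fi].
have gy y : mu.-integrable `]-oo, y] (EFin \o g) by exact: igS.
have := FTC1Ny gy lg; rewrite /ae0L; apply: filterS; first exact: (ae_filter_ringOfSetsType mu).
move=> x [_ Fx] xL.
have <- : g x = f x by rewrite /g patchE mem_set//= in_itv.
rewrite -Fx; apply: is_derive_derive1; apply/is_deriveP => e e0.
have /andP[x0 xL'] := xL.
exists (Num.min x (L - x)); first by rewrite lt_min x0 subr_gt0.
move=> y; rewrite lt_min => /andP[yx yL].
have [y0 yL'] : 0 < y /\ y < L by move: yx yL; rewrite !ltr_norml; lra.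
have E : F y = F x.
  by have [yx'|xy|->//] := ltgtP y x; [apply: FE|apply/esym/FE].
by rewrite [X in `|X|](_ : _ = F y - F x - 0 * (y - x))// E subrr mul0r subr0 normr0 mulr_ge0// ltW.
Qed.

(** The sets of candidates are equal, so even the chosen representatives coincide. A solution can
    thus be replaced by its expansion, with which it agrees only on [0, L]. *)
Lemma eq_wderiv u u' : (forall x, 0 < x < L -> u x = u' x) -> wderiv L u = wderiv L u'.
Proof.
move=> uu'; rewrite /wderiv; congr get; apply/seteqP.
split => v [Lv wv]; split => // phi tphi; rewrite -(wv phi tphi);
  by apply: eq_int0L => x xL; rewrite uu'.
Qed.

Lemma test_bdmeas phi : test_function L phi -> bdmeas 0 L phi /\ bdmeas 0 L (derive1 phi).
Proof.
move=> [dphi cphi _]; split; apply: bdmeas_continuous => //.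
by apply: (@is_derive_continuous _ _ (derive1 phi)) => x; rewrite derive1E; exact/derivableP.
Qed.

(** Stated through pairings because [wderiv] is determined only up to a null set; all the scalar
    products of the system are such pairings. *)
Lemma weak_derivative_unique u v v' : L2 L v -> L2 L v' ->
  weak_derivative L u v -> weak_derivative L u v' ->
  forall z, L2 L z -> ip2 L v z = ip2 L v' z.
Proof.
move=> Lv Lv' wv wv' z Lz.
have iv := L2_intble Lv; have iv' := L2_intble Lv'.
have ae : ae0L (fun x => v x - v' x = 0).
  apply: fundamental_lemma; first exact: intbleB.
  move=> phi tphi; have [bphi _] := test_bdmeas tphi.
  transitivity (ip2 L v phi - ip2 L v' phi).
    rewrite /ip2 -int0LB; try exact: intble_bdmeasM.
    by apply: eq_int0L => x _; rewrite mulrBl.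
  by have := wv phi tphi; have := wv' phi tphi; rewrite /weak_derivative; lra.
rewrite /ip2 /int0L; congr fine; apply: ae_eq_integral => //.
- by apply/measurable_EFinP; apply: measurable_funM; exact: L2_measurable.
- by apply/measurable_EFinP; apply: measurable_funM; exact: L2_measurable.
- move: ae; rewrite /ae0L /ae_eq; apply: filterS; first exact: (ae_filter_ringOfSetsType mu).
  move=> x H /=; rewrite in_itv/= => xL.
  by have /eqP := H xL; rewrite subr_eq0 => /eqP ->.
Qed.

Lemma wderivP u : H1 L u -> L2 L (wderiv L u) /\ weak_derivative L u (wderiv L u).
Proof.
move=> [_ [v [Lv wv]]].
exact: (@getPex _ [set v | L2 L v /\ weak_derivative L u v] (ex_intro _ v (conj Lv wv))).
Qed.

Lemma test_ends phi : test_function L phi -> phi 0 = 0 /\ phi L = 0.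
Proof.
move=> [_ _ [a [b [a0 bL sphi]]]]; split; apply/eqP/negPn/negP => /sphi; lra.
Qed.

Lemma smooth_weak_derivative u du : (forall x : R, is_derive x 1 u (du x)) -> continuous du ->
  weak_derivative L u du.
Proof.
move=> dU cdu phi tphi; have [bp bdp] := test_bdmeas tphi.
have [p0 pL] := test_ends tphi; have [dphi cphi _] := tphi.
have cu := is_derive_continuous dU.
have dp (x : R) : is_derive x 1 phi (derive1 phi x) by rewrite derive1E; exact/derivableP.
have cp := is_derive_continuous dp.
have D (x : R) : is_derive x 1 (fun x => u x * phi x) (u x * derive1 phi x + du x * phi x).
  by have := dU x; have := dp x => ? ?; apply: is_derive_eq; rewrite /GRing.scale/=; ring.
have cD : continuous (fun x => u x * derive1 phi x + du x * phi x).
  by move=> x; apply: cvgD; apply: cvgM; [exact: cu|exact: cphi|exact: cdu|exact: cp].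
apply/eqP; rewrite -subr_eq0 opprK /ip2 -int0LD.
- by rewrite (int0L_FTC (ltW L0) cD D) p0 pL !mulr0 subrr.
- by apply/bdmeas_intble/bdmeasM => //; exact: bdmeas_continuous.
- by apply/bdmeas_intble/bdmeasM => //; exact: bdmeas_continuous.
Qed.

Lemma smooth_H1 u du : (forall x : R, is_derive x 1 u (du x)) -> continuous du -> H1 L u.
Proof.
move=> dU cdu; split.
  by apply/bdmeas_L2/bdmeas_continuous/(is_derive_continuous dU).
exists du; split; [by apply/bdmeas_L2/bdmeas_continuous|exact: smooth_weak_derivative].
Qed.

Section smooth.
Variables (u du ddu : R -> R).
Hypothesis dU : forall x : R, is_derive x 1 u (du x).
Hypothesis ddU : forall x : R, is_derive x 1 du (ddu x).
Hypothesis cddu : continuous ddu.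
Let cdu : continuous du := is_derive_continuous ddU.

Let Ldu : L2 L du. Proof. by apply/bdmeas_L2/bdmeas_continuous. Qed.
Let Lddu : L2 L ddu. Proof. by apply/bdmeas_L2/bdmeas_continuous. Qed.

Lemma smooth_wderiv z : L2 L z -> ip2 L (wderiv L u) z = ip2 L du z.
Proof.
have [Lw ww] := wderivP (smooth_H1 dU cdu).
exact: (weak_derivative_unique Lw Ldu ww (smooth_weak_derivative dU cdu)).
Qed.

Let wderiv_wderiv : weak_derivative L (wderiv L u) ddu.
Proof.
move=> phi tphi; have [bp bdp] := test_bdmeas tphi.
rewrite smooth_wderiv; last exact: bdmeas_L2.
exact: smooth_weak_derivative.
Qed.

Lemma smooth_H2 : H2 L u.
Proof.
split; first exact: smooth_H1 dU cdu.
have [Lw _] := wderivP (smooth_H1 dU cdu).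
by split => //; exists ddu; split.
Qed.

Lemma smooth_wderiv2 z : L2 L z -> ip2 L (wderiv L (wderiv L u)) z = ip2 L ddu z.
Proof.
have [_ H] := smooth_H2; have [Lw ww] := wderivP H.
exact: (weak_derivative_unique Lw Lddu ww wderiv_wderiv).
Qed.

End smooth.

Lemma ip2C u v : ip2 L u v = ip2 L v u.
Proof. by apply: eq_int0L => x _; rewrite mulrC. Qed.

Lemma ipH1_smooth u v (du ddu dv ddv : R -> R) :
  (forall x : R, is_derive x 1 u (du x)) -> (forall x : R, is_derive x 1 du (ddu x)) ->
  (forall x : R, is_derive x 1 v (dv x)) -> (forall x : R, is_derive x 1 dv (ddv x)) ->
  ipH1 L u v = ip2 L du dv.
Proof.
move=> U1 U2 V1 V2; rewrite /ipH1 (smooth_wderiv U1 U2).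
  rewrite ip2C (smooth_wderiv V1 V2) 1?ip2C//.
  by apply/bdmeas_L2/bdmeas_continuous/(is_derive_continuous U2).
by have [] := wderivP (smooth_H1 V1 (is_derive_continuous V2)).
Qed.

Lemma ipH2_smooth u v (du ddu dv ddv : R -> R) :
  (forall x : R, is_derive x 1 u (du x)) -> (forall x : R, is_derive x 1 du (ddu x)) -> continuous ddu ->
  (forall x : R, is_derive x 1 v (dv x)) -> (forall x : R, is_derive x 1 dv (ddv x)) -> continuous ddv ->
  ipH2 L u v = ip2 L ddu ddv.
Proof.
move=> U1 U2 cU V1 V2 cV; rewrite /ipH2 (smooth_wderiv2 U1 U2 cU).
  rewrite ip2C (smooth_wderiv2 V1 V2 cV) 1?ip2C//.
  by apply/bdmeas_L2/bdmeas_continuous.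
by have [_ /wderivP[]] := smooth_H2 V1 V2 cV.
Qed.

End weak_derivatives.

(** * Integration by parts with functions that are not compactly supported *)

Section integration_by_parts.
Context {R : realType}.
Variable L : R.
Hypothesis L0 : 0 < L.
Notation mu := (@lebesgue_measure R).

Section weak.
Variables (u v psi dpsi : R -> R).
Hypothesis Lu : L2 L u.
Hypothesis Lv : L2 L v.
Hypothesis wuv : weak_derivative L u v.
Hypothesis dP : forall x : R, is_derive x 1 psi (dpsi x).
Hypothesis cdP : continuous dpsi.

Let k (m : nat) : R := m.+1%:R.
(** It vanishes within [1 / k] of the ends of (0, L), so that multiplying by it yields test
    functions, and equals 1 from distance [2 / k] on. *)
Let chi m := cutoff (k m) (k m)^-1 (L - (k m)^-1).
Let dchi m := dcutoff (k m) (k m)^-1 (L - (k m)^-1).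

Let k0 m : 0 < k m. Proof. by rewrite /k ltr0n. Qed.

Let le_k (x : R) m : x <= m%:R -> x <= k m.
Proof. by move=> h; apply: le_trans h _; rewrite ler_nat. Qed.

Let deep m x : 0 < x < L -> Num.max (2 / x) (2 / (L - x)) <= k m ->
  1 <= k m * (x - (k m)^-1) /\ 1 <= k m * (L - (k m)^-1 - x).
Proof.
move=> /andP[x0 xL]; rewrite ge_max => /andP[h1 h2].
have kk : k m * (k m)^-1 = 1 by rewrite mulfV// gt_eqF.
move: h1 h2; rewrite !ler_pdivrMr ?subr_gt0// => h1 h2.
by split; rewrite !mulrBr kk; move: h1 h2; rewrite ?mulrBr; lra.
Qed.

Let chi_cvg x : 0 < x < L -> chi m x @[m --> \oo] --> (1 : R).
Proof.
move=> xL; apply: (@cvg_eventually R _ _ (Num.max (2 / x) (2 / (L - x)))) => m hm.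
by have [h1 h2] := deep xL (le_k hm); exact: cutoff_eq1.
Qed.

Let dchi_cvg x : 0 < x < L -> dchi m x @[m --> \oo] --> (0 : R).
Proof.
move=> xL; apply: (@cvg_eventually R _ _ (Num.max (2 / x) (2 / (L - x)))) => m hm.
by have [h1 h2] := deep xL (le_k hm); exact: dcutoff_eq0.
Qed.

Let bpsi : bdmeas 0 L psi := bdmeas_continuous 0 L (is_derive_continuous dP).
Let bdpsi : bdmeas 0 L dpsi := bdmeas_continuous 0 L cdP.
Let bchi m : bdmeas 0 L (chi m) := bdmeas_continuous 0 L (is_derive_continuous (is_derive_cutoff _ _ _)).
Let bdchi m : bdmeas 0 L (dchi m) := bdmeas_continuous 0 L (@dcutoff_continuous R _ _ _).

Let dct_chi f : intble 0 L f -> int0L L (fun x => f x * chi m x) @[m --> \oo] --> int0L L f.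
Proof.
move=> fi; apply: (@int0L_dct _ _ _ _ (fun x => `|f x|)).
- by move=> m; apply: measurable_funM; [exact: intble_measurable|exact: measurable_cutoff].
- exact: intble_measurable.
- exact: integrable_norm.
- move=> x xL; rewrite -[X in _ --> X]mulr1; apply: cvgM; first exact: cvg_cst.
  exact: chi_cvg.
- move=> m x _; rewrite normrM ler_piMr//.
  by have /andP[h1 h2] := @cutoff_bound R (k m) (k m)^-1 (L - (k m)^-1) x; rewrite ger0_norm.
Qed.

(** Testing with [psi * chi m] is legitimate and leaves one additional term, containing the
    derivative of the cutoff. Boundary values matter only for its convergence to 0. *)
Lemma weak_ibp_limit :
  int0L L (fun x => u x * psi x * dchi m x) @[m --> \oo] --> (0 : R) ->
  ip2 L u dpsi = - ip2 L v psi.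
Proof.
move=> dchi0; have iu := L2_intble Lu; have iv := L2_intble Lv.
have iup : intble 0 L (fun x => u x * psi x) by exact: intble_bdmeasM.
have iudp : intble 0 L (fun x => u x * dpsi x) by exact: intble_bdmeasM.
have ivp : intble 0 L (fun x => v x * psi x) by exact: intble_bdmeasM.
have E m : int0L L (fun x => u x * dpsi x * chi m x) =
   - int0L L (fun x => v x * psi x * chi m x) - int0L L (fun x => u x * psi x * dchi m x).
  have bL : L - (k m)^-1 < L by rewrite ltrBlDr ltrDl invr_gt0.
  have a0 : 0 < (k m)^-1 by rewrite invr_gt0.
  have [tP dE] := test_cutoff (k0 m) a0 bL dP cdP.
  have := wuv tP; rewrite dE /ip2.
  have -> : int0L L (fun x => v x * (psi x * cutoff (k m) (k m)^-1 (L - (k m)^-1) x)) =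
    int0L L (fun x => v x * psi x * chi m x) by apply: eq_int0L => x _; rewrite mulrA.
  move=> <-; apply/eqP; rewrite eq_sym subr_eq -int0LD; try exact: intble_bdmeasM.
  by apply/eqP; apply: eq_int0L => x _; rewrite /chi /dchi; ring.
have c1 := dct_chi iudp; have c2 := dct_chi ivp.
have c3 : - int0L L (fun x => v x * psi x * chi m x) - int0L L (fun x => u x * psi x * dchi m x) @[m --> \oo]
    --> - ip2 L v psi - 0 by apply: cvgB => //; exact: cvgN.
rewrite subr0 in c3; move: c1; rewrite (eq_cvg _ _ E) => c1.
exact: (cvg_unique (@Rhausdorff R) c1 c3).
Qed.

(* [psi] vanishes linearly at the ends, which compensates the growth of the
   derivative of the cutoff. *)
Lemma weak_ibp_vanishing_test : psi 0 = 0 -> psi L = 0 ->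
  ip2 L u dpsi = - ip2 L v psi.
Proof.
move=> p0 pL; apply: weak_ibp_limit; have iu := L2_intble Lu.
have [P HP] := continuous_bounded 0 L cdP.
have P0 : 0 <= P by apply: le_trans (normr_ge0 _) (HP 0 _); rewrite lexx ltW.
have psil x : 0 < x < L -> `|psi x| <= P * x.
  move=> /andP[x0 xL]; have [c cx E] := is_derive_MVT dP x0.
  move: E; rewrite p0 !subr0 => ->; rewrite normrM (gtr0_norm x0) ler_wpM2r ?(ltW x0)//.
  by apply: HP; lra.
have psir x : 0 < x < L -> `|psi x| <= P * (L - x).
  move=> /andP[x0 xL]; have [c cx E] := is_derive_MVT dP xL.
  have -> : psi x = - (dpsi c * (L - x)) by rewrite -E pL sub0r opprK.
  rewrite normrN normrM [`|L - x|]ger0_norm; last by lra.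
  by apply: ler_wpM2r; [lra|apply: HP; lra].
(* The derivative of the step is nonzero only where [k m * d] is at most 2, and it is at most 2
   there, whence [4 * P]; the two ends together give [8 * P]. *)
have strip m d y : 0 <= y -> `|psi y| <= P * d -> 0 <= d ->
    `|psi y| * (k m * dsmoothstep (k m * (d - (k m)^-1))) <= 4 * P.
  move=> y0 py d0; have /andP[h5 h6] := dsmoothstep_bound (k m * (d - (k m)^-1)).
  have [h|h] := leP 1 (k m * (d - (k m)^-1)).
    by rewrite dsmoothstep_ge1// !mulr0 mulr_ge0.
  have kd : k m * d <= 2.
    by move: h; rewrite mulrBr mulfV ?gt_eqF//; lra.
  apply: (@le_trans _ _ (P * d * (k m * 2))).
    by apply: ler_pM => //; [rewrite mulr_ge0// ltW|rewrite ler_pM2l].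
  by have := ler_wpM2l P0 kd; lra.
rewrite -[X in _ --> X](int0L0 L).
apply: (@int0L_dct _ _ _ _ (fun x => (8 * P) * `|u x|)).
- move=> m; apply: measurable_funM; last by have [] := bdchi m.
  by apply: measurable_funM; [exact: L2_measurable|case: bpsi].
- exact: measurable_cst.
- by apply: intbleZ; exact: integrable_norm.
- move=> x xL; rewrite -[X in _ --> X](mulr0 (u x * psi x)); apply: cvgM; first exact: cvg_cst.
  exact: dchi_cvg.
- move=> m x xL; have [x0 xL'] := andP xL.
  rewrite -mulrA normrM mulrC ler_wpM2r// normrM.
  apply: (@le_trans _ _ (`|psi x| * (k m * dsmoothstep (k m * (x - (k m)^-1)) +
     k m * dsmoothstep (k m * (L - (k m)^-1 - x))))).
    by apply: ler_wpM2l => //; apply: dcutoff_le; exact: ltW.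
  have s1 := strip m x x (ltW x0) (psil x xL) (ltW x0).
  have s2 := strip m (L - x) x (ltW x0) (psir x xL).
  rewrite subr_ge0 (ltW xL') addrAC in s2; have {}s2 := s2 isT.
  by rewrite mulrDr; lra.
Qed.

(** Now [u] is the small factor: it is at most [d] on the strips where the cutoff varies. There the
    derivative of the cutoff is of size [k], but each of its two parts has integral at most 1, so
    the error is at most [2 * d * P]. *)
Lemma weak_ibp_vanishing : {within `[0, L], continuous u} -> u 0 = 0 -> u L = 0 ->
  ip2 L u dpsi = - ip2 L v psi.
Proof.
move=> cu u0 uL; apply: weak_ibp_limit; have iu := L2_intble Lu.
have [P HP] := continuous_bounded 0 L (is_derive_continuous dP).
have P0 : 0 <= P by apply: le_trans (normr_ge0 _) (HP 0 _); rewrite lexx ltW.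
apply/cvgrPdist_le => e e0.
pose d := e / (2 * (P + 1)).
have P1 : 0 < 2 * (P + 1) by rewrite mulr_gt0// ltr_pwDr.
have d0 : 0 < d by rewrite divr_gt0.
have /continuous_within_itvP[//|_ cu0 cuL] := cu.
have near0 : exists2 r : R, 0 < r & forall x, 0 < x < r -> `|u x| <= d.
  move: cu0; rewrite u0 => /cvgrPdist_le/(_ d d0) [r /= r0 rP]; exists r => // x /andP[x0 xr].
  by have := rP x; rewrite /ball/= sub0r normrN gtr0_norm// sub0r normrN => /(_ xr x0).
have nearL : exists2 r : R, 0 < r & forall x, L - r < x < L -> `|u x| <= d.
  move: cuL; rewrite uL => /cvgrPdist_le/(_ d d0) [r /= r0 rP]; exists r => // x /andP[x0 xr].
  have := rP x; rewrite /ball/= sub0r normrN gtr0_norm ?subr_gt0//; apply=> //; lra.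
have [r1 r10 r1P] := near0; have [r2 r20 r2P] := nearL.
near=> m.
have km : 2 < k m * r1 /\ 2 < k m * r2.
  have : Num.max (2 / r1) (2 / r2) < k m.
    apply: (@lt_le_trans _ _ m%:R); last by rewrite ler_nat.
    by near: m; exact: nbhs_infty_gtr.
  by rewrite gt_max !ltr_pdivrMr// => /andP[].
have kk : k m * (k m)^-1 = 1 by rewrite mulfV// gt_eqF.
pose g1 x := k m * dsmoothstep (k m * (x - (k m)^-1)).
pose g2 x := k m * dsmoothstep (k m * (L - (k m)^-1 - x)).
have cg1 : continuous g1 by exact: continuous_left.
have cg2 : continuous g2 by exact: continuous_right.
have ig1 := bdmeas_intble (bdmeas_continuous 0 L cg1).
have ig2 := bdmeas_intble (bdmeas_continuous 0 L cg2).
have I1 : int0L L g1 <= 1.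
  rewrite (int0L_FTC (ltW L0) cg1 (is_derive_left _ _)).
  have /andP[h1 h2] := smoothstep_bound (k m * (L - (k m)^-1)).
  have /andP[h3 h4] := smoothstep_bound (k m * (0 - (k m)^-1)).
  lra.
have I2 : int0L L g2 <= 1.
  have D2 (x : R) : is_derive x 1 (fun x => - smoothstep (k m * (L - (k m)^-1 - x))) (g2 x).
    have h := is_derive_right (k m) (L - (k m)^-1) x.
    by rewrite -[g2 x]opprK; exact: is_deriveN.
  rewrite (int0L_FTC (ltW L0) cg2 D2).
  have /andP[h1 h2] := smoothstep_bound (k m * (L - (k m)^-1 - L)).
  have /andP[h3 h4] := smoothstep_bound (k m * (L - (k m)^-1 - 0)).
  lra.
rewrite sub0r normrN.
have iupc : intble 0 L (fun x => u x * psi x * dchi m x).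
  by apply: intble_bdmeasM (bdchi m); exact: intble_bdmeasM.
have igg := intbleZ (d * P) (intbleD ig1 ig2).
apply: (@le_trans _ _ (int0L L (fun x => d * P * (g1 x + g2 x)))).
  apply: norm_int0L_le => // x xL; have [x0 xL'] := andP xL.
  rewrite -mulrA mulrCA normrM [d * P]mulrC -mulrA.
  apply: ler_pM => //; first by apply: HP; rewrite !ltW.
  rewrite normrM; apply: (@le_trans _ _ (`|u x| * (g1 x + g2 x))).
    by apply: ler_wpM2l => //; apply: dcutoff_le; exact: ltW.
  rewrite !mulrDr; apply: lerD.
    have /andP[h5 h6] := dsmoothstep_bound (k m * (x - (k m)^-1)).
    have [h|h] := leP 1 (k m * (x - (k m)^-1)).
      by rewrite /g1 dsmoothstep_ge1// !mulr0.
    apply: ler_wpM2r; first by rewrite mulr_ge0// ltW.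
    apply: r1P; rewrite x0 -(ltr_pM2l (k0 m)).
    by move: h; rewrite mulrBr kk; lra.
  have /andP[h5 h6] := dsmoothstep_bound (k m * (L - (k m)^-1 - x)).
  have [h|h] := leP 1 (k m * (L - (k m)^-1 - x)).
    by rewrite /g2 dsmoothstep_ge1// !mulr0.
  apply: ler_wpM2r; first by rewrite mulr_ge0// ltW.
  apply: r2P; rewrite xL' andbT -(ltr_pM2l (k0 m)).
  by move: h; rewrite !mulrBr kk; lra.
rewrite int0LZ; last exact: intbleD.
rewrite int0LD//; apply: (@le_trans _ _ (d * P * 2)).
  by apply: ler_wpM2l; [rewrite mulr_ge0// ltW|lra].
have -> : e = d * (P + 1) * 2 by rewrite /d; field; rewrite gt_eqF// ltr_pwDr.
by rewrite ler_pM2r// ler_pM2l// lerDl.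
Unshelve. all: by end_near. Qed.

End weak.

(** The first integration by parts uses the boundary values of [v], the second those of [psi], since
    the derivative of [v] is not assumed to vanish at the ends. *)
Lemma ip2_H2H10 (v psi dpsi ddpsi : R -> R) : H2H10 L v ->
  (forall x : R, is_derive x 1 psi (dpsi x)) -> (forall x : R, is_derive x 1 dpsi (ddpsi x)) ->
  continuous ddpsi -> psi 0 = 0 -> psi L = 0 ->
  ip2 L v ddpsi = ip2 L (wderiv L (wderiv L v)) psi.
Proof.
move=> [[H1v H1w] [_ cv v0 vL]] D1 D2 cdd p0 pL.
have [Lw ww] := wderivP H1v; have [Lz wz] := wderivP H1w.
have [Lv _] := H1v.
rewrite (weak_ibp_vanishing Lv Lw ww D2 cdd cv v0 vL).
by rewrite (weak_ibp_vanishing_test Lw Lz wz D1 (is_derive_continuous D2) p0 pL) opprK.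
Qed.

End integration_by_parts.

(** * The sine basis *)

Section basis.
Context {R : realType}.
Variable L : R.
Hypothesis L0 : 0 < L.
Implicit Types (a b : nat -> R) (x t : R) (k r : nat).

Definition freq k : R := k%:R * pi / L.

Definition e1_ k x : R := Num.sqrt (2 / L) * freq k * cos (k%:R * pi * x / L).

Lemma is_derive_phase k x : is_derive x 1 (fun x => k%:R * pi * x / L) (freq k).
Proof. by apply: is_derive_eq; rewrite /freq /GRing.scale/=; ring. Qed.

Lemma is_derive_e k x : is_derive x 1 (e_ L k) (e1_ k x).
Proof.
have h1 := is_derive_sin (k%:R * pi * x / L).
have h2 := is_derive_phase k x.
have := @is_derive1_comp _ (@sin R) (fun x : R => k%:R * pi * x / L) x _ _ h1 h2 => h3.
have -> : e1_ k x = Num.sqrt (2 / L) * (cos (k%:R * pi * x / L) * freq k) by rewrite /e1_; ring.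
exact: is_deriveZ.
Qed.

Lemma is_derive_e1 k x : is_derive x 1 (e1_ k) (- freq k ^+ 2 * e_ L k x).
Proof.
have h1 := is_derive_cos (k%:R * pi * x / L).
have h2 := is_derive_phase k x.
have := @is_derive1_comp _ (@cos R) (fun x : R => k%:R * pi * x / L) x _ _ h1 h2 => h3.
have -> : - freq k ^+ 2 * e_ L k x = Num.sqrt (2 / L) * freq k * (- sin (k%:R * pi * x / L) * freq k).
  by rewrite /e_; ring.
exact: is_deriveZ.
Qed.

Lemma e_continuous k : continuous (e_ L k).
Proof. exact: is_derive_continuous (is_derive_e k). Qed.

Lemma e1_continuous k : continuous (e1_ k).
Proof. exact: is_derive_continuous (is_derive_e1 k). Qed.

Lemma e_0 k : e_ L k 0 = 0.
Proof. by rewrite /e_ mulr0 mul0r sin0 mulr0. Qed.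

Lemma e_L k : e_ L k L = 0.
Proof.
rewrite /e_ mulfK ?gt_eqF// (_ : sin _ = 0) ?mulr0//.
elim: k => [|k ih]; first by rewrite mul0r sin0.
by rewrite -natr1 mulrDl mul1r sinDpi ih oppr0.
Qed.

Lemma freq_gt0 k : (0 < k)%N -> 0 < freq k.
Proof. by move=> k0; rewrite divr_gt0// mulr_gt0 ?ltr0n// pi_gt0. Qed.

Lemma e_bound k x : `|e_ L k x| <= Num.sqrt (2 / L).
Proof.
rewrite normrM ger0_norm ?sqrtr_ge0// ler_piMr ?sqrtr_ge0//; exact: sin_max.
Qed.

(** Explicit primitives: for [k != r] the Wronskian of the two modes has derivative [e_k * e_r]
    times the difference of the squared frequencies and vanishes at both ends; for [k = r] only the
    term [x / L] contributes. *)
Lemma ip2_e k r : (0 < k)%N -> (0 < r)%N -> ip2 L (e_ L k) (e_ L r) = (k == r)%:R.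
Proof.
move=> k0 r0; have ce := e_continuous.
have cee : continuous (fun x => e_ L k x * e_ L r x) by move=> x; apply: cvgM; exact: ce.
have iee := bdmeas_intble (bdmeas_continuous 0 L cee).
have fk := freq_gt0 k0; have fr := freq_gt0 r0.
case: eqVneq => [E|kr].
  subst r; have D (x : R) : is_derive x 1 (fun x => x / L - e_ L k x * e1_ k x / (2 * freq k ^+ 2)) (e_ L k x * e_ L k x).
    have h1 := is_derive_e k x; have h2 := is_derive_e1 k x.
    apply: is_derive_eq; rewrite /GRing.scale/=.
    have s2 : Num.sqrt (2 / L) ^+ 2 = 2 / L by rewrite sqr_sqrtr// divr_ge0// ltW.
    have h : e1_ k x ^+ 2 = freq k ^+ 2 * (2 / L - e_ L k x ^+ 2).
      by rewrite /e1_ /e_ !exprMn s2 cos2sin2; ring.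
    rewrite (_ : _ - _ = L^-1 - (e1_ k x ^+ 2 - freq k ^+ 2 * e_ L k x ^+ 2) / (2 * freq k ^+ 2)); last ring.
    rewrite h; field; rewrite !gt_eqF//.
  rewrite /ip2 (int0L_FTC (ltW L0) cee D) e_0 e_L !mul0r !subr0 divff// gt_eqF//.
have D (x : R) : is_derive x 1 (fun x => e_ L k x * e1_ r x - e1_ k x * e_ L r x)
    ((freq k ^+ 2 - freq r ^+ 2) * (e_ L k x * e_ L r x)).
  have h1 := is_derive_e k x; have h2 := is_derive_e1 k x.
  have h3 := is_derive_e r x; have h4 := is_derive_e1 r x.
  by apply: is_derive_eq; rewrite /GRing.scale/=; ring.
have cD : continuous (fun x => (freq k ^+ 2 - freq r ^+ 2) * (e_ L k x * e_ L r x)).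
  by move=> x; apply: cvgM; [exact: cvg_cst|exact: cee].
have := int0L_FTC (ltW L0) cD D; rewrite int0LZ// !e_0 !e_L !mul0r !mulr0 !subrr => /eqP.
rewrite mulf_eq0 => /orP[|/eqP//]; rewrite subr_eq0 eqrXn2 ?ltW//.
have piL : pi / L != 0 :> R by rewrite gt_eqF// divr_gt0// pi_gt0.
by rewrite /freq -!mulrA (inj_eq (mulIf piL)) eqr_nat (negbTE kr).
Qed.

Variable n : nat.

Definition modal a x : R := \sum_(1 <= k < n.+1) a k * e_ L k x.
Definition dmodal a x : R := \sum_(1 <= k < n.+1) a k * e1_ k x.
Definition ddmodal a x : R := modal (fun k => - freq k ^+ 2 * a k) x.

Lemma is_derive_modal a x : is_derive x 1 (modal a) (dmodal a x).
Proof. by apply: is_derive_bigsum => k; have := is_derive_e k x => ?; exact: is_deriveZ. Qed.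

Lemma is_derive_dmodal a x : is_derive x 1 (dmodal a) (ddmodal a x).
Proof.
apply: is_derive_bigsum => k; have := is_derive_e1 k x => ?.
have -> : - freq k ^+ 2 * a k * e_ L k x = a k * (- freq k ^+ 2 * e_ L k x) by ring.
exact: is_deriveZ.
Qed.

Lemma modal_continuous a : continuous (modal a).
Proof. exact: is_derive_continuous (is_derive_modal a). Qed.

Lemma dmodal_continuous a : continuous (dmodal a).
Proof. exact: is_derive_continuous (is_derive_dmodal a). Qed.

Lemma ddmodal_continuous a : continuous (ddmodal a).
Proof. exact: modal_continuous. Qed.

Lemma modal_0 a : modal a 0 = 0.
Proof. by rewrite /modal big1// => k _; rewrite e_0 mulr0. Qed.

Lemma modal_L a : modal a L = 0.
Proof. by rewrite /modal big1// => k _; rewrite e_L mulr0. Qed.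

Lemma L2_continuous (u : R -> R) : continuous u -> L2 L u.
Proof. by move=> cu; apply/bdmeas_L2/bdmeas_continuous. Qed.

Lemma ip2_modal a (v : R -> R) : L2 L v ->
  ip2 L (modal a) v = \sum_(1 <= k < n.+1) a k * ip2 L (e_ L k) v.
Proof.
move=> Lv; have ie k : intble 0 L (fun x => e_ L k x * v x).
  by apply: L2_mul => //; exact/L2_continuous/e_continuous.
transitivity (int0L L (fun x => \sum_(1 <= k < n.+1) a k * (e_ L k x * v x))).
  by apply: eq_int0L => x _; rewrite mulr_suml; apply: eq_bigr => k _; rewrite mulrA.
rewrite int0L_sum; first by apply: eq_bigr => k _; rewrite int0LZ.
by move=> k; exact: intbleZ.
Qed.

Lemma ip2_modal_e a r : (1 <= r <= n)%N -> ip2 L (modal a) (e_ L r) = a r.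
Proof.
move=> rn; rewrite ip2_modal; last exact/L2_continuous/e_continuous.
have rn' : r \in index_iota 1 n.+1 by rewrite mem_index_iota.
rewrite (bigD1_seq r) ?iota_uniq//= ip2_e ?eqxx ?mulr1; try by case/andP: rn.
rewrite big_seq_cond big1 ?addr0// => k /andP[]; rewrite mem_index_iota => /andP[k0 _] kr.
by rewrite ip2_e//; [rewrite (negbTE kr) mulr0|case/andP: rn].
Qed.

Lemma ip2_modal_modal a b : ip2 L (modal a) (modal b) = \sum_(1 <= k < n.+1) a k * b k.
Proof.
rewrite ip2_modal; last exact/L2_continuous/modal_continuous.
by apply: eq_big_nat => k kn; rewrite ip2C ip2_modal_e.
Qed.

Lemma ipH2_modal a r : (1 <= r <= n)%N -> ipH2 L (modal a) (e_ L r) = freq r ^+ 4 * a r.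
Proof.
move=> rn.
have ce2 : continuous (fun x => - freq r ^+ 2 * e_ L r x).
  by move=> x; apply: cvgM; [exact: cvg_cst|exact: e_continuous].
rewrite (ipH2_smooth L0 (is_derive_modal a) (is_derive_dmodal a) (@ddmodal_continuous a)
  (is_derive_e r) (is_derive_e1 r) ce2).
transitivity (- freq r ^+ 2 * ip2 L (ddmodal a) (e_ L r)).
  rewrite /ip2 -int0LZ; first by apply: eq_int0L => x _; ring.
  by apply: L2_mul; apply: L2_continuous; [exact: ddmodal_continuous|exact: e_continuous].
by rewrite ip2_modal_e//; ring.
Qed.

(** Moving the derivative onto [e_r] reduces the product to the orthonormality of the sines. *)
Lemma ipH1_modal a r : (1 <= r <= n)%N -> ipH1 L (modal a) (e_ L r) = freq r ^+ 2 * a r.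
Proof.
move=> rn; rewrite (ipH1_smooth L0 (is_derive_modal a) (is_derive_dmodal a) (is_derive_e r) (is_derive_e1 r)).
have ce2 : continuous (fun x => - freq r ^+ 2 * e_ L r x).
  by move=> x; apply: cvgM; [exact: cvg_cst|exact: e_continuous].
rewrite ip2C (weak_ibp_vanishing_test L0 _ _ (smooth_weak_derivative L0 (is_derive_e1 r) ce2)
   (is_derive_modal a) (@dmodal_continuous a) (modal_0 a) (modal_L a)).
- transitivity (freq r ^+ 2 * ip2 L (modal a) (e_ L r)); last by rewrite ip2_modal_e.
  rewrite -mulN1r /ip2 -!int0LZ; first by apply: eq_int0L => x _; ring.
    by apply: L2_mul; apply: L2_continuous => //; exact: modal_continuous.
  by apply: L2_mul; apply: L2_continuous; [exact: modal_continuous|exact: e_continuous].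
- exact/L2_continuous/e1_continuous.
- exact/L2_continuous.
Qed.

Lemma H2H10_modal a : H2H10 L (modal a).
Proof.
split; first exact: (smooth_H2 L0 (is_derive_modal a) (is_derive_dmodal a) (@ddmodal_continuous a)).
split; [|exact/continuous_subspaceT/modal_continuous|exact: modal_0|exact: modal_L].
exact: (smooth_H1 L0 (is_derive_modal a) (@dmodal_continuous a)).
Qed.

Lemma normH2_modal a : normH2 L (modal a) = Num.sqrt (\sum_(1 <= k < n.+1) freq k ^+ 4 * a k ^+ 2).
Proof.
rewrite /normH2 (ipH2_smooth L0 (is_derive_modal a) (is_derive_dmodal a) (@ddmodal_continuous a)
  (is_derive_modal a) (is_derive_dmodal a) (@ddmodal_continuous a)).
by rewrite ip2_modal_modal; congr Num.sqrt; apply: eq_bigr => k _; ring.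
Qed.

Lemma norm2_modal a : norm2 L (modal a) = Num.sqrt (\sum_(1 <= k < n.+1) a k ^+ 2).
Proof. by rewrite /norm2 ip2_modal_modal; congr Num.sqrt; apply: eq_bigr. Qed.

(* Since [e_k = - freq k ^-2 * e_k''], two integrations by parts bound the
   pairing with [e_k] by the [H^2] norm, without any Poincare inequality. *)
Lemma ip2_e_H2 k (v : R -> R) : (0 < k)%N -> H2H10 L v ->
  `|ip2 L (e_ L k) v| <= freq k ^- 2 * normH2 L v.
Proof.
move=> k0 Hv; have fk := freq_gt0 k0.
have ce2 : continuous (fun x => - freq k ^+ 2 * e_ L k x).
  by move=> x; apply: cvgM; [exact: cvg_cst|exact: e_continuous].
have := ip2_H2H10 L0 Hv (is_derive_e k) (is_derive_e1 k) ce2 (e_0 k) (e_L k).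
have [[H1v H1w] _] := Hv; have [Lv _] := H1v.
have [Lz _] := wderivP H1w; set z := wderiv L (wderiv L v) in Lz *.
have Le : L2 L (e_ L k) by exact/L2_continuous/e_continuous.
have -> : ip2 L v (fun x => - freq k ^+ 2 * e_ L k x) = - freq k ^+ 2 * ip2 L (e_ L k) v.
  rewrite /ip2 -int0LZ; first by apply: eq_int0L => x _; ring.
  exact: L2_mul.
set p := ip2 L z (e_ L k) => E.
have zz := L2_mul Lz Lz; have ze := L2_mul Lz Le; have ee := L2_mul Le Le.
have sq (c : R) : int0L L (fun x => (z x - c * e_ L k x) ^+ 2) =
    ip2 L z z - 2 * c * ip2 L z (e_ L k) + c ^+ 2 * ip2 L (e_ L k) (e_ L k).
  rewrite /ip2 -!int0LZ// -int0LB//; last exact: intbleZ.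
  rewrite -int0LD; [|by apply: intbleB => //; exact: intbleZ|exact: intbleZ].
  by apply: eq_int0L => x _; ring.
have bessel : p ^+ 2 <= ip2 L z z.
  have : 0 <= int0L L (fun x => (z x - p * e_ L k x) ^+ 2).
    by apply: Rintegral_ge0 => x _; exact: sqr_ge0.
  by rewrite sq ip2_e// eqxx mulr1 -/p expr2; lra.
have -> : ip2 L (e_ L k) v = - (freq k ^- 2 * p).
  by rewrite -E; field; rewrite gt_eqF.
rewrite normrN normrM [`|freq k ^- 2|]ger0_norm ?invr_ge0 ?exprn_ge0 ?(ltW fk)//.
rewrite ler_pM2l ?invr_gt0 ?exprn_gt0// /normH2 /ipH2 -/z.
by rewrite -sqrtr_sqr ler_wsqrtr.
Qed.

End basis.

(** * Regularity in time *)

Section time.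
Context {R : realType}.
Implicit Types (D : set R) (f : R -> R) (s t : R).

Definition rate f t s : R := (s - t)^-1 * (f s - f t).

Lemma cvg_within_dnbhsP D f t (l : R) :
  f s @[s --> within D t^'] --> l <->
  forall e : R, 0 < e -> exists2 r : R, 0 < r & forall s, D s -> s != t -> `|s - t| < r -> `|f s - l| <= e.
Proof.
split=> [/cvgrPdist_le H e e0|H].
  have := H e e0; rewrite !near_withinE => -[r /= r0 rP]; exists r => // s Ds st sr.
  by rewrite distrC; apply: rP => //; rewrite /ball/= distrC.
apply/cvgrPdist_le => e e0; rewrite !near_withinE; have [r r0 rP] := H e e0.
exists r => //= s; rewrite /ball/= => ts st Ds; rewrite distrC; apply: rP => //.
by rewrite distrC.
Qed.

Lemma is_derive_rate D f t (d : R) : is_derive t 1 f d ->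
  rate f t s @[s --> within D t^'] --> d.
Proof.
move=> /is_deriveP H; apply/cvg_within_dnbhsP => e e0; have [r r0 rP] := H e e0.
exists r => // s _ st sr; have st0 : s - t != 0 by rewrite subr_eq0.
rewrite -(ler_pM2r (_ : 0 < `|s - t|)) ?normr_gt0// -normrM.
have -> : (rate f t s - d) * (s - t) = f s - f t - d * (s - t) by rewrite /rate; field.
exact: rP.
Qed.

Lemma rate_is_derive D f t (d : R) (r0 : R) : 0 < r0 -> (forall s, `|s - t| < r0 -> D s) ->
  rate f t s @[s --> within D t^'] --> d -> is_derive t 1 f d.
Proof.
move=> r00 DP /cvg_within_dnbhsP H; apply/is_deriveP => e e0; have [r r1 rP] := H e e0.
exists (Num.min r r0); first by rewrite lt_min r1.
move=> s; rewrite lt_min => /andP[sr sr0].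
have [->|st] := eqVneq s t; first by rewrite !subrr mulr0 subr0 normr0 mulr0.
have st0 : s - t != 0 by rewrite subr_eq0.
have -> : f s - f t - d * (s - t) = (rate f t s - d) * (s - t) by rewrite /rate; field.
by rewrite normrM ler_wpM2r// rP//; exact: DP.
Qed.

Lemma rate_continuous D f t (d : R) : rate f t s @[s --> within D t^'] --> d ->
  forall e : R, 0 < e -> exists2 r : R, 0 < r & forall s, D s -> `|s - t| < r -> `|f s - f t| <= e.
Proof.
move=> /cvg_within_dnbhsP/(_ 1 ltr01)[r r0 rP] e e0.
have d1 : 0 < `|d| + 1 by rewrite ltr_pwDr.
exists (Num.min r (e / (`|d| + 1))); first by rewrite lt_min r0 divr_gt0.
move=> s Ds; rewrite lt_min => /andP[sr se].
have [->|st] := eqVneq s t; first by rewrite subrr normr0 ltW.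
have st0 : s - t != 0 by rewrite subr_eq0.
have -> : f s - f t = rate f t s * (s - t) by rewrite /rate; field.
have rd : `|rate f t s| <= `|d| + 1.
  have := rP s Ds st sr; have := ler_normD d (rate f t s - d); rewrite subrKC.
  by move=> h1 h2; apply: le_trans h1 _; rewrite lerD2l.
rewrite normrM; apply: (@le_trans _ _ ((`|d| + 1) * (e / (`|d| + 1)))).
  by apply: ler_pM => //; exact: ltW.
by rewrite mulrC divfK ?gt_eqF.
Qed.

Lemma eq_rate D f g t (d : R) : D t -> (forall s, D s -> f s = g s) ->
  rate f t s @[s --> within D t^'] --> d -> rate g t s @[s --> within D t^'] --> d.
Proof.
move=> Dt fg /cvg_within_dnbhsP H; apply/cvg_within_dnbhsP => e e0.
have [r r0 rP] := H e e0; exists r => // s Ds st sr.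
by rewrite /rate -!fg//; exact: rP.
Qed.

Variable T : \bar R.
Hypothesis T0 : (0 < T)%E.
Let D := time_domain T.

(** Every time is an accumulation point of the domain, from the right if [t < T] and from the left
    if [t = T > 0]. Properness makes the limits that define [dt] unique. *)
Lemma time_domain_proper t : D t -> ProperFilter (within D t^').
Proof.
move=> [t0 tT]; apply: Build_ProperFilter_ex => A.
rewrite /within => -[r /= r0 rP].
have key s : D s -> s != t -> `|s - t| < r -> exists x, A x.
  by move=> Ds st sr; exists s; apply: (rP s) => //; rewrite /ball/= distrC.
have [tT'|tT'] := ltP t%:E T.
- have [p [p0 pr pT]] : exists p : R, [/\ 0 < p, p < r & ((t + p)%:E <= T)%E].
    case: T T0 tT tT' => [T'| |] //= _ _.
      rewrite lte_fin => tT'; exists (Num.min (r / 2) (T' - t)).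
      rewrite lt_min subr_gt0 tT' divr_gt0// gt_min; split => //.
        by apply/orP; left; lra.
      by rewrite lee_fin -lerBrDl ge_min lexx orbT.
    by move=> _; exists (r / 2); rewrite leey; split=> //; lra.
  apply: (key (t + p)).
  + by split => //; rewrite addr_ge0// ltW.
  + by rewrite gt_eqF// ltrDl.
  + by rewrite addrAC subrr add0r gtr0_norm.
- have tp : 0 < t by have := lt_le_trans T0 tT'; rewrite lte_fin.
  apply: (key (t - Num.min (r / 2) t)).
  + split; first by rewrite subr_ge0 ge_min lexx orbT.
    apply: le_trans tT; rewrite lee_fin gerBl le_min (ltW tp) andbT; lra.
  + by rewrite lt_eqF// gtrBl lt_min tp divr_gt0.
  + rewrite addrAC subrr add0r normrN gtr0_norm; last by rewrite lt_min tp divr_gt0.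
    by rewrite gt_min; apply/orP; left; lra.
Qed.

Lemma time_domain_ge0 t : D t -> 0 <= t. Proof. by case. Qed.

Lemma time_domain_le s t : D t -> 0 <= s -> s <= t -> D s.
Proof. by move=> [t0 tT] s0 st; split => //; apply: le_trans tT; rewrite lee_fin. Qed.

Lemma time_domain0 : D 0.
Proof. by split => //; exact: ltW. Qed.

Lemma dtE f t (d : R) : D t -> rate f t s @[s --> within D t^'] --> d -> dt D f t = d.
Proof. by move=> /time_domain_proper PD cv; apply/cvg_lim. Qed.

End time.

(** * Membership in X_T and regularity of the coefficients *)

Section regularity.
Context {R : realType}.
Variables (L : R) (n : nat).
Hypothesis L0 : 0 < L.
Implicit Types (b : nat -> R) (D : set R) (w : R -> R -> R).
Local Notation sum_modes := (modal L n).

Section norms_cvg.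
Variables (F : set_system R) (b : R -> nat -> R).
Context {FF : Filter F}.
Hypothesis b0 : forall k, b s k @[s --> F] --> (0 : R).

Let sq_cvg (c : nat -> R) : \sum_(1 <= k < n.+1) c k * b s k ^+ 2 @[s --> F] --> (0 : R).
Proof.
rewrite [X in _ --> X](_ : 0 = \sum_(1 <= k < n.+1) c k * (0 * 0)); last first.
  by rewrite big1// => k _; rewrite mulr0 mulr0.
apply: cvg_bigsum => k; apply: cvgM; first exact: cvg_cst.
by under eq_fun do rewrite expr2; exact: cvgM.
Qed.

Let sqrt_cvg (g : R -> R) : g s @[s --> F] --> (0 : R) -> Num.sqrt (g s) @[s --> F] --> (0 : R).
Proof.
by move=> g0; rewrite -[X in _ --> X]sqrtr0; apply: continuous_cvg => //; exact: sqrt_continuous.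
Qed.

Lemma normH2_modal_cvg : normH2 L (sum_modes (b s)) @[s --> F] --> (0 : R).
Proof. by under eq_fun do rewrite normH2_modal//; exact/sqrt_cvg/sq_cvg. Qed.

Lemma norm2_modal_cvg : norm2 L (sum_modes (b s)) @[s --> F] --> (0 : R).
Proof.
under eq_fun do rewrite norm2_modal//; apply: sqrt_cvg.
have := sq_cvg (fun=> 1).
by under eq_fun do under eq_bigr do rewrite mul1r.
Qed.

End norms_cvg.

Definition pairing b (v : R -> R) : R := ip2 L (sum_modes b) v.

Definition dual_bound b : R := \sum_(1 <= k < n.+1) `|b k| * freq L k ^- 2.

Lemma pairing_bound b v : H2H10 L v -> `|pairing b v| <= dual_bound b * normH2 L v.
Proof.
move=> Hv; have [[[Lv _] _] _] := Hv.
rewrite /pairing ip2_modal//; apply: le_trans (ler_norm_sum _ _ _) _.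
rewrite /dual_bound mulr_suml !big_nat; apply: ler_sum => k /andP[k0 _].
by rewrite normrM -mulrA ler_wpM2l//; exact: ip2_e_H2.
Qed.

Lemma normHstar_le (G : (R -> R) -> R) (A : R) : 0 <= A ->
  (forall v, H2H10 L v -> normH2 L v <= 1 -> `|G v| <= A) -> 0 <= normHstar L G <= A.
Proof.
(* The zero function makes the set under the supremum nonempty; it also gives the lower bound 0,
   needed for squeezing. *)
move=> A0 GA; pose z : R -> R := sum_modes (fun=> 0).
have Hz : H2H10 L z by exact: H2H10_modal.
have nz : normH2 L z <= 1.
  by rewrite /z normH2_modal// big1 ?sqrtr0// => k _; rewrite expr0n mulr0.
have ubA : ubound [set `|G v| | v in [set v | H2H10 L v /\ normH2 L v <= 1]] A.
  by move=> _ [v [Hv nv] <-]; exact: GA.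
apply/andP; split; last by apply: ge_sup ubA; exists `|G z|, z.
by apply: le_trans (normr_ge0 (G z)) _; apply: ub_le_sup; [exists A|exists z].
Qed.

Lemma normHstar_ge (G : (R -> R) -> R) v : Hstar L G -> H2H10 L v -> normH2 L v <= 1 ->
  `|G v| <= normHstar L G.
Proof.
move=> [_ [C GC]] Hv nv; apply: ub_le_sup; last by exists v.
exists `|C| => _ [u [Hu nu] <-]; apply: le_trans (GC u Hu) _.
have n0 : 0 <= normH2 L u by exact: sqrtr_ge0.
apply: (@le_trans _ _ (`|C| * normH2 L u)); first by rewrite ler_wpM2r// ler_norm.
by rewrite ler_piMr.
Qed.

Lemma Hstar_pairing b : Hstar L (pairing b).
Proof.
split; last by exists (dual_bound b) => v; exact: pairing_bound.
move=> c u v [[[Lu _] _] _] [[[Lv _] _] _]; have Lm : L2 L (sum_modes b).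
  exact/L2_continuous/modal_continuous.
rewrite /pairing /ip2 -int0LZ ?L2_mul// -int0LD; [|exact/intbleZ/L2_mul|exact: L2_mul].
by apply: eq_int0L => x _; ring.
Qed.

Lemma modalZB (c : R) a b1 b :
  c *: (sum_modes a - sum_modes b1) - sum_modes b = sum_modes (fun k => c * (a k - b1 k) - b k).
Proof.
apply/funext => x; rewrite /modal /= -[LHS]/(c * (sum_modes a x - sum_modes b1 x) - sum_modes b x) /modal.
by rewrite -sumrB mulr_sumr -sumrB; apply: eq_bigr => k _; ring.
Qed.

Lemma modalB a b : sum_modes a - sum_modes b = sum_modes (fun k => a k - b k).
Proof.
apply/funext => x; rewrite -[LHS]/(sum_modes a x - sum_modes b x) /modal.
by rewrite -sumrB; apply: eq_bigr => k _; ring.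
Qed.

Lemma pairingB a b v : H2H10 L v -> pairing a v - pairing b v = pairing (fun k => a k - b k) v.
Proof.
move=> [[[Lv _] _] _]; rewrite /pairing !ip2_modal// -sumrB.
by apply: eq_bigr => k _; ring.
Qed.

Lemma pairingZB (c : R) a b1 b v : H2H10 L v ->
  c * (pairing a v - pairing b1 v) - pairing b v = pairing (fun k => c * (a k - b1 k) - b k) v.
Proof.
move=> [[[Lv _] _] _]; rewrite /pairing !ip2_modal// -sumrB mulr_sumr -sumrB.
by apply: eq_bigr => k _; ring.
Qed.

Lemma normHstar_cvg (F : set_system R) {FF : Filter F} (b : R -> nat -> R) (G : R -> (R -> R) -> R) :
  (forall k, b s k @[s --> F] --> (0 : R)) ->
  (forall s v, H2H10 L v -> G s v = pairing (b s) v) ->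
  normHstar L (G s) @[s --> F] --> (0 : R).
Proof.
move=> b0 Gb; have db0 s : 0 <= dual_bound (b s).
  by apply: sumr_ge0 => k _; rewrite mulr_ge0// invr_ge0 exprn_even_ge0.
have H s : 0 <= normHstar L (G s) <= dual_bound (b s).
  apply: normHstar_le => // v Hv nv; rewrite Gb//; apply: le_trans (pairing_bound _ Hv) _.
  by rewrite ler_piMr.
apply: (@squeeze_cvgr _ _ _ _ (fun=> 0) (fun s => dual_bound (b s))).
- exact: nearW.
- exact: cvg_cst.
- have E : \sum_(1 <= k < n.+1) `|(0 : R)| * freq L k ^- 2 = 0.
    by rewrite big1// => k _; rewrite normr0 mul0r.
  rewrite -[X in _ --> X]E; apply: cvg_bigsum => k.
  by apply: cvgM; [exact: cvg_norm|exact: cvg_cst].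
Qed.

Section membership.
Variables (D : set R) (a a1 a2 : R -> nat -> R).
Hypothesis da : forall t k, D t -> is_derive t 1 (a ^~ k) (a1 t k).
Hypothesis da1 : forall t k, D t -> is_derive t 1 (a1 ^~ k) (a2 t k).
Hypothesis ca2 : forall t k, D t -> {for t, continuous (a2 ^~ k)}.

Let is_derive_for (f : R -> R) (t d : R) : is_derive t 1 f d -> {for t, continuous f}.
Proof. by move=> [df _]; exact/differentiable_continuous/derivable1_diffP. Qed.

Let incr (c : R -> nat -> R) (t : R) (k : nat) : {for t, continuous (c ^~ k)} ->
  c s k - c t k @[s --> within D (nbhs t)] --> (0 : R).
Proof.
move=> cc; have cv : c s k - c t k @[s --> t] --> c t k - c t k.
  by apply: cvgB; [exact: cc|exact: cvg_cst].
by rewrite subrr in cv; exact: cvg_within_filter cv.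
Qed.

Let quot (c c1 : R -> nat -> R) (t : R) (k : nat) : is_derive t 1 (c ^~ k) (c1 t k) ->
  (s - t)^-1 * (c s k - c t k) - c1 t k @[s --> within D t^'] --> (0 : R).
Proof.
move=> /(is_derive_rate D) cv.
have cv1 : (s - t)^-1 * (c s k - c t k) - c1 t k @[s --> within D t^'] --> c1 t k - c1 t k.
  by apply: cvgB; [exact: cv|exact: cvg_cst].
by rewrite subrr in cv1.
Qed.

(** On the span of finitely many modes the three norms are controlled by the coefficients, so C^2
    coefficients suffice. Two-sided derivatives may be assumed at all times of [D] because the
    constructed solution is differentiable on the whole line. *)
Lemma XT_modal : XT L D (fun t => sum_modes (a t)).
Proof.
split.
- split => // t Dt; split; first exact: H2H10_modal.
  under eq_fun do rewrite modalB; apply: normH2_modal_cvg => k.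
  by apply: incr; apply: is_derive_for; exact: da.
- split; [|exists (fun t => sum_modes (a1 t)); split; [|split => //]].
  + move=> t Dt; split; first exact/L2_continuous/modal_continuous.
    under eq_fun do rewrite modalB; apply: norm2_modal_cvg => k.
    by apply: incr; apply: is_derive_for; exact: da.
  + move=> t Dt; under eq_fun do rewrite modalZB; apply: norm2_modal_cvg => k.
    by apply: quot; exact: da.
  + move=> t Dt; split; first exact/L2_continuous/modal_continuous.
    under eq_fun do rewrite modalB; apply: norm2_modal_cvg => k.
    by apply: incr; apply: is_derive_for; exact: da1.
- split; [|exists (fun t => pairing (a1 t)); split; [|split; [|exists (fun t => pairing (a2 t)); split; [|split => //]]]].
  + move=> t Dt; split; first exact: Hstar_pairing.
    apply: (@normHstar_cvg _ _ (fun s k => a s k - a t k)); last by move=> s v; exact: pairingB.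
    by move=> k; apply: incr; apply: is_derive_for; exact: da.
  + move=> t Dt.
    apply: (@normHstar_cvg _ _ (fun s k => (s - t)^-1 * (a s k - a t k) - a1 t k)); last first.
      by move=> s v; exact: pairingZB.
    by move=> k; apply: quot; exact: da.
  + move=> t Dt; split; first exact: Hstar_pairing.
    apply: (@normHstar_cvg _ _ (fun s k => a1 s k - a1 t k)); last by move=> s v; exact: pairingB.
    by move=> k; apply: incr; apply: is_derive_for; exact: da1.
  + move=> t Dt.
    apply: (@normHstar_cvg _ _ (fun s k => (s - t)^-1 * (a1 s k - a1 t k) - a2 t k)); last first.
      by move=> s v; exact: pairingZB.
    by move=> k; apply: quot; exact: da1.
  + move=> t Dt; split; first exact: Hstar_pairing.
    apply: (@normHstar_cvg _ _ (fun s k => a2 s k - a2 t k)); last by move=> s v; exact: pairingB.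
    by move=> k; apply: incr; exact: ca2.
Qed.

End membership.

Lemma Hstar_combination (c : R) (F1 F2 F3 : (R -> R) -> R) :
  Hstar L F1 -> Hstar L F2 -> Hstar L F3 -> Hstar L (c *: (F1 - F2) - F3).
Proof.
move=> [l1 [C1 B1]] [l2 [C2 B2]] [l3 [C3 B3]].
have E v : (c *: (F1 - F2) - F3) v = c * (F1 v - F2 v) - F3 v by [].
split=> [d u v Hu Hv|]; first by rewrite !E l1// l2// l3//; ring.
exists (`|c| * (C1 + C2) + C3) => v Hv; rewrite E.
apply: le_trans (ler_normB _ _) _; rewrite mulrDl; apply: lerD; last exact: B3.
rewrite normrM -mulrA ler_wpM2l// mulrDl.
by apply: le_trans (ler_normB _ _) _; apply: lerD; [exact: B1|exact: B2].
Qed.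

(** By homogeneity, with [e_r / N] in the unit ball; the summand 1 makes [N] positive without
    evaluating the norm of [e_r]. *)
Lemma Hstar_eval (G : (R -> R) -> R) r : Hstar L G -> (1 <= r <= n)%N ->
  `|G (e_ L r)| <= (1 + normH2 L (e_ L r)) * normHstar L G.
Proof.
move=> HG rn; have [lG _] := HG.
(* Multiples of [e_r] as expansions with one coefficient, so that their membership and norm come
   from the general formulas. *)
pose del (c : R) : nat -> R := fun k => if k == r then c else 0.
have mdel c : sum_modes (del c) = fun x => c * e_ L r x.
  apply/funext => x; have rn' : r \in index_iota 1 n.+1 by rewrite mem_index_iota.
  rewrite /modal (bigD1_seq r) ?iota_uniq//= /del eqxx big1 ?addr0// => k /negbTE ->.
  by rewrite mul0r.
have nH c : 0 <= c -> normH2 L (sum_modes (del c)) = c * normH2 L (sum_modes (del 1)).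
  move=> c0; rewrite !normH2_modal//.
  have -> : \sum_(1 <= k < n.+1) freq L k ^+ 4 * del c k ^+ 2 =
     c ^+ 2 * \sum_(1 <= k < n.+1) freq L k ^+ 4 * del 1 k ^+ 2.
    rewrite mulr_sumr; apply: eq_bigr => k _; rewrite /del.
    by case: eqP => _; rewrite ?expr1n ?expr0n/= ?mulr0// !mulr1 mulrC.
  by rewrite sqrtrM ?sqr_ge0// sqrtr_sqr ger0_norm.
have m1 : sum_modes (del 1) = e_ L r by rewrite mdel; apply/funext => x; rewrite mul1r.
have He c : H2H10 L (fun x => c * e_ L r x) by rewrite -mdel; exact: H2H10_modal.
pose N := 1 + normH2 L (e_ L r).
have N0 : 0 < N by rewrite ltr_pwDl// sqrtr_ge0.
have G0 : G (fun=> 0) = 0.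
  have z : H2H10 L (fun=> 0 : R) by have := He 0; under eq_fun do rewrite mul0r.
  have := lG 1 _ _ z z; under eq_fun do rewrite mulr0 addr0.
  by lra.
have z : H2H10 L (fun=> 0 : R) by have := He 0; under eq_fun do rewrite mul0r.
have e1 : H2H10 L (e_ L r) by rewrite -m1; exact: H2H10_modal.
have GZ : G (fun x => N^-1 * e_ L r x) = N^-1 * G (e_ L r).
  by have := lG N^-1 _ _ e1 z; rewrite G0 addr0; under eq_fun do rewrite addr0.
have : `|G (fun x => N^-1 * e_ L r x)| <= normHstar L G.
  apply: normHstar_ge => //; rewrite -mdel nH; last by rewrite invr_ge0 ltW.
  by rewrite m1 ler_pdivrMl// mulr1 lerDr.
by rewrite GZ normrM gtr0_norm ?invr_gt0// ler_pdivrMl.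
Qed.

(** The coefficient is the pairing with [e_k], and evaluation at [e_k] is bounded for the dual norm.
    The two time derivatives come from the dual space, where X_T provides both of them. *)
Lemma XT_expansion_derivable D w (wk : nat -> R -> R) : XT L D w -> expansion L D n wk w ->
  exists b1 b2 : R -> nat -> R, forall t k, D t -> (1 <= k <= n)%N ->
    rate (wk k) t s @[s --> within D t^'] --> b1 t k /\
    rate (b1 ^~ k) t s @[s --> within D t^'] --> b2 t k.
Proof.
move=> [_ _ [C0 [F1 [D1 [C1 [F2 [D2 [C2 _]]]]]]]] Ew.
exists (fun t k => F1 t (e_ L k)), (fun t k => F2 t (e_ L k)) => t k Dt kn.
have wkE s : D s -> wk k s = ip2 L (w s) (e_ L k).
  move=> Ds; rewrite -(ip2_modal_e L0 (wk ^~ s) kn); apply: eq_int0L => x /andP[x0 xL].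
  by rewrite (Ew s x Ds)// in_itv/= !ltW.
have step (G G1 : R -> (R -> R) -> R) : (forall s, D s -> Hstar L (G s)) ->
    (forall s, D s -> Hstar L (G1 s)) -> deriv_in (normHstar L) D G G1 ->
    rate (fun s => G s (e_ L k)) t s @[s --> within D t^'] --> G1 t (e_ L k).
  move=> HG HG1 /(_ t Dt)/cvg_within_dnbhsP H; apply/cvg_within_dnbhsP => e e0.
  pose N := 1 + normH2 L (e_ L k).
  have N0 : 0 < N by rewrite ltr_pwDl// sqrtr_ge0.
  have [|r r0 rP] := H (e / N); first by rewrite divr_gt0.
  exists r => // s Ds st sr.
  have HH := Hstar_combination (s - t)^-1 (HG s Ds) (HG t Dt) (HG1 t Dt).
  apply: le_trans (Hstar_eval HH kn) _; rewrite -/N -ler_pdivlMl// mulrC.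
  have := rP s Ds st sr; rewrite subr0 => /(le_trans _); apply; exact: ler_norm.
split.
- apply: (eq_rate (f := fun s => ip2 L (w s) (e_ L k)) Dt); first by move=> s Ds; rewrite wkE.
  by apply: (step (fun s => ip2 L (w s)) F1) => // s Ds; [have [] := C0 s Ds|have [] := C1 s Ds].
- by apply: (step F1 F2) => // s Ds; [have [] := C1 s Ds|have [] := C2 s Ds].
Qed.

End regularity.

(** * The Galerkin system *)

Section congruence.
Context {R : realType}.
Variable c : constants R.
Let L := cL c.
Implicit Types (f g q u : R -> R) (x : R).

Lemma slope_congr u u' : (forall x, 0 <= x <= L -> u x = u' x) -> slope c u = slope c u'.
Proof.
move=> uu'; rewrite /slope (eq_conv_env (f2 := u' \+ yrest c))// => x xL.
by rewrite /= uu'.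
Qed.

Lemma hfun_congr u u' : (forall x, 0 <= x <= L -> u x = u' x) -> hfun c u = hfun c u'.
Proof. by move=> uu'; rewrite /hfun /Gamma (slope_congr uu'). Qed.

Lemma affine_on_gaps_congr f f' q q' x :
  (forall x, 0 <= x <= L -> f x = f' x) -> (forall x, 0 <= x <= L -> q x = q' x) ->
  0 <= x <= L -> affine_on_gaps L f q x = affine_on_gaps L f' q' x.
Proof.
move=> ff' qq' xL.
have E : contact_set L f = contact_set L f'.
  rewrite /contact_set (eq_conv_env ff'); apply/seteqP.
  by split => z [zL]; [rewrite ff'|rewrite -ff']; rewrite ?(ltW (andP zL).1) ?(ltW (andP zL).2).
rewrite /affine_on_gaps E; case: ifPn => [/set_mem Gx|_]; last exact: qq'.
have GL z : (`]0, L[%classic `\` contact_set L f') z -> 0 < z < L.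
  by case; rewrite /= in_itv.
have [l0 lx xr rL] := gap_bounds GL Gx.
by rewrite -/(gapl _ x) -/(gapr _ x) !qq'//; apply/andP; split=> //; lra.
Qed.

Lemma eq_derive1 f g x : 0 < x < L -> (forall x, 0 <= x <= L -> f x = g x) ->
  derive1 f x = derive1 g x.
Proof.
move=> xL fg; rewrite !derive1E; apply: near_eq_derive.
have : \forall y \near x, y \in `]0, L[ by apply: near_in_itvoo; rewrite in_itv.
by apply: filterS => y; rewrite in_itv/= => yL; apply: fg; rewrite !ltW//; case/andP: yL.
Qed.

Lemma ip2_hfun_congr u u' q q' :
  (forall x, 0 <= x <= L -> u x = u' x) -> (forall x, 0 <= x <= L -> q x = q' x) ->
  ip2 L (hfun c u) (derive1 (affine_on_gaps L (u \+ yrest c) q)) =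
  ip2 L (hfun c u') (derive1 (affine_on_gaps L (u' \+ yrest c) q')).
Proof.
move=> uu' qq'; apply: eq_int0L => x xL; rewrite (hfun_congr uu'); congr (_ * _).
apply: eq_derive1 => // z zL; apply: affine_on_gaps_congr => // y yL.
by rewrite /= uu'.
Qed.

End congruence.

Section lipschitz_trigonometry.
Context {R : realType}.

Lemma lip1 (f df : R -> R) : (forall x : R, is_derive x 1 f (df x)) -> (forall x, `|df x| <= 1) ->
  forall x y, `|f x - f y| <= `|x - y|.
Proof.
move=> D d1 x y; wlog : x y / y <= x.
  move=> H; have [/ltW|] := ltP x y; last exact: H.
  by rewrite distrC (distrC x); exact: H.
rewrite le_eqVlt => /predU1P[->|yx]; first by rewrite !subrr.
by have [z _ ->] := is_derive_MVT D yx; rewrite normrM ler_piMl.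
Qed.

Lemma sin_lip (x y : R) : `|sin x - sin y| <= `|x - y|.
Proof. exact: (lip1 (@is_derive_sin R) (@cos_max R)). Qed.

Lemma cos_lip (x y : R) : `|cos x - cos y| <= `|x - y|.
Proof.
by apply: (lip1 (@is_derive_cos R)) => z; rewrite normrN; exact: sin_max.
Qed.

End lipschitz_trigonometry.

(** * Growth and Lipschitz bounds in terms of the coefficients *)

Section forces.
Context {R : realType}.
Variables (c : constants R) (n : nat).
Let L := cL c.
Let L0 : 0 < L. Proof. exact: cL_gt0. Qed.
Local Notation e_ := (e_ L).
Local Notation e1_ := (e1_ L).
Local Notation modal := (modal L n).
Local Notation dmodal := (dmodal L n).
Implicit Types (a b : nat -> R) (x lam A : R) (r k : nat).

Definition mass a : R := \sum_(1 <= k < n.+1) `|a k|.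

Lemma mass_ge0 a : 0 <= mass a. Proof. exact: sumr_ge0. Qed.

(** One constant bounding the modes and, up to index [n], their derivatives. *)
Definition Emax : R := Num.sqrt (2 / L) * (1 + freq L n).

Let freq_ge0 k : 0 <= freq L k.
Proof. by rewrite divr_ge0 ?(ltW L0)// mulr_ge0 ?ler0n// pi_ge0. Qed.

Lemma Emax_ge0 : 0 <= Emax.
Proof. by rewrite mulr_ge0 ?sqrtr_ge0// addr_ge0. Qed.

Lemma e_le_Emax k x : `|e_ k x| <= Emax.
Proof. by apply: le_trans (e_bound _ _ _) _; rewrite ler_peMr ?sqrtr_ge0// lerDl. Qed.

Lemma e1_le_Emax k x : (k <= n)%N -> `|e1_ k x| <= Emax.
Proof.
move=> kn; have se : 0 <= Num.sqrt (2 / L) * freq L k by rewrite mulr_ge0 ?sqrtr_ge0.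
rewrite /e1_ normrM [`|_ * freq L k|]ger0_norm//.
apply: (@le_trans _ _ (Num.sqrt (2 / L) * freq L k)).
  by rewrite ler_piMr ?cos_max.
apply: ler_wpM2l; first exact: sqrtr_ge0.
apply: (@le_trans _ _ (freq L n)); last by rewrite lerDr.
by rewrite /freq ler_pM2r ?invr_gt0// ler_pM2r ?pi_gt0// ler_nat.
Qed.

Let sum_bound (f : nat -> R -> R) a x : (forall k, (k <= n)%N -> `|f k x| <= Emax) ->
  `|\sum_(1 <= k < n.+1) a k * f k x| <= Emax * mass a.
Proof.
move=> fE; apply: le_trans (ler_norm_sum _ _ _) _; rewrite /mass mulr_sumr !big_nat.
apply: ler_sum => k /andP[_ kn]; rewrite normrM mulrC.
by apply: ler_wpM2r => //; exact: fE.
Qed.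

Lemma modal_bound a x : `|modal a x| <= Emax * mass a.
Proof. by apply: sum_bound => k _; exact: e_le_Emax. Qed.

Lemma dmodal_bound a x : `|dmodal a x| <= Emax * mass a.
Proof. by apply: sum_bound => k; exact: e1_le_Emax. Qed.

Lemma modal_dist a b x : `|modal a x - modal b x| <= Emax * mass (fun k => a k - b k).
Proof.
rewrite (_ : _ - _ = modal (fun k => a k - b k) x); first exact: modal_bound.
by rewrite /modal -sumrB; apply: eq_bigr => k _; ring.
Qed.

Lemma dmodal_dist a b x : `|dmodal a x - dmodal b x| <= Emax * mass (fun k => a k - b k).
Proof.
rewrite (_ : _ - _ = dmodal (fun k => a k - b k) x); first exact: dmodal_bound.
by rewrite /dmodal -sumrB; apply: eq_bigr => k _; ring.
Qed.

(* [lam] is [cell c] for the cable alpha and [- cell c] for the cable beta. *)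
Definition cable lam a b x : R := modal a x + lam * sin (modal b x).
Definition dcable lam a b x : R := dmodal a x + lam * (cos (modal b x) * dmodal b x).

Let is_derive_sin_modal b x : is_derive x 1 (fun x => sin (modal b x)) (cos (modal b x) * dmodal b x).
Proof.
exact: (@is_derive1_comp _ (@sin R) (modal b) x _ _ (is_derive_sin _) (is_derive_modal L n b x)).
Qed.

Let is_derive_cos_modal b x : is_derive x 1 (fun x => cos (modal b x)) (- sin (modal b x) * dmodal b x).
Proof.
exact: (@is_derive1_comp _ (@cos R) (modal b) x _ _ (is_derive_cos _) (is_derive_modal L n b x)).
Qed.

Lemma is_derive_cable lam a b x : is_derive x 1 (cable lam a b) (dcable lam a b x).
Proof.
have := is_derive_modal L n a x; have := is_derive_sin_modal b x => h1 h2.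
by apply: is_deriveD; exact: is_deriveZ.
Qed.

Let dmodal_cont b : continuous (dmodal b) := @dmodal_continuous _ L n b.
Let sin_cont b : continuous (fun x => sin (modal b x)) := is_derive_continuous (is_derive_sin_modal b).
Let cos_cont b : continuous (fun x => cos (modal b x)) := is_derive_continuous (is_derive_cos_modal b).

Definition twist r b x : R := e_ r x * cos (modal b x).
Definition dtwist r b x : R := e1_ r x * cos (modal b x) - e_ r x * (sin (modal b x) * dmodal b x).

Lemma is_derive_twist r b x : is_derive x 1 (twist r b) (dtwist r b x).
Proof.
have := is_derive_e L r x; have := is_derive_cos_modal b x => h1 h2.
by apply: is_derive_eq; rewrite /dtwist /GRing.scale/=; ring.
Qed.

Lemma dtwist_continuous r b : continuous (dtwist r b).
Proof.
move=> x; apply: cvgB; apply: cvgM.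
- exact: (@e1_continuous _ L r).
- exact: cos_cont.
- exact: (@e_continuous _ L r).
- by apply: cvgM; [exact: sin_cont|exact: dmodal_cont].
Qed.

Lemma dcable_bound lam a b A x : mass a <= A -> mass b <= A ->
  `|dcable lam a b x| <= (1 + `|lam|) * (Emax * A).
Proof.
move=> aA bA; rewrite mulrDl mul1r; apply: le_trans (ler_normD _ _) _; apply: lerD.
  by apply: le_trans (dmodal_bound _ _) _; rewrite ler_wpM2l// Emax_ge0.
rewrite normrM ler_wpM2l// normrM; apply: (@le_trans _ _ (1 * `|dmodal b x|)).
  by rewrite ler_wpM2r// cos_max.
by rewrite mul1r; apply: le_trans (dmodal_bound _ _) _; rewrite ler_wpM2l// Emax_ge0.
Qed.

Let prod_dist (p q p' q' P dp dq Q : R) : `|p| <= P -> `|q'| <= Q -> `|p - p'| <= dp -> `|q - q'| <= dq ->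
  `|p * q - p' * q'| <= P * dq + dp * Q.
Proof.
move=> h1 h2 h3 h4; have -> : p * q - p' * q' = p * (q - q') + (p - p') * q' by ring.
by apply: le_trans (ler_normD _ _) _; rewrite !normrM; apply: lerD; apply: ler_pM.
Qed.

Let cos_modal_dist b b' d x : mass (fun k => b k - b' k) <= d ->
  `|cos (modal b x) - cos (modal b' x)| <= Emax * d.
Proof.
move=> bd; apply: le_trans (cos_lip _ _) _; apply: le_trans (modal_dist _ _ _) _.
by rewrite ler_wpM2l// Emax_ge0.
Qed.

Let sin_modal_dist b b' d x : mass (fun k => b k - b' k) <= d ->
  `|sin (modal b x) - sin (modal b' x)| <= Emax * d.
Proof.
move=> bd; apply: le_trans (sin_lip _ _) _; apply: le_trans (modal_dist _ _ _) _.
by rewrite ler_wpM2l// Emax_ge0.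
Qed.

Let dmodal_bound' b A x : mass b <= A -> `|dmodal b x| <= Emax * A.
Proof. by move=> bA; apply: le_trans (dmodal_bound _ _) _; rewrite ler_wpM2l// Emax_ge0. Qed.

Let dmodal_dist' b b' d x : mass (fun k => b k - b' k) <= d -> `|dmodal b x - dmodal b' x| <= Emax * d.
Proof. by move=> bA; apply: le_trans (dmodal_dist _ _ _) _; rewrite ler_wpM2l// Emax_ge0. Qed.

Lemma dcable_dist lam a b a' b' A d x : mass b' <= A ->
  mass (fun k => a k - a' k) <= d -> mass (fun k => b k - b' k) <= d ->
  `|dcable lam a b x - dcable lam a' b' x| <= Emax * (1 + `|lam| * (1 + Emax * A)) * d.
Proof.
move=> bA ad bd.
have -> : dcable lam a b x - dcable lam a' b' x = (dmodal a x - dmodal a' x) +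
   lam * (cos (modal b x) * dmodal b x - cos (modal b' x) * dmodal b' x) by rewrite /dcable; ring.
have -> : Emax * (1 + `|lam| * (1 + Emax * A)) * d =
  Emax * d + `|lam| * (1 * (Emax * d) + (Emax * d) * (Emax * A)) by ring.
apply: le_trans (ler_normD _ _) _; apply: lerD; first exact: dmodal_dist'.
rewrite normrM ler_wpM2l//; apply: prod_dist.
- exact: cos_max.
- exact: dmodal_bound'.
- exact: cos_modal_dist.
- exact: dmodal_dist'.
Qed.

Lemma dtwist_bound r b A x : (r <= n)%N -> mass b <= A -> `|dtwist r b x| <= Emax * (1 + Emax * A).
Proof.
move=> rn bA; rewrite mulrDr; apply: le_trans (ler_normB _ _) _.
rewrite [X in X + _]normrM [X in _ + X]normrM [X in _ + _ * X]normrM; apply: lerD.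
  by apply: ler_pM => //; [exact: e1_le_Emax|exact: cos_max].
apply: ler_pM => //; first exact: e_le_Emax.
by rewrite -[Emax * A]mul1r; apply: ler_pM => //; [exact: sin_max|exact: dmodal_bound'].
Qed.

Lemma dtwist_dist r b b' A d x : (r <= n)%N -> mass b' <= A -> mass (fun k => b k - b' k) <= d ->
  `|dtwist r b x - dtwist r b' x| <= Emax * (2 * Emax + Emax * (Emax * A)) * d.
Proof.
move=> rn bA bd.
have -> : dtwist r b x - dtwist r b' x = e1_ r x * (cos (modal b x) - cos (modal b' x)) -
  e_ r x * (sin (modal b x) * dmodal b x - sin (modal b' x) * dmodal b' x) by rewrite /dtwist; ring.
have -> : Emax * (2 * Emax + Emax * (Emax * A)) * d = Emax * (Emax * d) +
   Emax * (1 * (Emax * d) + (Emax * d) * (Emax * A)) by ring.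
apply: le_trans (ler_normB _ _) _; rewrite [X in X + _]normrM [X in _ + X]normrM; apply: lerD.
  by apply: ler_pM => //; [exact: e1_le_Emax|exact: cos_modal_dist].
apply: ler_pM => //; first exact: e_le_Emax.
apply: prod_dist.
- exact: sin_max.
- exact: dmodal_bound'.
- exact: sin_modal_dist.
- exact: dmodal_dist'.
Qed.

Let tension_const_ge0 : 0 <= tension_const c.
Proof. by rewrite addr_ge0// mulr_ge0// addr_ge0//; exact: (ltW L0). Qed.

Let stiffness_ge0 : 0 <= stiffness c. Proof. exact: normr_ge0. Qed.

Let dymax_ge0 : 0 <= dymax c. Proof. by rewrite addr_ge0. Qed.

Let tension_ge0 B : 0 <= B -> 0 <= tension_const c + stiffness c * (L * (B + dymax c)).
Proof.
move=> B0; rewrite addr_ge0// mulr_ge0// mulr_ge0 ?(ltW L0)//; exact: addr_ge0.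
Qed.

Let growth_aux lam q dq a b : (forall x : R, is_derive x 1 q (dq x)) -> continuous dq ->
  q 0 = 0 -> q L = 0 -> (forall x, 0 <= x <= L -> `|q x| <= Emax) ->
  `|force c (cable lam a b) dq| <=
  (tension_const c + stiffness c * (L * ((1 + `|lam|) * Emax + dymax c))) * (2 * Emax) * (1 + (mass a + mass b)).
Proof.
move=> Dq cdq q0 qL qE.
have ma := mass_ge0 a; have mb := mass_ge0 b; have E0 := Emax_ge0.
have B1 x : 0 < x < L -> `|dcable lam a b x| <= (1 + `|lam|) * (Emax * (mass a + mass b)).
  by move=> _; apply: dcable_bound; rewrite ?lerDl ?lerDr.
apply: le_trans (force_growth (is_derive_cable lam a b) B1 Dq cdq q0 qL qE) _.
clear B1 qE; move: (Emax) E0 => E E0; rewrite [leRHS]mulrAC; apply: ler_wpM2r; first by rewrite mulr_ge0.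
set A := mass a + mass b; have A0 : 0 <= A by rewrite addr_ge0.
rewrite [leRHS]mulrDl; apply: lerD.
  rewrite ler_peMr ?lerDl// /tension_const addr_ge0// mulr_ge0// addr_ge0//; exact: ltW.
rewrite -!mulrA; apply: ler_wpM2l; first exact: normr_ge0.
apply: ler_wpM2l; first exact: ltW.
rewrite [leRHS]mulrDl; apply: lerD.
  by rewrite -mulrA; apply: ler_wpM2l; [rewrite addr_ge0|apply: ler_wpM2l => //; rewrite lerDr].
by rewrite ler_peMr ?lerDl// /dymax addr_ge0.
Qed.

(** The two hypotheses of the Picard theorem, uniform in the mode index and stable under the linear
    combinations that form the accelerations. *)
Definition tame (phi : nat -> (nat -> R) -> (nat -> R) -> R) :=
  (exists2 C, 0 <= C & forall r a b, (1 <= r <= n)%N ->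
     `|phi r a b| <= C * (1 + (mass a + mass b))) /\
  forall A, exists2 K, 0 <= K & forall r a b a' b', (1 <= r <= n)%N ->
     mass a <= A -> mass b <= A -> mass a' <= A -> mass b' <= A ->
     `|phi r a b - phi r a' b'| <= K * (mass (fun k => a k - a' k) + mass (fun k => b k - b' k)).

Lemma tameD phi psi : tame phi -> tame psi -> tame (fun r a b => phi r a b + psi r a b).
Proof.
move=> [[C1 C10 g1] l1] [[C2 C20 g2] l2]; split.
  exists (C1 + C2) => [|r a b rn]; first exact: addr_ge0.
  apply: le_trans (ler_normD _ _) _; rewrite mulrDl.
  by apply: lerD; [exact: g1|exact: g2].
move=> A; have [K1 K10 h1] := l1 A; have [K2 K20 h2] := l2 A.
exists (K1 + K2) => [|r a b a' b' rn aA bA aA' bA']; first exact: addr_ge0.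
rewrite opprD addrACA; apply: le_trans (ler_normD _ _) _; rewrite mulrDl.
by apply: lerD; [exact: h1|exact: h2].
Qed.

Lemma tameZ (k : R) phi : tame phi -> tame (fun r a b => k * phi r a b).
Proof.
move=> [[C1 C10 g1] l1]; split.
  exists (`|k| * C1) => [|r a b rn]; first exact: mulr_ge0.
  by rewrite normrM -mulrA; apply: ler_wpM2l => //; exact: g1.
move=> A; have [K1 K10 h1] := l1 A.
exists (`|k| * K1) => [|r a b a' b' rn aA bA aA' bA']; first exact: mulr_ge0.
by rewrite -mulrBr normrM -mulrA; apply: ler_wpM2l => //; exact: h1.
Qed.

Lemma le_mass a r : (1 <= r <= n)%N -> `|a r| <= mass a.
Proof.
move=> rn; have rn' : r \in index_iota 1 n.+1 by rewrite mem_index_iota.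
by rewrite /mass (bigD1_seq r) ?iota_uniq//= lerDl sumr_ge0.
Qed.

Lemma tame_cst (k : nat -> R) : tame (fun r _ _ => k r).
Proof.
split.
  exists (mass k) => [|r a b rn]; first exact: mass_ge0.
  apply: le_trans (le_mass k rn) _; rewrite ler_peMr ?mass_ge0// lerDl.
  by rewrite addr_ge0// mass_ge0.
move=> A; exists 0 => // r a b a' b' *.
by rewrite subrr normr0 mul0r.
Qed.

Lemma tame_mode (j : bool) (k : nat -> R) : tame (fun r a b => k r * (if j then b else a) r).
Proof.
have kE r (z : nat -> R) : (1 <= r <= n)%N -> `|k r * z r| <= mass k * mass z.
  by move=> rn; rewrite normrM; apply: ler_pM => //; exact: le_mass.
split.
  exists (mass k) => [|r a b rn]; first exact: mass_ge0.
  apply: le_trans (kE r _ rn) _; apply: ler_wpM2l; first exact: mass_ge0.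
  by have := mass_ge0 a; have := mass_ge0 b; case: j; lra.
move=> A; exists (mass k) => [|r a b a' b' rn _ _ _ _]; first exact: mass_ge0.
rewrite -mulrBr.
have ma := mass_ge0 (fun k => a k - a' k); have mb := mass_ge0 (fun k => b k - b' k).
case: j.
  apply: le_trans (kE r (fun k => b k - b' k) rn) _; apply: ler_wpM2l; first exact: mass_ge0.
  by rewrite lerDr.
apply: le_trans (kE r (fun k => a k - a' k) rn) _; apply: ler_wpM2l; first exact: mass_ge0.
by rewrite lerDl.
Qed.

(** [v] may depend on [b], as the derivatives of the torsional test functions do; [V A] and [k A]
    are its bound and Lipschitz constant for coefficients of mass at most [A]. *)
Let lip_aux lam (v : nat -> (nat -> R) -> R -> R) (V k : R -> R) :
  (forall r b, continuous (v r b)) ->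
  (forall A, 0 <= A -> 0 <= V A /\ 0 <= k A) ->
  (forall r b A x, (1 <= r <= n)%N -> mass b <= A -> `|v r b x| <= V A) ->
  (forall r b b' A d x, (1 <= r <= n)%N -> mass b' <= A -> mass (fun k => b k - b' k) <= d ->
     `|v r b x - v r b' x| <= k A * d) ->
  forall A, exists2 K, 0 <= K & forall r a b a' b', (1 <= r <= n)%N ->
     mass a <= A -> mass b <= A -> mass a' <= A -> mass b' <= A ->
     `|force c (cable lam a b) (v r b) - force c (cable lam a' b') (v r b')| <=
       K * (mass (fun k => a k - a' k) + mass (fun k => b k - b' k)).
Proof.
move=> cv Vk0 vV vk A.
have [A0|A0] := leP 0 A; last first.
  by exists 0 => // r a b a' b' _ aA; have := le_lt_trans (le_trans (mass_ge0 a) aA) A0; rewrite ltxx.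
have [V0 k0] := Vk0 A A0; have E0 := Emax_ge0.
pose B := (1 + `|lam|) * (Emax * A).
pose Kd := Emax * (1 + `|lam| * (1 + Emax * A)).
have Kd0 : 0 <= Kd by apply: mulr_ge0 => //; rewrite addr_ge0// mulr_ge0// addr_ge0// mulr_ge0.
have t0 : 0 <= tension_const c + stiffness c * (L * (B + dymax c)).
  by apply: tension_ge0; rewrite mulr_ge0 ?addr_ge0// mulr_ge0.
exists (stiffness c * (Kd * L) * (V A * L) +
   (tension_const c + stiffness c * (L * (B + dymax c))) * ((Kd * V A + k A) * L)).
  have l0 := ltW L0; apply: addr_ge0.
    by apply: mulr_ge0; [apply: mulr_ge0 => //; exact: mulr_ge0|exact: mulr_ge0].
  by apply: mulr_ge0 => //; rewrite mulr_ge0// addr_ge0// mulr_ge0.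
move=> r a b a' b' rn aA bA aA' bA'.
set d := mass (fun k => a k - a' k) + _.
have ad : mass (fun k => a k - a' k) <= d by rewrite lerDl mass_ge0.
have bd : mass (fun k => b k - b' k) <= d by rewrite lerDr mass_ge0.
have := @force_dist _ c (cable lam a b) (dcable lam a b) (cable lam a' b') (dcable lam a' b')
  (v r b) (v r b') (is_derive_cable lam a b) (is_derive_cable lam a' b') (cv r b) (cv r b')
  B (Kd * d) (V A) (k A * d).
move=> H; apply: le_trans (H _ _ _ _ _) _.
- by move=> x _; exact: dcable_bound.
- by move=> x _; exact: dcable_bound.
- by move=> x _; exact: dcable_dist.
- by move=> x _; exact: vV.
- by move=> x _; exact: vk.
rewrite -/L le_eqVlt; apply/orP; left; apply/eqP.
move: (stiffness c) (tension_const c) (dymax c) => s1 s2 s3; ring.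
Qed.

Lemma tame_force_e lam : tame (fun r a b => force c (cable lam a b) (e1_ r)).
Proof.
split.
  exists ((tension_const c + stiffness c * (L * ((1 + `|lam|) * Emax + dymax c))) * (2 * Emax)).
    have E0 := Emax_ge0; apply: mulr_ge0; last (by rewrite mulr_ge0); apply: tension_ge0.
    by rewrite mulr_ge0// addr_ge0.
  move=> r a b _; apply: (growth_aux _ _ _ (is_derive_e L r)).
  - exact: e1_continuous.
  - exact: e_0.
  - exact: e_L.
  - by move=> x _; exact: e_le_Emax.
apply: (@lip_aux lam (fun r _ => e1_ r) (fun=> Emax) (fun=> 0)).
- by move=> r _; exact: e1_continuous.
- by move=> A _; split => //; exact: Emax_ge0.
- by move=> r b A x /andP[_ rn] _; exact: e1_le_Emax.
- by move=> r b b' A d x _ _ _; rewrite subrr normr0 mul0r.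
Qed.

Lemma tame_force_twist lam : tame (fun r a b => force c (cable lam a b) (dtwist r b)).
Proof.
have E0 := Emax_ge0.
split.
  exists ((tension_const c + stiffness c * (L * ((1 + `|lam|) * Emax + dymax c))) * (2 * Emax)).
    by apply: mulr_ge0; last (by rewrite mulr_ge0); apply: tension_ge0; rewrite mulr_ge0// addr_ge0.
  move=> r a b _; apply: (growth_aux _ _ _ (is_derive_twist r b)).
  - exact: dtwist_continuous.
  - by rewrite /twist e_0 mul0r.
  - by rewrite /twist (e_L L0) mul0r.
  - move=> x _; rewrite /twist normrM -[Emax]mulr1; apply: ler_pM => //; [exact: e_le_Emax|exact: cos_max].
apply: (@lip_aux lam dtwist (fun A => Emax * (1 + Emax * A)) (fun A => Emax * (2 * Emax + Emax * (Emax * A)))).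
- by move=> r b; exact: dtwist_continuous.
- move=> A A0; have EA : 0 <= Emax * A by exact: mulr_ge0.
  by split; apply: mulr_ge0 => //; apply: addr_ge0 => //; exact: mulr_ge0.
- by move=> r b A x /andP[_ rn] bA; exact: dtwist_bound.
- by move=> r b b' A d x /andP[_ rn] bA bd; exact: dtwist_dist.
Qed.

Definition load r : R := ip2 L (fun=> cM c * cg c) (e_ r).

(** The factors [-1 *] put the right-hand side literally into the form handled by [tameD] and
    [tameZ]. *)
Definition acc_w r a b : R := (cM c)^-1 * (load r + - (cE c * cI c) * freq L r ^+ 4 * a r
  + -1 * force c (cable (cell c) a b) (e1_ r) + -1 * force c (cable (- cell c) a b) (e1_ r)).

Definition acc_th r a b : R := (cM c * cell c / 3)^-1 *
  (- (cE c * cJ c / cell c * freq L r ^+ 4 + cG c * cK c / cell c * freq L r ^+ 2) * b r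
   + -1 * force c (cable (cell c) a b) (dtwist r b) + force c (cable (- cell c) a b) (dtwist r b)).

Lemma tame_acc_w : tame acc_w.
Proof.
apply: tameZ; apply: tameD; last exact/tameZ/tame_force_e.
apply: tameD; last exact/tameZ/tame_force_e.
apply: tameD; first exact: tame_cst.
exact: (tame_mode false (fun r => - (cE c * cI c) * freq L r ^+ 4)).
Qed.

Lemma tame_acc_th : tame acc_th.
Proof.
apply: tameZ; apply: tameD; last exact: tame_force_twist.
apply: tameD; last exact/tameZ/tame_force_twist.
exact: (tame_mode true (fun r => - (cE c * cJ c / cell c * freq L r ^+ 4 + cG c * cK c / cell c * freq L r ^+ 2))).
Qed.

Section equations.
Variables (w th : R -> R) (a b : nat -> R).
Hypothesis wa : forall x, 0 <= x <= L -> w x = modal a x.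
Hypothesis thb : forall x, 0 <= x <= L -> th x = modal b x.

Let u_alphaE x : 0 <= x <= L -> u_alpha c w th x = cable (cell c) a b x.
Proof. by move=> xL; rewrite /u_alpha /cable wa// thb. Qed.

Let u_betaE x : 0 <= x <= L -> u_beta c w th x = cable (- cell c) a b x.
Proof. by move=> xL; rewrite /u_beta /cable wa// thb// mulNr. Qed.

Let twistE r x : 0 <= x <= L -> e_ r x * cos (th x) = twist r b x.
Proof. by move=> xL; rewrite thb. Qed.

Let ip2_hfun lam u q q0 dq : (forall x, 0 <= x <= L -> u x = cable lam a b x) ->
  (forall x, 0 <= x <= L -> q x = q0 x) -> (forall x : R, is_derive x 1 q0 (dq x)) -> continuous dq ->
  ip2 L (hfun c u) (derive1 (affine_on_gaps L (u \+ yrest c) q)) = - force c (cable lam a b) dq.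
Proof.
move=> uE qE Dq cdq; rewrite (ip2_hfun_congr uE qE).
exact: (force_identity c (is_derive_cable lam a b) Dq cdq).
Qed.

Lemma rhs_w r : ip2 L (h_alpha c w th) (derive1 (J_alpha c w th (e_ r)))
   + ip2 L (h_beta c w th) (derive1 (J_beta c w th (e_ r))) =
  - force c (cable (cell c) a b) (e1_ r) - force c (cable (- cell c) a b) (e1_ r).
Proof.
congr (_ + _).
- exact: (ip2_hfun u_alphaE (fun _ _ => erefl) (is_derive_e L r) (@e1_continuous _ L r)).
- exact: (ip2_hfun u_betaE (fun _ _ => erefl) (is_derive_e L r) (@e1_continuous _ L r)).
Qed.

Lemma rhs_th r : ip2 L (h_alpha c w th) (derive1 (G_alpha c w th (e_ r)))
   - ip2 L (h_beta c w th) (derive1 (G_beta c w th (e_ r))) =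
  - force c (cable (cell c) a b) (dtwist r b) + force c (cable (- cell c) a b) (dtwist r b).
Proof.
rewrite -[force c (cable (- _) _ _) _]opprK; congr (_ - _).
- exact: (ip2_hfun u_alphaE (twistE r) (is_derive_twist r b) (@dtwist_continuous r b)).
- exact: (ip2_hfun u_betaE (twistE r) (is_derive_twist r b) (@dtwist_continuous r b)).
Qed.

Lemma ipH2_w r : (1 <= r <= n)%N -> ipH2 L w (e_ r) = freq L r ^+ 4 * a r.
Proof.
move=> rn; have E : wderiv L w = wderiv L (modal a).
  by apply: eq_wderiv => x /andP[x0 xL]; apply: wa; rewrite !ltW.
by rewrite /ipH2 E; exact: (ipH2_modal L0 a rn).
Qed.

Lemma ipH2_th r : (1 <= r <= n)%N -> ipH2 L th (e_ r) = freq L r ^+ 4 * b r.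
Proof.
move=> rn; have E : wderiv L th = wderiv L (modal b).
  by apply: eq_wderiv => x /andP[x0 xL]; apply: thb; rewrite !ltW.
by rewrite /ipH2 E; exact: (ipH2_modal L0 b rn).
Qed.

Lemma ipH1_th r : (1 <= r <= n)%N -> ipH1 L th (e_ r) = freq L r ^+ 2 * b r.
Proof.
move=> rn; have E : wderiv L th = wderiv L (modal b).
  by apply: eq_wderiv => x /andP[x0 xL]; apply: thb; rewrite !ltW.
by rewrite /ipH1 E; exact: (ipH1_modal L0 b rn).
Qed.

(** An equivalence, since uniqueness reads it from left to right and existence from right to
    left. *)
Lemma equation_w r (wtt : R) : (1 <= r <= n)%N ->
  (cM c * wtt + cE c * cI c * ipH2 L w (e_ r) - ip2 L (fun=> cM c * cg c) (e_ r)
   = ip2 L (h_alpha c w th) (derive1 (J_alpha c w th (e_ r)))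
   + ip2 L (h_beta c w th) (derive1 (J_beta c w th (e_ r)))) <-> wtt = acc_w r a b.
Proof.
move=> rn; rewrite rhs_w ipH2_w// -/(load r) /acc_w.
move: (force _ _ _) (force _ (cable (- _) _ _) _) (load r) => f1 f2 l.
have M0 : cM c != 0 by rewrite gt_eqF// cM_gt0.
split=> [H|->]; last by field.
apply: (mulfI M0); rewrite mulrA mulfV// mul1r; move: H; lra.
Qed.

Lemma equation_th r (thtt : R) : (1 <= r <= n)%N ->
  (cM c * cell c / 3 * thtt + cE c * cJ c / cell c * ipH2 L th (e_ r)
   + cG c * cK c / cell c * ipH1 L th (e_ r)
   = ip2 L (h_alpha c w th) (derive1 (G_alpha c w th (e_ r)))
   - ip2 L (h_beta c w th) (derive1 (G_beta c w th (e_ r)))) <-> thtt = acc_th r a b.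
Proof.
move=> rn; rewrite rhs_th ipH2_th// ipH1_th// /acc_th.
move: (force _ _ _) (force _ (cable (- _) _ _) _) => f1 f2.
have M0 : cM c * cell c / 3 != 0 by rewrite gt_eqF// divr_gt0// mulr_gt0 ?cM_gt0 ?cell_gt0.
move: (cE c * cJ c / cell c) (cG c * cK c / cell c) (cM c * cell c / 3) M0 => k1 k2 m M0.
split=> [H|->]; last by field.
apply: (mulfI M0); rewrite mulrA mulfV// mul1r; move: H; lra.
Qed.

End equations.
End forces.

Section second_time_derivative.
Context {R : realType}.
Variables (L : R) (n : nat) (T : \bar R).
Hypotheses (L0 : 0 < L) (T0 : (0 < T)%E).
Let D := time_domain T.

Lemma rate_sum_modes (a : nat -> R -> R) (d : nat -> R) t x :
  (forall k, (1 <= k <= n)%N -> rate (a k) t s @[s --> within D t^'] --> d k) ->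
  rate (fun s => \sum_(1 <= k < n.+1) a k s * e_ L k x) t s @[s --> within D t^'] --> modal L n d x.
Proof.
move=> ad.
(* [cvg_bigsum] asks for convergence at every index, so indices out of range receive the constant
   0. *)
pose f k s := if (1 <= k <= n)%N then rate (a k) t s * e_ L k x else 0.
pose l k := if (1 <= k <= n)%N then d k * e_ L k x else 0.
have -> : modal L n d x = \sum_(1 <= k < n.+1) l k.
  by rewrite /modal !big_nat; apply: eq_bigr => k kn; rewrite /l kn.
have -> : rate (fun s => \sum_(1 <= k < n.+1) a k s * e_ L k x) t = fun s => \sum_(1 <= k < n.+1) f k s.
  apply/funext => s; rewrite /rate -sumrB mulr_sumr !big_nat; apply: eq_bigr => k kn.
  by rewrite /f kn -mulrBl mulrA.
apply: cvg_bigsum => k; rewrite /f /l; case: ifP => kn; last exact: cvg_cst.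
by apply: cvgM; [exact: ad|exact: cvg_cst].
Qed.

(** For fixed [x] in [0, L], both time derivatives are taken mode by mode. The inner one is
    identified only at times of [D], and these are the only times the outer difference quotient
    samples. *)
Lemma ip2_second_dt w wk (b1 b2 : R -> nat -> R) t r :
  expansion L D n wk w ->
  (forall t k, D t -> (1 <= k <= n)%N ->
     rate (wk k) t s @[s --> within D t^'] --> b1 t k /\
     rate (b1 ^~ k) t s @[s --> within D t^'] --> b2 t k) ->
  D t -> (1 <= r <= n)%N -> ip2 L (fun x => dt D (dt D (w ^~ x)) t) (e_ L r) = b2 t r.
Proof.
move=> Ew Hb Dt rn; rewrite -(ip2_modal_e L0 (b2 t) rn); apply: eq_int0L => x /andP[x0 xL].
congr (_ * _); have xL' : x \in `[0, L] by rewrite in_itv/= !ltW.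
have dt1 s : D s -> dt D (w ^~ x) s = modal L n (b1 s) x.
  move=> Ds; apply: (dtE T0 Ds).
  apply: (@eq_rate _ _ (fun s => \sum_(1 <= k < n.+1) wk k s * e_ L k x)) => // [u Du|].
    by rewrite Ew.
  by apply: rate_sum_modes => k kn; have [] := Hb s k Ds kn.
apply: (dtE T0 Dt).
apply: (@eq_rate _ _ (fun s => \sum_(1 <= k < n.+1) b1 s k * e_ L k x)) => // [u Du|].
  by rewrite dt1.
by apply: rate_sum_modes => k kn; have [] := Hb t k Dt kn.
Qed.

End second_time_derivative.

(** * The first-order system for the coefficients, existence and uniqueness *)

Section galerkin_ode.
Context {R : realType}.
Variables (c : constants R) (n : nat) (T : \bar R).
Hypothesis T0 : (0 < T)%E.
Let L := cL c.
Let L0 : 0 < L. Proof. exact: cL_gt0. Qed.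
Let D := time_domain T.

(* The state (j, v, k) is the k-th coefficient of [w] (j = false) or [theta]
   (j = true) for v = false, of its time derivative for v = true; the slots
   with k = 0 are unused and stay equal to 0. *)
Let state : finType := (bool * bool * 'I_n.+1)%type.
Implicit Types (X Y : state -> R).

Definition coeffs (j v : bool) X k : R := X (j, v, inord k).

Lemma mass_coeffs j v X : mass n (coeffs j v X) <= norm1 X.
Proof.
apply: (@le_trans _ _ (\sum_(k < n.+1) `|X (j, v, k)|)).
  have -> : \sum_(k < n.+1) `|X (j, v, k)| = \sum_(0 <= k < n.+1) `|coeffs j v X k|.
    by rewrite big_mkord; apply: eq_bigr => k _; rewrite /coeffs inord_val.
  by rewrite [leRHS]big_ltn// lerDr.
have -> : norm1 X = \sum_(p : bool * bool) \sum_(k < n.+1) `|X (p, k)|.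
  by rewrite pair_bigA; apply: eq_bigr => -[].
by rewrite (bigD1 (j, v))//= lerDl; apply: sumr_ge0 => p _; exact: sumr_ge0.
Qed.

Let norm1_le X (B : R) : (forall i, `|X i| <= B) -> norm1 X <= #|state|%:R * B.
Proof.
move=> XB; apply: (@le_trans _ _ (\sum_(i : state) B)); first exact: ler_sum.
by rewrite sumr_const mulr_natl.
Qed.

Let inord0 k : (1 <= k <= n)%N -> (inord k == ord0 :> 'I_n.+1) = false.
Proof.
by case/andP=> k0 kn; apply/negbTE; rewrite -val_eqE/= inordK// -lt0n.
Qed.

Let ord_range (k : 'I_n.+1) : k != ord0 -> (1 <= k <= n)%N.
Proof. by rewrite -val_eqE/= -lt0n => ->; rewrite -ltnS ltn_ord. Qed.

Definition vfield X (i : state) : R :=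
  let: (j, v, k) := i in
  if k == ord0 then 0 else if v then
    (if j then acc_th else acc_w) c n k (coeffs false false X) (coeffs true false X)
  else X (j, true, k).

Lemma vfield_growth : exists2 C, 0 < C & forall X, norm1 (vfield X) <= C * (1 + norm1 X).
Proof.
have [[C1 C10 g1] _] := tame_acc_w c n; have [[C2 C20 g2] _] := tame_acc_th c n.
(* The 1 inside accounts for the position slots, the factor 2 for the two masses, each at most
   [norm1 X]; the final 1 makes the constant positive. *)
exists (#|state|%:R * (1 + 2 * (C1 + C2)) + 1) => [|X].
  by rewrite ltr_wpDl// mulr_ge0// addr_ge0// mulr_ge0// addr_ge0.
have N0 := norm1_ge0 X.
apply: (@le_trans _ _ (#|state|%:R * ((1 + 2 * (C1 + C2)) * (1 + norm1 X)))); last first.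
  by rewrite [leRHS]mulrDl mul1r -mulrA lerDl addr_ge0.
apply: norm1_le => -[[j v] k]; rewrite /vfield.
have h0 : 0 <= (1 + 2 * (C1 + C2)) * (1 + norm1 X).
  by rewrite mulr_ge0// addr_ge0// mulr_ge0// addr_ge0.
case: ifPn => [_|/ord_range kn]; first by rewrite normr0.
have m1 := mass_coeffs false false X; have m2 := mass_coeffs true false X.
have CN0 : 0 <= C1 * norm1 X by exact: mulr_ge0.
have CN1 : 0 <= C2 * norm1 X by exact: mulr_ge0.
have key (C : R) : 0 <= C -> C <= C1 + C2 ->
    C * (1 + (mass n (coeffs false false X) + mass n (coeffs true false X))) <=
    (1 + 2 * (C1 + C2)) * (1 + norm1 X).
  move=> C0 CC; apply: (@le_trans _ _ (C * (1 + (norm1 X + norm1 X)))).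
    by apply: ler_wpM2l => //; rewrite lerD2l lerD.
  apply: (@le_trans _ _ ((C1 + C2) * (1 + (norm1 X + norm1 X)))).
    by apply: ler_wpM2r => //; rewrite !addr_ge0.
  by move: (norm1 X) N0 h0 CN0 CN1 => N *; lra.
case: v; last first.
  by apply: le_trans (le_norm1 X _) _; move: (norm1 X) N0 h0 CN0 CN1 => N *; lra.
case: j.
  by apply: le_trans (g2 _ _ _ kn) _; apply: key => //; rewrite lerDr.
by apply: le_trans (g1 _ _ _ kn) _; apply: key => //; rewrite lerDl.
Qed.

Lemma vfield_lipschitz (B : R) : exists2 K, 0 < K & forall X Y, norm1 X <= B -> norm1 Y <= B ->
  norm1 (fun i => vfield X i - vfield Y i) <= K * norm1 (fun i => X i - Y i).
Proof.
have [_ /(_ B)[K1 K10 h1]] := tame_acc_w c n; have [_ /(_ B)[K2 K20 h2]] := tame_acc_th c n.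
exists (#|state|%:R * (1 + 2 * (K1 + K2)) + 1) => [|X Y XB YB].
  by rewrite ltr_wpDl// mulr_ge0// addr_ge0// mulr_ge0// addr_ge0.
set Z := fun i => X i - Y i; have N0 := norm1_ge0 Z.
apply: (@le_trans _ _ (#|state|%:R * ((1 + 2 * (K1 + K2)) * norm1 Z))); last first.
  by rewrite [leRHS]mulrDl mul1r -mulrA lerDl.
apply: norm1_le => -[[j v] k]; rewrite /vfield.
have h0 : 0 <= (1 + 2 * (K1 + K2)) * norm1 Z.
  by rewrite mulr_ge0// addr_ge0// mulr_ge0// addr_ge0.
case: ifPn => [_|/ord_range kn]; first by rewrite subrr normr0.
have m1 : mass n (fun k => coeffs false false X k - coeffs false false Y k) <= norm1 Z.
  exact: mass_coeffs.
have m2 : mass n (fun k => coeffs true false X k - coeffs true false Y k) <= norm1 Z.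
  exact: mass_coeffs.
have CN0 : 0 <= K1 * norm1 Z by exact: mulr_ge0.
have CN1 : 0 <= K2 * norm1 Z by exact: mulr_ge0.
have key (K p q : R) : 0 <= K -> K <= K1 + K2 -> p <= norm1 Z -> q <= norm1 Z ->
    K * (p + q) <= (1 + 2 * (K1 + K2)) * norm1 Z.
  move=> C0 CC pN qN; apply: (@le_trans _ _ (K * (norm1 Z + norm1 Z))).
    by apply: ler_wpM2l => //; rewrite lerD.
  apply: (@le_trans _ _ ((K1 + K2) * (norm1 Z + norm1 Z))).
    by apply: ler_wpM2r => //; rewrite addr_ge0.
  by move: (norm1 Z) N0 h0 CN0 CN1 => N *; lra.
have mX j' v' := le_trans (mass_coeffs j' v' X) XB.
have mY j' v' := le_trans (mass_coeffs j' v' Y) YB.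
case: v; last first.
  apply: le_trans (le_norm1 Z (j, true, k)) _.
  by move: (norm1 Z) N0 h0 CN0 CN1 => N *; lra.
case: j.
  by apply: le_trans (h2 _ _ _ _ _ kn _ _ _ _) _ => //; apply: key => //; rewrite lerDr.
by apply: le_trans (h1 _ _ _ _ _ kn _ _ _ _) _ => //; apply: key => //; rewrite lerDl.
Qed.

(** Difference quotients are taken within [D], hence one-sided at its end points: this is the
    differentiability that X_T provides. *)
Definition trajectory (y : R -> state -> R) : Prop := forall t i, D t ->
  rate (y ^~ i) t s @[s --> within D t^'] --> vfield (y t) i.

(** Both trajectories are continuous on the compact [0, t], hence bounded, so one local Lipschitz
    constant serves for Gronwall's inequality. *)
Lemma vfield_unique (y y' : R -> state -> R) t : D t ->
  trajectory y -> trajectory y' -> (forall i, y 0 i = y' 0 i) -> forall i, y t i = y' t i.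
Proof.
move=> Dt Hy Hy'; have t0 := time_domain_ge0 Dt.
have Ds s : 0 <= s <= t -> D s by case/andP; exact: time_domain_le.
have cont z (Hz : trajectory z) i :
    {within `[0, t], continuous (z ^~ i)}.
  apply/subspace_continuousP => s /=; rewrite in_itv/= => st.
  apply/cvgrPdist_le => e e0; have [r r0 rP] := rate_continuous (Hz s i (Ds s st)) e0.
  rewrite near_withinE; exists r => // u /= su; rewrite in_itv/= => ut.
  by rewrite distrC; apply: rP; [exact: Ds|rewrite distrC].
have derive z (Hz : trajectory z) s i :
    0 < s < t -> is_derive s 1 (z ^~ i) (vfield (z s) i).
  move=> /andP[s0 st]; apply: (@rate_is_derive _ D _ _ _ (Num.min s (t - s))).
  - by rewrite lt_min s0 subr_gt0.
  - move=> u; rewrite lt_min !ltr_norml => us; apply: Ds; lra.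
  - by apply: Hz; apply: Ds; rewrite !ltW.
have bounded z (Hz : trajectory z) :
    exists B, forall s, 0 <= s <= t -> norm1 (z s) <= B.
  have cz : {within `[0, t], continuous (fun s => norm1 (z s))}.
    apply/subspace_continuousP => s st; apply: cvg_bigsum => i; apply: cvg_norm.
    by have /subspace_continuousP/(_ s st) := cont z Hz i.
  by have [m _ mP] := EVT_max t0 cz; exists (norm1 (z m)) => s st; apply: mP; rewrite in_itv.
have [B HB] := bounded y Hy; have [B' HB'] := bounded y' Hy'.
have [K K0 lipK] := vfield_lipschitz (Num.max B B').
apply: (gronwall_unique t0 (ltW K0) (cont y Hy) (cont y' Hy') (derive y Hy) (derive y' Hy')) => s /andP[s0 st].
by apply: lipK; rewrite le_max (HB, HB') ?orbT// !ltW.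
Qed.

Variables w0 th0 w1 th1 : R -> R.

Definition initial_state (i : state) : R :=
  let: (j, v, k) := i in
  if k == ord0 then 0 else
  ip2 L (if v then (if j then th1 else w1) else (if j then th0 else w0)) (e_ L k).

(** The velocity slots are filled with the derivatives extracted from X_T and the slots [k = 0] with
    0, so that any two solutions share the full initial state. *)
Lemma galerkin_state w th : galerkin_solution c n T w0 th0 w1 th1 w th ->
  exists y : R -> state -> R,
  [/\ expansion L D n (fun k t => coeffs false false (y t) k) w,
      expansion L D n (fun k t => coeffs true false (y t) k) th,
      trajectory y &
      forall i, y 0 i = initial_state i].
Proof.
move=> [Xw Xth [wk [thk [Ew Eth eqw eqth init]]]].
have [b1 [b2 Hb]] := XT_expansion_derivable L0 Xw Ew.
have [d1 [d2 Hd]] := XT_expansion_derivable L0 Xth Eth.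
pose y t (i : state) := let: (j, v, k) := i in
  if k == ord0 then 0 else
  if v then (if j then d1 t k else b1 t k) else (if j then thk k t else wk k t).
have yw t k : (1 <= k <= n)%N -> coeffs false false (y t) k = wk k t.
  by move=> kn; rewrite /coeffs /y inord0// inordK//; case/andP: kn.
have yth t k : (1 <= k <= n)%N -> coeffs true false (y t) k = thk k t.
  by move=> kn; rewrite /coeffs /y inord0// inordK//; case/andP: kn.
have E1 : expansion L D n (fun k t => coeffs false false (y t) k) w.
  by move=> t x Dt xL; rewrite Ew// !big_nat; apply: eq_bigr => k kn; rewrite yw.
have E2 : expansion L D n (fun k t => coeffs true false (y t) k) th.
  by move=> t x Dt xL; rewrite Eth// !big_nat; apply: eq_bigr => k kn; rewrite yth.
have wE t : D t -> forall x, 0 <= x <= L -> w t x = modal L n (coeffs false false (y t)) x.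
  by move=> Dt x xL; rewrite E1.
have thE t : D t -> forall x, 0 <= x <= L -> th t x = modal L n (coeffs true false (y t)) x.
  by move=> Dt x xL; rewrite E2.
exists y; split => // [t [[j v] k] Dt|[[j v] k]]; rewrite /vfield /initial_state.
  case: ifPn => [k0|k0].
    by rewrite /rate /y k0; under eq_fun do rewrite subrr mulr0; exact: cvg_cst.
  have kn := ord_range k0.
  have [Hb1 Hb2] := Hb t k Dt kn; have [Hd1 Hd2] := Hd t k Dt kn.
  rewrite /y (negbTE k0); case: v; case: j => //.
  - by rewrite -(equation_th (wE t Dt) (thE t Dt) (d2 t k) kn).1//
        -(ip2_second_dt L0 T0 Eth Hd Dt kn); exact: eqth.
  - by rewrite -(equation_w (wE t Dt) (thE t Dt) (b2 t k) kn).1//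
        -(ip2_second_dt L0 T0 Ew Hb Dt kn); exact: eqw.
rewrite /y; case: ifPn => // /ord_range kn.
have D0 := time_domain0 T0; have [i1 i2 i3 i4] := init k kn.
have [Hb1 _] := Hb 0 k D0 kn; have [Hd1 _] := Hd 0 k D0 kn.
by case: v; case: j => //; [rewrite -i4 (dtE T0 D0 Hd1)|rewrite -i3 (dtE T0 D0 Hb1)].
Qed.

(** The Picard solution is defined on the whole line and follows the vector field for all
    nonnegative times, so finite and infinite [T] are handled alike, by restriction. *)
Lemma galerkin_exists : exists w th, galerkin_solution c n T w0 th0 w1 th1 w th.
Proof.
have [C C0 grow] := vfield_growth.
have [x [dx [x0E Dx cdx dxE]]] := picard_lindelof_global C0 grow vfield_lipschitz initial_state.
pose wk j k t := coeffs j false (x t) k.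
pose w j t := modal L n (coeffs j false (x t)).
have vel j k t : D t -> (1 <= k <= n)%N -> dx t (j, false, inord k) = coeffs j true (x t) k.
  by move=> /time_domain_ge0 t0 kn; rewrite dxE// /vfield inord0.
have XTw j : XT L D (w j).
  (* [XT_modal] asks for derivatives at every index; truncation makes the coefficients out of range
     constant and leaves the sum unchanged. *)
  pose trunc (f : nat -> R) k : R := if (1 <= k <= n)%N then f k else 0.
  have -> : w j = fun t => modal L n (trunc (coeffs j false (x t))).
    apply/funext => t; apply/funext => z; rewrite /w /modal !big_nat.
    by apply: eq_bigr => k kn; rewrite /trunc kn.
  apply: (@XT_modal _ _ n L0 D _ (fun t => trunc (coeffs j true (x t)))
    (fun t => trunc (fun k => dx t (j, true, inord k)))) => t k Dt; rewrite /trunc; case kn: (1 <= k <= n)%N.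
  - by rewrite -vel//; exact: Dx.
  - exact: is_derive_cst.
  - exact: Dx.
  - exact: is_derive_cst.
  - exact: cdx.
  - exact: cst_continuous.
have Hb j t k : D t -> (1 <= k <= n)%N ->
     rate (wk j k) t s @[s --> within D t^'] --> coeffs j true (x t) k /\
     rate (fun s => coeffs j true (x s) k) t s @[s --> within D t^'] --> dx t (j, true, inord k).
  move=> Dt kn; split; last exact: (is_derive_rate D (Dx t (j, true, inord k))).
  by rewrite -vel//; exact: (is_derive_rate D (Dx t (j, false, inord k))).
have Ew j : expansion L D n (wk j) (w j) by [].
have acc j r t : D t -> (1 <= r <= n)%N ->
    ip2 L (fun z => dt D (dt D (w j ^~ z)) t) (e_ L r) =
    (if j then acc_th else acc_w) c n r (coeffs false false (x t)) (coeffs true false (x t)).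
  move=> Dt rn; rewrite (ip2_second_dt L0 T0 (Ew j) (Hb j) Dt rn) (dxE _ (time_domain_ge0 Dt)).
  by rewrite /vfield inord0// inordK//; case/andP: rn.
have D0 := time_domain0 T0.
have init j v k : (1 <= k <= n)%N -> coeffs j v (x 0) k =
    ip2 L (if v then (if j then th1 else w1) else (if j then th0 else w0)) (e_ L k).
  by move=> kn; rewrite x0E /coeffs /initial_state inord0// inordK//; case/andP: kn.
exists (w false), (w true); split; [exact: XTw|exact: XTw|].
exists (wk false), (wk true); split; [exact: Ew|exact: Ew| | |].
- move=> r t rn Dt.
  by apply: (equation_w (fun _ _ => erefl) (fun _ _ => erefl) _ rn).2; exact: acc.
- move=> r t rn Dt.
  by apply: (equation_th (fun _ _ => erefl) (fun _ _ => erefl) _ rn).2; exact: acc.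
- move=> k kn; have [Hw _] := Hb false 0 k D0 kn; have [Hth _] := Hb true 0 k D0 kn.
  split; [exact: init|exact: init| | ].
  + by rewrite (dtE T0 D0 Hw); exact: init.
  + by rewrite (dtE T0 D0 Hth); exact: init.
Qed.

Lemma galerkin_unique w th w' th' : galerkin_solution c n T w0 th0 w1 th1 w th ->
  galerkin_solution c n T w0 th0 w1 th1 w' th' ->
  forall t x, D t -> x \in `[0, L] -> w' t x = w t x /\ th' t x = th t x.
Proof.
move=> /galerkin_state[y [Ew Eth yD y0]] /galerkin_state[y' [Ew' Eth' yD' y0']] t x Dt xL.
have yy' : y' t = y t.
  by apply/funext => i; apply: (vfield_unique Dt yD' yD) => k; rewrite y0 y0'.
by rewrite Ew// Eth// Ew'// Eth'// yy'.
Qed.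

End galerkin_ode.

Theorem theorem4p2 (R : realType) (c : constants R) (n : nat) (T : \bar R)
    (hn : (1 <= n)%N) (hT : (0 < T)%E)
    (w0 th0 w1 th1 : R -> R)
    (hw0 : H2H10 (cL c) w0) (hth0 : H2H10 (cL c) th0)
    (hw1 : L2 (cL c) w1) (hth1 : L2 (cL c) th1) :
  exists w th : R -> R -> R,
    galerkin_solution c n T w0 th0 w1 th1 w th /\
    forall w' th' : R -> R -> R,
      galerkin_solution c n T w0 th0 w1 th1 w' th' ->
      forall t x, time_domain T t -> x \in `[0, cL c] ->
        w' t x = w t x /\ th' t x = th t x.
Proof.
have [w [th sol]] := galerkin_exists c n hT w0 th0 w1 th1.
by exists w, th; split=> // w' th'; exact: galerkin_unique sol.
Qed.
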